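(* There exists a constant $C>0$ such that for all integers $N\ge3$, $$C^{-1}(\log N)^{3/4}\le\mathbb E[\mathfrak S_N]\le\mathbb E[\mathcal S_N]\le C(\log N)^{3/4}.$$
   Context: Let $\{h_v:v\in\mathbb Z^2\}$ be i.i.d. standard Gaussian random variables. Let $\Lambda_N=\{v\in\mathbb Z^2:|v|_\infty\le N\}$, and consider $\mathbb Z^2$ with its nearest-neighbor graph structure. $\mathcal A_N$ is the collection of all connected subsets of $\Lambda_N$ (lattice animals) containing the origin, and $\mathfrak A_N\subset\mathcal A_N$ is the collection of those which are simply connected, i.e. connected sets $A$ that disconnect no vertex of $\mathbb Z^2\setminus A$ from infinity ($\mathbb Z^2\setminus A$ is connected in the nearest-neighbor graph). For a finite $A\subset\mathbb Z^2$, $|\partial A|$ is the number of nearest-neighbor edges with exactly one endpoint in $A$. Define $$\mathcal S_N=\max_{A\in\mathcal A_N}\frac{\sum_{v\in A}h_v}{|\partial A|},\qquad \mathfrak S_N=\max_{A\in\mathfrak A_N}\frac{\sum_{v\in A}h_v}{|\partial A|}.$$ *)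

(* Defs.v *)
From mathcomp Require Import all_boot all_order all_algebra finmap.
From mathcomp Require Import all_classical all_reals all_analysis.
From mathcomp Require Import zify.

Set Implicit Arguments.
Unset Strict Implicit.
Unset Printing Implicit Defensive.

Import Order.TTheory GRing.Theory Num.Theory.
Import numFieldNormedType.Exports.

Local Open Scope classical_set_scope.
Local Open Scope ring_scope.

Notation Z2 := (int * int)%type.

Definition origin : Z2 := (0, 0).

Definition supnorm (v : Z2) : int := Num.max `|v.1| `|v.2|.

Definition neighbors (v : Z2) : {fset Z2} :=
  [fset (v.1 + 1, v.2)%R; (v.1 - 1, v.2)%R;
        (v.1, v.2 + 1)%R; (v.1, v.2 - 1)%R]%fset.

Definition adjacent : rel Z2 := fun u v => v \in neighbors u.

Lemma adjacentE (u v : Z2) :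
  adjacent u v = (`|u.1 - v.1| + `|u.2 - v.2| == 1).
Proof.
by case: u v => [a b] [c d]; rewrite /adjacent !inE /= !xpair_eqE; lia.
Qed.

Definition connected_in (S : {pred Z2}) : Prop :=
  {in S &, forall u v, exists p : seq Z2,
    [/\ path adjacent u p, all [in S] p & last u p = v]}.

Definition animals (N : nat) : set {fset Z2} :=
  [set A | [/\ {in A, forall v, supnorm v <= N%:Z},
               origin \in A & connected_in [in A]]].

Definition simply_connected_animals (N : nat) : set {fset Z2} :=
  [set A | animals N A /\ connected_in [predC A]].

(* An undirected edge is the two-element set of its endpoints. *)
Definition edge_boundary (A : {fset Z2}) : {fset {fset Z2}} :=
  [fset [fset v; w] | v in A, w in neighbors v & w \notin A]%fset.

Definition ratio (R : realType) (x : Z2 -> R) (A : {fset Z2}) : R :=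
  (\sum_(v <- A) x v) / #|` edge_boundary A|%:R.

(* By max_ratioP below, this is a maximum when F is a nonempty subfamily of
   animals N; both families above contain the singleton of the origin. *)
Definition max_ratio (R : realType) (F : set {fset Z2}) (x : Z2 -> R) : R :=
  sup [set ratio x A | A in F].

Lemma finite_animals (N : nat) : finite_set (animals N).
Proof.
pose r : seq int := [seq i%:Z - N%:Z | i <- iota 0 (N + N).+1].
pose box : {fset Z2} := [fset v in [seq (a, b) | a <- r, b <- r]]%fset.
have rP (a : int) : `|a| <= N%:Z -> a \in r.
  move=> aN; apply/mapP; exists (absz (a + N%:Z)); last by lia.
  by rewrite mem_iota; lia.
apply: (@sub_finite_set _ _ [set` fpowerset box]); last exact: finite_fset.
move=> A [AN _ _] /=; rewrite fpowersetE; apply/fsubsetP => -[a b] /AN.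
rewrite /supnorm /= ge_max => /andP[aN bN].
have ab : (a, b) \in [seq (x, y) | x <- r, y <- r].
  by apply: (allpairs_f pair); exact: rP.
by apply/imfsetP; exists (a, b).
Qed.

Lemma max_ratioP (R : realType) (N : nat) (F : set {fset Z2}) (x : Z2 -> R) :
  F `<=` animals N -> F !=set0 ->
  (exists2 A, F A & max_ratio F x = ratio x A) /\
  (forall A, F A -> ratio x A <= max_ratio F x).
Proof.
move=> FN [A0 FA0].
have Ffin : finite_set F by apply: sub_finite_set FN _; exact: finite_animals.
pose S := [set ratio x A | A in F].
have Sfin : finite_set S by exact: finite_image.
have S0 : S !=set0 by exists (ratio x A0), A0.
have [m Sm mP] : exists2 m, S m & ubound S m.
  have /finite_seqP[s Ss] := Sfin.
  have ms y : y \in s -> y <= \big[Num.max/ratio x A0]_(z <- s) z.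
    by move=> ys; exact: le_bigmax_seq.
  exists (\big[Num.max/ratio x A0]_(z <- s) z).
    rewrite big_seq; apply: (big_ind S).
    - by exists A0.
    - by move=> a b Sa Sb; case: (leP a b).
    - by move=> y ys; rewrite Ss.
  by rewrite Ss => y /= /ms.
have maxE : max_ratio F x = m.
  apply/eqP; rewrite eq_le; apply/andP; split; first exact: ge_sup.
  by apply: ub_le_sup => //; exists m.
split; first by case: Sm => A FA <- in maxE *; exists A.
by move=> A FA; rewrite maxE; apply: mP; exists A.
Qed.

Local Open Scope ereal_scope.

Definition independent_family d (T : measurableType d) (R : realType)
    (P : probability T R) (I : choiceType) (X : I -> {RV P >-> R}) : Prop :=
  forall (J : {fset I}) (B : I -> set R),
    (forall i, measurable (B i)) ->
    P (\bigcap_(i in [set` J]) (X i @^-1` B i)) =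
    \prod_(i <- J) P (X i @^-1` B i).

Definition iid_standard_gaussian d (T : measurableType d) (R : realType)
    (P : probability T R) (I : choiceType) (X : I -> {RV P >-> R}) : Prop :=
  independent_family X /\
  forall i (B : set R), measurable B ->
    distribution P (X i) B = normal_prob 0%R 1%R B.

Definition greedy_animal d (T : measurableType d) (R : realType)
    (P : probability T R) (h : Z2 -> {RV P >-> R}) (N : nat) : T -> R :=
  fun t => max_ratio (animals N) (fun v => h v t).

Definition greedy_simply_connected_animal d (T : measurableType d)
    (R : realType) (P : probability T R) (h : Z2 -> {RV P >-> R}) (N : nat) :
    T -> R :=
  fun t => max_ratio (simply_connected_animals N) (fun v => h v t).

(* Main.v *)
(* Lower bound. Let 16^c be of order log N.  Subgraph animals of width 2^K <= N
   are built dyadically: at every other scale 2^j, the profile may or may not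
   receive a triangular bump of height 2^j / 4^c.  The cells S added by the bump
   number about 4^j / 4^c, and accepting the bump exactly when they have a
   positive sum gains E[h(S)^+], of order 2^j / 2^c, without biasing the field
   elsewhere.  The squared slopes of the bumps add up to at most K 2^K before the
   division by 4^c, so the perimeter stays of order 2^K, while the total gain is
   of order 2^K K / 2^c: the ratio is of order K^(3/4).

   Upper bound. The sum of w h is bounded by the total variation of w for every
   integer weight w.  Clipping w and splitting off cycles of its boundary reduce
   this to windings, with values in {-1, 0, 1}, of closed walks.  A closed walk of
   length 2^K is approximated by polygons with 2^(K-k) vertices on a grid of mesh
   2^k / 4^c, for k = K, ..., 0.  By the parallelogram identity the midpoint
   deviations at all scales have bounded total energy, which controls at the same
   time the area between consecutive polygons, hence the variance of the
   increment, and the cost of coding the finer polygon given the coarser one.  A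
   single partition function Z, the sum over all codes of
   exp (l X - l^2 Var X / 2 - cost), has a mean polynomial in N and bounds all the
   increments X simultaneously; summing them over the scales gives
   2^K ((ln Z + K) / 2^c + 8^c), again of order (log N)^(3/4) per unit length. *)
From HB Require Import structures.
Require Import Defs.
From mathcomp Require Import all_boot all_order all_algebra finmap.
From mathcomp Require Import all_classical all_reals all_analysis.
From mathcomp Require Import measurable_realfun.
From mathcomp Require Import zify lra.

Set Implicit Arguments.
Unset Strict Implicit.
Unset Printing Implicit Defensive.

Import Order.TTheory GRing.Theory Num.Theory.
Import numFieldNormedType.Exports.
(* [adjacent] is shadowed by the analysis library. *)
Import Defs.

Local Open Scope classical_set_scope.
Local Open Scope ring_scope.

(** * Independent Gaussian variables *)

(** Both bounds rest on one balance. Bends of slope [4^-c] at each of [K] scales add up to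
    [K / 16^c] of squared slope per unit length. The least [c] with [K <= 16^c] keeps this bounded,
    and then [K / 2^c] and [8^c] are both of order [K^(3/4)].

    In the lower bound, the sites that decide a bump must play no part in any other choice on that
    interval. Bumps at every other scale make room for this: finer bumps raise a profile by at most
    a third of the height of the next one, while that one rises by at least half its height over its
    middle half. The strip in between depends on this bump alone.

    In the upper bound, one piece of a walk may bend by as much as its own length, so counting the
    refinements of a level uniformly costs too much. Only the squared deviations summed over all
    scales are bounded. Hence a code pays for its actual displacements, and the inequality
    [a x <= a^3 x^2 / (2 w) + w / (2 a)] with [a = 2^c] trades each payment for energy. The
    approximating polygons may wind several times around a cell; clipping their weights keeps the
    variance of an increment below twice the area swept. *)

Section normal_mgf.
Variable R : realType.
Local Notation mu := (@lebesgue_measure R).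
Local Notation gamma := (normal_prob (0 : R) 1).
Local Open Scope ereal_scope.

(** The Radon-Nikodym derivative of [gamma] and the explicit density have equal integrals over
    measurable sets, so they agree almost everywhere. *)
Lemma ge0_integral_normal_prob (f : R -> \bar R) :
  measurable_fun setT f -> (forall x, 0 <= f x) ->
  \int[gamma]_x f x = \int[mu]_x (f x * (normal_pdf 0 1 x)%:E).
Proof.
move=> mf f0.
have dom := normal_prob_dominates (0 : R)%R 1%R.
rewrite -(Radon_Nikodym_SigmaFinite.change_of_variables dom)//=.
have mpdf : measurable_fun setT (EFin \o normal_pdf (0 : R) 1).
  by apply/measurable_EFinP; exact: measurable_normal_pdf.
have irn := Radon_Nikodym_SigmaFinite.f_integrable dom.
apply: ae_eq_integral => //.
- by apply: emeasurable_funM => //; apply: (measurable_int mu).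
- exact: emeasurable_funM.
- apply: ae_eqe_mul2l => /=; apply: integral_ae_eq => //=.
  by move=> E _ mE; rewrite -Radon_Nikodym_SigmaFinite.f_integral.
Qed.

(** Completing the square turns the tilted density into the density centred at [t]. *)
Lemma normal_mgf (t : R) :
  \int[gamma]_x (expR (t * x))%:E = (expR (t ^+ 2 / 2))%:E.
Proof.
rewrite ge0_integral_normal_prob; last 2 first.
- apply/measurable_EFinP/measurableT_comp => //.
- by move=> x; rewrite lee_fin expR_ge0.
have pdfE (x : R) : (expR (t * x) * normal_pdf 0 1 x =
    expR (t ^+ 2 / 2) * normal_pdf t 1 x)%R.
  rewrite !normal_pdfE ?oner_neq0// mulrCA [RHS]mulrCA; congr (_ * _)%R.
  by rewrite /normal_fun -!expRD; congr expR; lra.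
under eq_integral => x _ do rewrite -EFinM pdfE EFinM.
rewrite ge0_integralZl ?integral_normal_pdf ?mule1//.
- by apply/measurable_EFinP; exact: measurable_normal_pdf.
- by move=> x _; rewrite lee_fin normal_pdf_ge0.
Qed.

End normal_mgf.

Section independence.
Context d (T : measurableType d) (R : realType) (P : probability T R).
Variables (I : choiceType) (h : I -> {RV P >-> R}).
Hypothesis indep : independent_family h.

(** The pi-system that generates the sigma-algebra of the coordinates in [J]. *)
Definition cylinder (J : {fset I}) : set (set T) :=
  [set A | exists2 B : I -> set R, (forall i, measurable (B i)) &
     A = \bigcap_(i in [set` J]) (h i @^-1` B i)].

Lemma cylinder_setI_closed J : setI_closed (cylinder J).
Proof.
move=> _ _ [B mB ->] [C mC ->]; exists (fun i => B i `&` C i).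
  by move=> i; exact: measurableI.
rewrite predeqE => t; split.
  by move=> [Bt Ct] i Ji; split; [exact: Bt|exact: Ct].
by move=> BC; split=> i Ji; have [] := BC i Ji.
Qed.

Lemma cylinder_measurable J : cylinder J `<=` measurable.
Proof.
move=> _ [B mB ->]; apply: fin_bigcap_measurable; first exact: finite_fset.
by move=> i _; rewrite -[X in measurable X]setTI; exact: measurable_funPT.
Qed.

Lemma cylinderT J : cylinder J setT.
Proof.
by exists (fun=> setT); rewrite // predeqE.
Qed.

Lemma sigma_cylinder_measurable J : <<s cylinder J >> `<=` measurable.
Proof.
apply: smallest_sub; first exact: sigma_algebra_measurable.
exact: cylinder_measurable.
Qed.

Lemma cylinder_indep J K A B : [disjoint J & K]%fset ->
  cylinder J A -> cylinder K B -> P (A `&` B) = (P A * P B)%E.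
Proof.
move=> JK [A' mA ->] [B' mB ->].
pose C i := if i \in J then A' i else B' i.
have mC i : measurable (C i) by rewrite /C; case: ifP.
have KJ i : i \in K -> (i \in J) = false.
  by move=> iK; apply/negP => iJ; have /fdisjointP/(_ _ iJ) := JK; rewrite iK.
rewrite (_ : _ `&` _ = \bigcap_(i in [set` (J `|` K)%fset]) (h i @^-1` C i)).
  rewrite (indep _ mC) (indep J mA) (indep K mB).
  rewrite (perm_big (enum_fset J ++ enum_fset K)) /=; last first.
    apply: uniq_perm; rewrite ?fset_uniq// ?cat_uniq ?fset_uniq//= ?andbT.
      by apply/hasPn => i /KJ /= ->.
    by move=> i; rewrite mem_cat in_fsetU.
  rewrite big_cat /=; congr (_ * _)%E; apply: eq_big_seq => i iJ.
    by rewrite /C iJ.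
  by rewrite /C KJ.
rewrite predeqE => t; split.
  move=> [At Bt] i /=; rewrite in_fsetU /C => iJK.
  by case: ifPn iJK => [iJ _|_ iK]; [exact: At|exact: Bt].
move=> Ct; split=> i /= iJ; have /= := Ct i.
  by rewrite in_fsetU iJ /C iJ; exact.
by rewrite in_fsetU iJ orbT /C KJ//; exact.
Qed.

(** With [B] fixed, both sides are finite measures in [A] that agree on the pi-system [G]. Applied
    twice, this enlarges the two factors one after the other. *)
Let indep_aux (G : set (set T)) (B : set T) :
  setI_closed G -> G setT -> G `<=` measurable -> measurable B ->
  (forall A, G A -> P (A `&` B) = (P A * P B)%E) ->
  forall A, <<s G >> A -> P (A `&` B) = (P A * P B)%E.
Proof.
move=> GI GT Gm mB GB A sA.
have PB0 : (0 <= fine (P B))%R by exact: fine_ge0.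
pose m1 := mrestr P mB.
pose m2 := mscale (NngNum PB0) P.
have m2E C : m2 C = (P C * P B)%E.
  by rewrite /m2 /mscale /= fineK ?fin_num_measure// muleC.
rewrite -[LHS]/(m1 A) -m2E.
apply: (g_sigma_algebra_measure_unique G Gm (fun=> setT)) => //.
- by rewrite predeqE => t; split=> // _; exists 0%N.
- by move=> C GC; rewrite [LHS]GB// -m2E.
- move=> _; apply: le_lt_trans (ltry 1); apply: probability_le1.
  exact: measurableI.
Qed.

Lemma sigma_cylinder_indep J K A B : [disjoint J & K]%fset ->
  <<s cylinder J >> A -> <<s cylinder K >> B -> P (A `&` B) = (P A * P B)%E.
Proof.
move=> JK sA sB.
apply: (indep_aux (@cylinder_setI_closed J) (cylinderT J)
  (@cylinder_measurable J)) sA; first exact: sigma_cylinder_measurable sB.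
move=> C cC; rewrite setIC muleC.
apply: (indep_aux (@cylinder_setI_closed K) (cylinderT K)
  (@cylinder_measurable K)) sB; first exact: cylinder_measurable cC.
by move=> D cD; rewrite setIC muleC; exact: cylinder_indep cC cD.
Qed.

Definition determined (J : {fset I}) (X : T -> R) :=
  @measurable_fun _ _ (g_sigma_algebraType (cylinder J)) R setT X.

Lemma determined_measurable J X : determined J X -> measurable_fun setT X.
Proof.
move=> mX _ B mB; have := mX measurableT B mB.
exact: sigma_cylinder_measurable.
Qed.

Lemma determined_coord J i : i \in J -> determined J (h i).
Proof.
move=> iJ _ B mB; apply: sub_sigma_algebra; rewrite setTI.
exists (fun j => if j == i then B else setT).
  by move=> j; case: ifP.
rewrite predeqE => t; split=> [Bt j /= _|/(_ i iJ)]; last by rewrite eqxx.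
by case: eqP => [->|].
Qed.

Lemma sub_determined J K X : (J `<=` K)%fset ->
  determined J X -> determined K X.
Proof.
move=> JK dX _ B mB; have {dX} := dX measurableT B mB.
apply: smallest_sub; first exact: smallest_sigma_algebra.
move=> _ [C mC ->]; apply: sub_sigma_algebra.
exists (fun j => if j \in J then C j else setT); first by move=> j; case: ifP.
rewrite predeqE => t; split=> Ct j /= jJ.
  by case: ifPn => // jJ'; exact: Ct.
by have /= := Ct j (fsubsetP JK _ jJ); rewrite jJ.
Qed.

Lemma determined_indep J K X Y : [disjoint J & K]%fset ->
  determined J X -> determined K Y ->
  (forall t, 0 <= X t) -> (forall t, 0 <= Y t) ->
  (\int[P]_t (X t * Y t)%:E = \int[P]_t (X t)%:E * \int[P]_t (Y t)%:E)%E.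
Proof.
move=> JK dX dY X0 Y0.
have mX := determined_measurable dX; have mY := determined_measurable dY.
pose XY t := (X t, Y t).
have mXY : measurable_fun setT XY by exact: measurable_fun_pair.
pose X' : {RV P >-> R} := HB.pack X (isMeasurableFun.Build _ _ _ _ _ mX).
pose Y' : {RV P >-> R} := HB.pack Y (isMeasurableFun.Build _ _ _ _ _ mY).
(* The absolute values make the integrand nonnegative on the whole plane, as Tonelli requires, and
   change nothing on the range of the pair. *)
pose g (z : R * R) := (`|z.1| * `|z.2|)%:E.
have mg : measurable_fun setT g.
  apply/measurable_EFinP; apply: measurable_funM; apply: measurableT_comp => //.
have g0 z : (0 <= g z)%E by rewrite lee_fin mulr_ge0.
rewrite (_ : (\int[P]_t _ = \int[P]_t (g \o XY) t)%E); last first.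
  by apply: eq_integral => t _; rewrite /g /= !ger0_norm.
pose XY' : {RV P >-> (R * R)%type} :=
  HB.pack XY (isMeasurableFun.Build _ _ _ _ _ mXY).
rewrite -(@ge0_integral_distribution _ _ _ _ _ P XY')//.
pose m1 := distribution P X'; pose m2 := distribution P Y'.
rewrite (eq_measure_integral (m1 \x m2)%E); last first.
  move=> A mA _; apply/esym; apply: product_measure_unique => // B C mB mC.
  have := sigma_cylinder_indep JK (dX measurableT B mB) (dY measurableT C mC).
  by rewrite !setTI.
rewrite fubini_tonelli1// /fubini_F.
transitivity (\int[m1]_x \int[m2]_y (`|x|%:E * `|y|%:E))%E.
  by apply: eq_integral => x _; apply: eq_integral => y _; rewrite -EFinM.
have mabs : measurable_fun [set: R] (fun x : R => `|x|%:E).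
  by apply/measurable_EFinP; exact: normr_measurable.
transitivity (\int[m1]_x (`|x|%:E * \int[m2]_y `|y|%:E))%E.
  by apply: eq_integral => x _; rewrite ge0_integralZl_EFin.
rewrite ge0_integralZr//=; last by apply: integral_ge0.
congr (_ * _)%E; rewrite ge0_integral_distribution//;
  by apply: eq_integral => t _; rewrite /= ger0_norm.
Qed.

End independence.

Section real_expectation.
Context d (T : measurableType d) (R : realType) (P : probability T R).
Implicit Types X Y : T -> R.

Definition summable X := P.-integrable setT (EFin \o X).

Definition mean X : R := \int[P]_t X t.

Lemma summable_measurable X : summable X -> measurable_fun setT X.
Proof. by move=> /integrableP[/measurable_EFinP]. Qed.

Lemma summableD X Y : summable X -> summable Y -> summable (fun t => X t + Y t).
Proof. by move=> sX sY; exact: (integrableD measurableT sX sY). Qed.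

Lemma summableZ a X : summable X -> summable (fun t => a * X t).
Proof. by move=> sX; exact: (integrableZl measurableT a sX). Qed.

Lemma summable_cst a : summable (fun=> a).
Proof. exact: finite_measure_integrable_cst. Qed.

Lemma summable_sum (I : Type) (s : seq I) (X : I -> T -> R) :
  (forall i, summable (X i)) -> summable (fun t => \sum_(i <- s) X i t).
Proof.
move=> sX; elim: s => [|i s IHs].
  by under eq_fun do rewrite big_nil; exact: summable_cst.
by under eq_fun do rewrite big_cons; exact: summableD.
Qed.

Lemma le_summable X Y : measurable_fun setT X -> (forall t, `|X t| <= Y t) ->
  summable Y -> summable X.
Proof.
move=> mX XY; apply: le_integrable => //; first exact/measurable_EFinP.
by move=> t _; rewrite lee_fin (le_trans (XY t))// ler_norm.
Qed.

Lemma summable_norm X : summable X -> summable (fun t => `|X t|).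
Proof. by move=> /integrable_norm. Qed.

Lemma summable_max X Y : summable X -> summable Y ->
  summable (fun t => Num.max (X t) (Y t)).
Proof.
move=> sX sY; apply: (@le_summable _ (fun t => `|X t| + `|Y t|)).
- by apply: measurable_maxr; exact: summable_measurable.
- by move=> t; rewrite maxEle; case: ifP => _; [rewrite lerDr|rewrite lerDl].
- by apply: summableD; exact: summable_norm.
Qed.

Lemma summable_ge0 X (m : \bar R) : measurable_fun setT X ->
  (forall t, 0 <= X t) -> (\int[P]_t (X t)%:E <= m)%E -> (m < +oo)%E ->
  summable X.
Proof.
move=> mX X0 Xm moo; apply/integrableP; split; first exact/measurable_EFinP.
under eq_integral => t _ do rewrite /= ger0_norm//.
exact: le_lt_trans moo.
Qed.

Lemma EFin_mean X : summable X -> (\int[P]_t (X t)%:E)%E = (mean X)%:E.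
Proof. by move=> sX; rewrite /mean /Rintegral fineK//; exact: integrable_fin_num. Qed.

Lemma expectation_mean X : summable X -> ('E_P[X] = (mean X)%:E)%E.
Proof. by move=> sX; rewrite unlock EFin_mean. Qed.

Lemma meanD X Y : summable X -> summable Y ->
  mean (fun t => X t + Y t) = mean X + mean Y.
Proof. by move=> sX sY; exact: RintegralD. Qed.

Lemma meanZ a X : summable X -> mean (fun t => a * X t) = a * mean X.
Proof. by move=> sX; exact: RintegralZl. Qed.

Lemma mean_cst a : mean (fun=> a) = a.
Proof. by rewrite /mean Rintegral_cst//= probability_setT mulr1. Qed.

Lemma mean_sum (I : Type) (s : seq I) (X : I -> T -> R) :
  (forall i, summable (X i)) ->
  mean (fun t => \sum_(i <- s) X i t) = \sum_(i <- s) mean (X i).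
Proof.
move=> sX; elim: s => [|i s IHs].
  by under eq_fun do rewrite big_nil; rewrite mean_cst big_nil.
under eq_fun do rewrite big_cons.
by rewrite big_cons -IHs meanD//; exact: summable_sum.
Qed.

Lemma le_mean X Y : summable X -> summable Y -> (forall t, X t <= Y t) ->
  mean X <= mean Y.
Proof. by move=> sX sY XY; exact: le_Rintegral. Qed.

Lemma mean_ge0 X : (forall t, 0 <= X t) -> 0 <= mean X.
Proof. by move=> X0; exact: Rintegral_ge0. Qed.

Section independent_means.
Variables (I : choiceType) (h : I -> {RV P >-> R}).
Hypothesis indep : independent_family h.

Let mean_indep_ge0 (J K : {fset I}) X Y : [disjoint J & K]%fset ->
  determined h J X -> determined h K Y ->
  (forall t, 0 <= X t) -> (forall t, 0 <= Y t) -> summable X -> summable Y ->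
  summable (fun t => X t * Y t) /\ mean (fun t => X t * Y t) = mean X * mean Y.
Proof.
move=> JK dX dY X0 Y0 sX sY.
have XYE := determined_indep indep JK dX dY X0 Y0.
rewrite (EFin_mean sX) (EFin_mean sY) in XYE; split.
  apply: (@summable_ge0 _ (mean X * mean Y)%:E); rewrite ?ltry//.
  - by apply: measurable_funM; exact: summable_measurable.
  - by move=> t; rewrite mulr_ge0.
  - by rewrite XYE -EFinM.
by rewrite /mean /Rintegral XYE -EFinM.
Qed.

(** Splitting [Y] into its positive and negative parts reduces this to the nonnegative case. In the
    applications [X] is an indicator and [Y] a field value or a maximum of sums. *)
Lemma mean_indep (J K : {fset I}) X Y : [disjoint J & K]%fset ->
  determined h J X -> determined h K Y ->
  (forall t, 0 <= X t) -> summable X -> summable Y ->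
  summable (fun t => X t * Y t) /\ mean (fun t => X t * Y t) = mean X * mean Y.
Proof.
move=> JK dX dY X0 sX sY.
pose Yp t := Num.max (Y t) 0; pose Yn t := Num.max (- 1 * Y t) 0.
have dYp : determined h K Yp by apply: measurable_maxr.
have dYn : determined h K Yn.
  by apply: measurable_maxr => //; apply: measurable_funM.
have sYp : summable Yp by apply: summable_max => //; exact: summable_cst.
have sYn : summable Yn.
  by apply: summable_max; [exact: summableZ|exact: summable_cst].
have Yp0 t : 0 <= Yp t by rewrite le_max lexx orbT.
have Yn0 t : 0 <= Yn t by rewrite le_max lexx orbT.
have [sp Ep] := mean_indep_ge0 JK dX dYp X0 Yp0 sX sYp.
have [sn En] := mean_indep_ge0 JK dX dYn X0 Yn0 sX sYn.
have YE t : Y t = Yp t + -1 * Yn t.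
  by rewrite /Yp /Yn; case: (leP (Y t) 0); case: (leP (-1 * Y t) 0); lra.
have XYE : (fun t => X t * Y t) =
    (fun t => X t * Yp t + -1 * (X t * Yn t)).
  by apply/funext => t; rewrite YE; lra.
rewrite XYE; split; first by apply: summableD => //; exact: summableZ.
rewrite meanD//; last exact: summableZ.
rewrite meanZ// Ep En (_ : Y = fun t => Yp t + -1 * Yn t); last exact/funext.
by rewrite meanD ?meanZ//; [lra|exact: summableZ].
Qed.

End independent_means.
End real_expectation.

Section gaussian_sums.
Context d (T : measurableType d) (R : realType) (P : probability T R).
Variables (I : choiceType) (h : I -> {RV P >-> R}).
Hypothesis iid : iid_standard_gaussian h.

Let indep : independent_family h := iid.1.

Lemma gaussian_mgf1 i (a : R) :
  (\int[P]_t (expR (a * h i t))%:E = (expR (a ^+ 2 / 2))%:E)%E.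
Proof.
rewrite -normal_mgf.
have mh : @measurable_fun _ _ T (measurableTypeR R) setT (h i).
  exact: (measurable_funPT (h i)).
pose X : {RV P >-> measurableTypeR R} :=
  HB.pack (h i : T -> measurableTypeR R) (isMeasurableFun.Build _ _ _ _ _ mh).
have mf : measurable_fun setT (fun x : measurableTypeR R => (expR (a * x))%:E).
  by apply/measurable_EFinP/measurableT_comp => //; exact: measurable_funM.
have f0 (x : measurableTypeR R) : (0 <= (expR (a * x))%:E)%E.
  by rewrite lee_fin expR_ge0.
rewrite -[LHS](ge0_integral_distribution X mf f0).
apply: (@eq_measure_integral _ (measurableTypeR R) R setT (normal_prob 0 1)
  (distribution P X)) => A mA _.
exact: (iid.2 i A mA).
Qed.

Lemma determined_lin (w : I -> R) (s : seq I) :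
  determined h [fset i in s]%fset (fun t => \sum_(i <- s) w i * h i t).
Proof.
elim: s => [|i s IHs].
  have -> : (fun t => \sum_(i <- [::]) w i * h i t) = cst 0.
    by apply/funext => t; rewrite big_nil.
  exact: measurable_cst.
have -> : (fun t => \sum_(j <- i :: s) w j * h j t) =
    (fun t => w i * h i t + \sum_(j <- s) w j * h j t).
  by apply/funext => t; rewrite big_cons.
apply: measurable_funD.
  apply: measurable_funM => //; apply: determined_coord.
  by rewrite !inE eqxx.
apply: sub_determined IHs; apply/fsubsetP => j; rewrite !inE => ->.
by rewrite orbT.
Qed.

Lemma measurable_lin (w : I -> R) (s : seq I) :
  measurable_fun setT (fun t => \sum_(i <- s) w i * h i t).
Proof. by apply: measurable_sum => i; exact: measurable_funM. Qed.

Lemma gaussian_mgf (w : I -> R) (s : seq I) : uniq s ->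
  (\int[P]_t (expR (\sum_(i <- s) w i * h i t))%:E =
   (expR ((\sum_(i <- s) w i ^+ 2) / 2))%:E)%E.
Proof.
elim: s => [|i s IHs] /=.
  rewrite big_nil mul0r; under eq_integral do rewrite big_nil.
  by rewrite integral_cst//= probability_setT mule1.
move=> /andP[iNs us]; rewrite big_cons mulrDl expRD EFinM -IHs// -(gaussian_mgf1 i).
under eq_integral => t _ do rewrite big_cons expRD EFinM.
apply: (determined_indep indep (J := [fset i]%fset) (K := [fset j in s]%fset)).
- by rewrite fdisjoint1X !inE.
- apply: measurableT_comp => //; apply: measurable_funM => //.
  by apply: determined_coord; rewrite inE.
- by apply: measurableT_comp => //; exact: determined_lin.
- by move=> t; exact: expR_ge0.
- by move=> t; exact: expR_ge0.
Qed.

Lemma summable_expR_lin (w : I -> R) (s : seq I) : uniq s ->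
  summable P (fun t => expR (\sum_(i <- s) w i * h i t)).
Proof.
move=> us; apply: (@summable_ge0 _ _ _ _ _ (expR ((\sum_(i <- s) w i ^+ 2) / 2))%:E).
- by apply: measurableT_comp => //; exact: measurable_lin.
- by move=> t; exact: expR_ge0.
- by rewrite gaussian_mgf.
- exact: ltry.
Qed.

Lemma mean_expR_lin (w : I -> R) (s : seq I) : uniq s ->
  mean P (fun t => expR (\sum_(i <- s) w i * h i t)) =
  expR ((\sum_(i <- s) w i ^+ 2) / 2).
Proof. by move=> us; rewrite /mean /Rintegral gaussian_mgf. Qed.

Lemma norm_le_expR (x : R) : `|x| <= expR x + expR (- x).
Proof.
have := expR_ge1Dx x; have := expR_ge1Dx (- x).
have := expR_gt0 x; have := expR_gt0 (- x).
by case: (ger0P x); lra.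
Qed.

Lemma summable_gaussian i : summable P (h i).
Proof.
apply: (@le_summable _ _ _ _ _ (fun t => expR (\sum_(j <- [:: i]) 1 * h j t)
  + expR (\sum_(j <- [:: i]) -1 * h j t))) => //.
- by move=> t; rewrite !big_seq1 mul1r mulN1r norm_le_expR.
- by apply: summableD; exact: summable_expR_lin.
Qed.

Lemma expR_le_inv (x : R) : 0 <= x -> x <= 2^-1 -> expR x <= 1 + 2 * x.
Proof.
move=> x0 x2; have := expR_ge1Dx (- x); rewrite expRN => h1.
have e0 := expR_gt0 x.
have : (1 + - x) * expR x <= 1.
  by rewrite -ler_pdivlMr// div1r.
nra.
Qed.

(** Only the Laplace transform is needed: [1 + a x <= e^(a x)] gives [a m <= e^(a^2 / 2) - 1 <= a^2]
    for [|a| <= 1], which fails at [a = m / 2], or at [a = 1] or [-1] when [m] is large, unless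
    [m = 0]. *)
Lemma mean_gaussian i : mean P (h i) = 0.
Proof.
have key (a : R) : a * mean P (h i) <= expR (a ^+ 2 / 2) - 1.
  rewrite -meanZ; last exact: summable_gaussian.
  have := @mean_expR_lin (fun=> a) [:: i] isT.
  rewrite big_seq1 => <-; rewrite lerBrDl.
  rewrite -[X in X + _](mean_cst P) -meanD; last 2 first.
  - exact: summable_cst.
  - by apply: summableZ; exact: summable_gaussian.
  apply: le_mean.
  - apply: summableD; first exact: summable_cst.
    by apply: summableZ; exact: summable_gaussian.
  - exact: summable_expR_lin.
  - by move=> t; rewrite big_seq1 expR_ge1Dx.
set m := mean P (h i) in key *.
have key2 (a : R) : -1 <= a -> a <= 1 -> a * m <= a ^+ 2.
  move=> a1 a2; apply: le_trans (key a) _.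
  have a21 : a ^+ 2 <= 1 by nra.
  have a20 := sqr_ge0 a.
  have : expR (a ^+ 2 / 2) <= 1 + 2 * (a ^+ 2 / 2) by apply: expR_le_inv; lra.
  lra.
apply/eqP; rewrite eq_le; apply/andP; split; rewrite leNgt; apply/negP => m0.
  have [m2|m2] := leP 1 (m / 2).
    have k : 1 * m <= 1 ^+ 2 by apply: key2; lra.
    lra.
  have k : (m / 2) * m <= (m / 2) ^+ 2 by apply: key2; lra.
  nra.
have [m2|m2] := leP 1 (- m / 2).
  have k : -1 * m <= (-1) ^+ 2 by apply: key2; lra.
  lra.
have k : (m / 2) * m <= (m / 2) ^+ 2 by apply: key2; lra.
nra.
Qed.

Lemma summable_lin (w : I -> R) (s : seq I) :
  summable P (fun t => \sum_(i <- s) w i * h i t).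
Proof.
by apply: summable_sum => i; apply: summableZ; exact: summable_gaussian.
Qed.

Lemma mean_lin (w : I -> R) (s : seq I) :
  mean P (fun t => \sum_(i <- s) w i * h i t) = 0.
Proof.
rewrite mean_sum; last by move=> i; apply: summableZ; exact: summable_gaussian.
by rewrite big1// => i _; rewrite meanZ ?mean_gaussian ?mulr0//;
  exact: summable_gaussian.
Qed.

(* For [y <= ln 64] convexity gives [e^y - 1 <= 64 |y|]; beyond that [e^y] is
   dominated by [e^(2y) / 64]. *)
Lemma expR_sub1_le (y : R) : expR y - 1 <= 64 * `|y| + expR (2 * y) / 64.
Proof.
have e0 := expR_gt0 y.
rewrite (_ : 2 * y = y + y); last lra.
rewrite expRD; set e := expR y in e0 *.
have [e64|e64] := leP 64 e.
  by have := normr_ge0 y; nra.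
have h1 : e * (1 - y) <= 1.
  have := expR_ge1Dx (- y); rewrite expRN -/e => h1.
  by rewrite mulrC -ler_pdivlMr// div1r.
by case: (ger0P y) => y0; nra.
Qed.

(** Let [y] be the sum divided by its standard deviation. Integrating [expR_sub1_le] with
    [E e^y = e^(1/2) >= 3/2] and [E e^(2y) = e^2 <= 16] gives [1/2 <= 64 E|y| + 1/4]. So
    [E|y| >= 1/256], and half of it is the positive part since [y] is centred. *)
Lemma mean_pos_part_ge (S : seq I) : uniq S ->
  Num.sqrt (size S)%:R / 512 <=
  mean P (fun t => Num.max (\sum_(i <- S) h i t) 0).
Proof.
case: S => [|i0 S0] uS.
  by rewrite sqrtr0 mul0r; apply: mean_ge0 => t; rewrite le_max lexx orbT.
set S := i0 :: S0 in uS *; set n : R := (size S)%:R.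
have n0 : 0 < n by rewrite ltr0n.
have rn0 : 0 < Num.sqrt n by rewrite sqrtr_gt0.
pose a := (Num.sqrt n)^-1.
have a0 : 0 < a by rewrite invr_gt0.
have a2 : a ^+ 2 * n = 1.
  by rewrite exprVn sqr_sqrtr ?ltW// mulVf// gt_eqF.
pose y t := \sum_(i <- S) a * h i t.
have yE t : y t = a * \sum_(i <- S) h i t by rewrite mulr_sumr.
have sy : summable P y by exact: summable_lin.
have my : mean P y = 0 by exact: mean_lin.
have mgf (c : R) : mean P (fun t => expR (c * y t)) = expR (c ^+ 2 / 2) /\
    summable P (fun t => expR (c * y t)).
  have cyE : (fun t => expR (c * y t)) =
      (fun t => expR (\sum_(i <- S) (c * a) * h i t)).
    apply/funext => t; congr expR; rewrite mulr_sumr.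
    by apply: eq_bigr => i _; rewrite mulrA.
  rewrite cyE; split; last exact: summable_expR_lin.
  rewrite (@mean_expR_lin (fun=> c * a))// big_const_seq count_predT iter_addr.
  rewrite addr0 -[_ *+ _]mulr_natr -/n.
  have -> : (c * a) ^+ 2 * n = c ^+ 2 * (a ^+ 2 * n) by rewrite exprMn -mulrA.
  by rewrite a2 mulr1.
have [m1 s1] := mgf 1; have [m2 s2] := mgf 2.
rewrite expr1n in m1.
have half : 1 + 2^-1 <= expR (1 / 2) :> R.
  by apply: le_trans (expR_ge1Dx _); lra.
have four : expR (2 ^+ 2 / 2) <= 16 :> R.
  have h2 : expR (1 / 2) <= 2 :> R.
    by have := @expR_le_inv (1 / 2); lra.
  have -> : (2 ^+ 2 / 2 : R) = (1 / 2) * 4%:R by lra.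
  rewrite expRM_natr; have := expR_gt0 (1 / 2 : R) => e0.
  set e := expR _ in h2 e0 *.
  have ee : e ^+ 2 <= 4 by nra.
  have -> : e ^+ 4 = (e ^+ 2) ^+ 2 by rewrite -exprM.
  have : 0 <= e ^+ 2 by exact: sqr_ge0.
  nra.
have sn : summable P (fun t => `|y t|) by exact: summable_norm.
have ineq : expR (1 / 2) - 1 <= 64 * mean P (fun t => `|y t|) + 16 / 64.
  apply: (@le_trans _ _ (64 * mean P (fun t => `|y t|) + expR (2 ^+ 2 / 2) / 64));
    last by lra.
  have -> : expR (1 / 2) - 1 = mean P (fun t => expR (1 * y t) + -1).
    by rewrite meanD ?m1 ?mean_cst//; exact: summable_cst.
  have -> : 64 * mean P (fun t => `|y t|) + expR (2 ^+ 2 / 2) / 64 =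
      mean P (fun t => 64 * `|y t| + 64^-1 * expR (2 * y t)).
    rewrite meanD; [|exact: summableZ|exact: summableZ].
    by rewrite !meanZ// m2; lra.
  apply: le_mean.
  - by apply: summableD => //; exact: summable_cst.
  - by apply: summableD; exact: summableZ.
  - by move=> t; have := expR_sub1_le (y t); rewrite mul1r; lra.
have posE : (fun t => Num.max (\sum_(i <- S) h i t) 0) =
    (fun t => Num.sqrt n * (2^-1 * (`|y t| + y t))).
  apply/funext => t.
  have -> : \sum_(i <- S) h i t = Num.sqrt n * y t.
    by rewrite yE mulrA mulfV ?mul1r// gt_eqF.
  case: (ger0P (y t)) => y0.
    by rewrite (max_idPl _) ?mulr_ge0// ?ltW//; lra.
  by rewrite (max_idPr _) ?pmulr_rle0 ?ltW//; lra.
rewrite posE meanZ; last by apply: summableZ; exact: summableD.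
rewrite ler_pM2l// meanZ; last exact: summableD.
by rewrite meanD// my; lra.
Qed.

End gaussian_sums.

(** * Maxima of field sums over finite families of sets *)

Section best_sums.
Context d (T : measurableType d) (R : realType) (P : probability T R).
Variables (I : choiceType) (h : I -> {RV P >-> R}).
Hypothesis iid : iid_standard_gaussian h.
Implicit Types (A B S K : {fset I}) (F : seq {fset I}).

Let indep : independent_family h := iid.1.

Definition field_sum A (t : T) : R := \sum_(i <- A) h i t.

Definition best F (t : T) : R :=
  \big[Num.max/field_sum (head fset0 F) t]_(A <- F) field_sum A t.

Lemma best_ge F A t : A \in F -> field_sum A t <= best F t.
Proof. by move=> AF; exact: (@le_bigmax_seq _ _ _ _ _ A xpredT (field_sum ^~ t)). Qed.

Lemma best_attained F t : F != [::] -> exists2 A, A \in F & best F t = field_sum A t.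
Proof.
case: F => [//|A0 F] _; rewrite /best /= big_seq.
apply: (big_ind (fun x => exists2 A, A \in A0 :: F & x = field_sum A t)).
- by exists A0; rewrite ?mem_head.
- by move=> x y [A AF ->] [B BF ->]; rewrite maxEle; case: ifP => _;
    [exists B|exists A].
- by move=> A AF; exists A.
Qed.

Lemma summable_field_sum A : summable P (field_sum A).
Proof.
by apply: summable_sum => i; exact: summable_gaussian iid i.
Qed.

Lemma mean_field_sum A : mean P (field_sum A) = 0.
Proof.
rewrite /field_sum mean_sum; last by move=> i; exact: summable_gaussian.
by rewrite big1// => i _; rewrite (mean_gaussian iid).
Qed.

Lemma summable_best F : summable P (best F).
Proof.
rewrite /best; move: (head _ _) => A0; elim: F => [|A F IHF].
  by under eq_fun do rewrite big_nil; exact: summable_field_sum.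
under eq_fun do rewrite big_cons.
by apply: summable_max => //; exact: summable_field_sum.
Qed.

Lemma determined_field_sum A : determined h A (field_sum A).
Proof.
have fE : field_sum A = (fun t => \sum_(i <- A) 1 * h i t).
  by apply/funext => t; apply: eq_bigr => i _; rewrite mul1r.
rewrite fE; apply: (sub_determined _ (@determined_lin _ _ _ P _ h (fun=> 1) A)).
by apply/fsubsetP => i; rewrite !inE.
Qed.

Lemma determined_best K F : F != [::] ->
  (forall A, A \in F -> (A `<=` K)%fset) -> determined h K (best F).
Proof.
move=> F0 FK.
have dF A : A \in F -> determined h K (field_sum A).
  by move=> AF; exact: sub_determined (FK _ AF) (@determined_field_sum A).
have : determined h K (field_sum (head fset0 F)).
  by apply: dF; case: (F) F0 => //= A F' _; exact: mem_head.
rewrite /best; move: (head _ _) => A0 dA0; elim: F {F0 FK} dF => [|A F IHF] dF.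
  have -> // : (fun t => \big[Num.max/field_sum A0 t]_(A <- [::]) field_sum A t)
    = field_sum A0 by apply/funext => t; rewrite big_nil.
have -> : (fun t => \big[Num.max/field_sum A0 t]_(B <- A :: F) field_sum B t)
    = (field_sum A \max
      (fun t => \big[Num.max/field_sum A0 t]_(B <- F) field_sum B t)).
  by apply/funext => t; rewrite big_cons.
apply: measurable_maxr; first by apply: dF; rewrite mem_head.
by apply: IHF => B BF; apply: dF; rewrite inE BF orbT.
Qed.

Lemma field_sumD A S t : (S `<=` A)%fset ->
  field_sum A t = field_sum S t + field_sum (A `\` S)%fset t.
Proof.
move=> SA; rewrite /field_sum -big_cat /=; apply: perm_big; apply: uniq_perm.
- exact: fset_uniq.
- rewrite cat_uniq !fset_uniq andbT /=; apply/hasPn => i.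
  by rewrite in_fsetD => /andP[].
- move=> i; rewrite mem_cat in_fsetD.
  by case: (boolP (i \in S)) => //= iS; rewrite (fsubsetP SA).
Qed.

Lemma field_sumU A B t : [disjoint A & B]%fset ->
  field_sum (A `|` B)%fset t = field_sum A t + field_sum B t.
Proof.
move=> AB; rewrite (@field_sumD (A `|` B)%fset A) ?fsubsetUl//.
congr (_ + field_sum _ t); rewrite fsetDUl fsetDv fset0U.
by apply/fsetDidPl; rewrite fdisjoint_sym.
Qed.

(* Choose [F1] exactly when [S] has a positive sum: what the sites outside [S]
   contribute is independent of this choice. *)
Lemma best_split F F0 F1 S :
  F0 != [::] -> F1 != [::] -> {subset F0 <= F} -> {subset F1 <= F} ->
  (forall A, A \in F0 -> [disjoint A & S]%fset) ->
  (forall A, A \in F1 -> (S `<=` A)%fset) ->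
  Num.sqrt #|` S|%:R / 512 + Num.min (mean P (best F0)) (mean P (best F1))
  <= mean P (best F).
Proof.
move=> F0n F1n F0F F1F F0S F1S.
(* Once [S] is removed from the second family, both maxima depend only on sites outside [S]; the
   centred sum over [S] does not affect the mean. *)
pose F1' := [seq (A `\` S)%fset | A <- F1].
have F1'n : F1' != [::] by rewrite /F1'; case: (F1) F1n.
pose K := [fset i in flatten [seq enum_fset A | A <- F0 ++ F1']]%fset.
have FK A : A \in F0 ++ F1' -> (A `<=` K)%fset.
  move=> AF; apply/fsubsetP => i iA; rewrite !inE; apply/flattenP.
  by exists (enum_fset A) => //; exact: map_f.
have SK : [disjoint S & K]%fset.
  apply/fdisjointP => i iS; rewrite !inE; apply/negP => /flattenP[_ /mapP[A AF ->]].
  move=> /= iA; move: AF; rewrite mem_cat => /orP[/F0S|/mapP[B _ AB]].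
    by move=> /fdisjointP/(_ _ iA); rewrite iS.
  by move: iA; rewrite AB in_fsetD iS.
have d0 : determined h K (best F0).
  by apply: determined_best => // A AF; apply: FK; rewrite mem_cat AF.
have d1 : determined h K (best F1').
  by apply: determined_best => // A AF; apply: FK; rewrite mem_cat AF orbT.
have bestF1 : best F1 = (fun t => field_sum S t + best F1' t).
  apply/funext => t; apply/eqP; rewrite eq_le; apply/andP; split.
    have [A AF ->] := best_attained t F1n.
    by rewrite (field_sumD t (F1S A AF)) lerD2l; apply: best_ge; exact: map_f.
  have [_ /mapP[A AF ->] ->] := best_attained t F1'n.
  by rewrite -(field_sumD t (F1S A AF)) best_ge.
have m1 : mean P (best F1) = mean P (best F1').
  rewrite bestF1 meanD ?mean_field_sum ?add0r//.
    exact: summable_field_sum.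
  exact: summable_best.
pose p t : R := if 0 < field_sum S t then 1 else 0.
have dS := @determined_field_sum S.
have dp : determined h S p.
  by apply: measurable_fun_ifT => //; exact: measurable_fun_ltr.
have dq : determined h S (fun t => 1 - p t) by exact: measurable_funB.
have p0 t : 0 <= p t by rewrite /p; case: ifP.
have q0 t : 0 <= 1 - p t by rewrite /p; case: ifP => _; lra.
have sp : summable P p.
  apply: (@le_summable _ _ _ _ _ (fun=> 1)); last exact: summable_cst.
    exact: determined_measurable dp.
  by move=> t; rewrite ger0_norm//; have := q0 t; lra.
have sq : summable P (fun t => 1 - p t).
  have -> : (fun t => 1 - p t) = (fun t => 1 + -1 * p t).
    by apply/funext => t; lra.
  by apply: summableD; [exact: summable_cst|exact: summableZ].
have mq : mean P (fun t => 1 - p t) = 1 - mean P p.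
  have -> : (fun t => 1 - p t) = (fun t => 1 + -1 * p t).
    by apply/funext => t; lra.
  rewrite meanD ?meanZ ?mean_cst//; [lra|exact: summable_cst|exact: summableZ].
have [s1 E1] := mean_indep indep SK dp d1 p0 sp (summable_best F1').
have [s2 E2] := mean_indep indep SK dq d0 q0 sq (summable_best F0).
pose Sp t := Num.max (field_sum S t) 0.
have sSp : summable P Sp.
  by apply: summable_max; [exact: summable_field_sum|exact: summable_cst].
have mp0 : 0 <= mean P p by exact: mean_ge0.
have mq0 : 0 <= 1 - mean P p by rewrite -mq; exact: mean_ge0.
have Sge : Num.sqrt #|` S|%:R / 512 <= mean P Sp.
  exact: (mean_pos_part_ge iid (fset_uniq S)).
(* By independence the two maxima enter with the weights [E p] and [1 - E p], and such a mixture is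
   at least the smaller of their means. *)
apply: (@le_trans _ _ (mean P (fun t => Sp t +
    (p t * best F1' t + (1 - p t) * best F0 t)))).
  rewrite meanD//; last exact: summableD.
  rewrite meanD// E1 E2 mq -m1 lerD//.
  rewrite minEle; case: ifP => [m01|/negbT]; first by nra.
  by rewrite -ltNge => m10; nra.
apply: le_mean; [|exact: summable_best|].
  by apply: summableD => //; exact: summableD.
move=> t; rewrite /p /Sp.
case: ltP => S0.
  rewrite mul1r subrr mul0r addr0.
  have [_ /mapP[A AF ->] ->] := best_attained t F1'n.
  by rewrite -(field_sumD t (F1S A AF)) best_ge// F1F.
rewrite mul0r subr0 mul1r !add0r.
by have [A AF ->] := best_attained t F0n; rewrite best_ge// F0F.
Qed.

Lemma best_product F F1 F2 (K1 : pred I) :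
  F1 != [::] -> F2 != [::] ->
  (forall A i, A \in F1 -> i \in A -> K1 i) ->
  (forall A i, A \in F2 -> i \in A -> ~~ K1 i) ->
  (forall A B, A \in F1 -> B \in F2 -> (A `|` B)%fset \in F) ->
  mean P (best F1) + mean P (best F2) <= mean P (best F).
Proof.
move=> F1n F2n F1K F2K F12.
rewrite -meanD; [|exact: summable_best|exact: summable_best].
apply: le_mean; [|exact: summable_best|].
  by apply: summableD; exact: summable_best.
move=> t; have [A AF ->] := best_attained t F1n.
have [B BF ->] := best_attained t F2n.
rewrite -field_sumU ?best_ge//; first exact: F12.
apply/fdisjointP => i iA; apply/negP => iB.
by have := F2K B i BF iB; rewrite (F1K A i).
Qed.

End best_sums.

(** * Animals with dyadic bumps *)

Section subgraph_animals.
Implicit Types (S : {pred Z2}) (u v w : Z2).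

Definition reach S u v := exists p : seq Z2,
  [/\ path adjacent u p, all [in S] p & last u p = v].

Lemma reach_refl S u : reach S u u.
Proof. by exists [::]. Qed.

Lemma reach_trans S u v w : reach S u v -> reach S v w -> reach S u w.
Proof.
move=> [p [up Sp <-]] [q [vq Sq <-]]; exists (p ++ q).
by rewrite cat_path all_cat last_cat up vq Sp Sq.
Qed.

Lemma reach_step S u v : adjacent u v -> v \in S -> reach S u v.
Proof. by move=> uv Sv; exists [:: v]; rewrite /= uv Sv. Qed.

Lemma reach_sym S u v : u \in S -> reach S u v -> reach S v u.
Proof.
move=> Su [p]; elim: p u Su => [|w p IHp] u Su [/= up Sp uv].
  by rewrite uv; exact: reach_refl.
case/andP: up => uw wp; case/andP: Sp => Sw Sp.
have := IHp w Sw (And3 wp Sp uv) => vw; apply: reach_trans vw _.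
apply: reach_step => //; move: uw; rewrite !adjacentE.
by rewrite distrC [X in _ + X]distrC.
Qed.

Lemma reach_line S (f : int -> Z2) (a b : int) :
  (forall x, adjacent (f x) (f (x + 1))) ->
  (forall x, Num.min a b <= x <= Num.max a b -> f x \in S) ->
  reach S (f a) (f b).
Proof.
move=> fadj.
suff up (k : nat) c : (forall x, c <= x <= c + k%:Z -> f x \in S) ->
    reach S (f c) (f (c + k%:Z)).
  case: (leP a b) => ab Sf.
    have -> : b = a + `|b - a|%N%:Z by lia.
    by apply: up => x xab; apply: Sf; lia.
  apply: reach_sym; first by apply: Sf; lia.
  have -> : a = b + `|a - b|%N%:Z by lia.
  by apply: up => x xab; apply: Sf; lia.
elim: k => [|k IHk] Sf; first by rewrite addr0; exact: reach_refl.
have -> : c + k.+1%:Z = c + k%:Z + 1 by lia.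
apply: reach_trans (IHk _) (reach_step (fadj _) _).
  by move=> x xck; apply: Sf; lia.
by apply: Sf; lia.
Qed.

Lemma reach_row S y (a b : int) :
  (forall x, Num.min a b <= x <= Num.max a b -> (x, y) \in S) ->
  reach S (a, y) (b, y).
Proof.
move=> Sy; apply: (@reach_line S (fun x => (x, y))) => // x.
by rewrite adjacentE /=; lia.
Qed.

Lemma reach_col S x (a b : int) :
  (forall y, Num.min a b <= y <= Num.max a b -> (x, y) \in S) ->
  reach S (x, a) (x, b).
Proof.
move=> Sx; apply: (@reach_line S (fun y => (x, y))) => // y.
by rewrite adjacentE /=; lia.
Qed.

Lemma connected_base S u : u \in S -> (forall v, v \in S -> reach S v u) ->
  connected_in S.
Proof.
move=> Su Sr v w Sv Sw; apply: reach_trans (Sr _ Sv) _.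
by apply: reach_sym; [|exact: Sr].
Qed.

Variables (n : nat) (H : int -> int) (A : {fset Z2}).
Hypothesis n_gt0 : (0 < n)%N.
Hypothesis H_gt0 : forall x : int, 0 <= x < n%:Z -> 0 < H x.
Hypothesis H_out : forall x : int, ~~ (0 <= x < n%:Z) -> H x = 0.
Hypothesis memA : forall v, (v \in A) = (0 <= v.2 < H v.1).

Let H_ge0 x : 0 <= H x.
Proof.
by case: (boolP (0 <= x < n%:Z)) => [/H_gt0/ltW|/H_out ->].
Qed.

Lemma subgraph_connected : connected_in [in A].
Proof.
have inA v : (v \in [in A]) = (0 <= v.2 < H v.1) by exact: memA.
apply: (@connected_base _ origin).
  by rewrite inA /= H_gt0 //= n_gt0.
move=> [x y]; rewrite inA /= => xy.
have x0n : 0 <= x < n%:Z.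
  by apply: contraT => /H_out Hx; lia.
apply: (@reach_trans _ _ (x, 0)).
  by apply: reach_col => y'; rewrite inA /=; lia.
apply: reach_row => x' x'x; rewrite inA /=.
by have := @H_gt0 x'; lia.
Qed.

(** A cell above the graph climbs to height [M]; from there, or from below the axis, rows are free
    up to the empty column at [-1]. *)
Lemma subgraph_compl_connected (M : int) : (forall x, H x <= M) ->
  connected_in [predC A].
Proof.
move=> HM; have M0 : 0 <= M by apply: le_trans (HM 0); exact: H_ge0.
have inC v : (v \in [predC A]) = ~~ (0 <= v.2 < H v.1).
  by rewrite !inE memA.
have Hm1 : H (-1) = 0 by apply: H_out; lia.
apply: (@connected_base _ (-1, M)); first by rewrite inC /= Hm1; lia.
have far x y : (y < 0) || (M <= y) -> reach [predC A] (x, y) (-1, M).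
  move=> yM; apply: (@reach_trans _ _ (-1, y)).
    by apply: reach_row => x' _; rewrite inC /=; have := HM x'; lia.
  by apply: reach_col => y' _; rewrite inC /= Hm1; lia.
move=> [x y]; rewrite inC /= => xy.
case: (ltP y 0) => [y0|y0]; first by apply: far; rewrite y0.
apply: (@reach_trans _ _ (x, Num.max y M)); last by apply: far; lia.
by apply: reach_col => y' yy'; rewrite inC /=; lia.
Qed.

Definition hedge (x y : int) : {fset Z2} := [fset (x - 1, y)%R; (x, y)]%fset.

Definition vedge (x y : int) : {fset Z2} := [fset (x, y - 1)%R; (x, y)]%fset.

Definition subgraph_edges : seq {fset Z2} :=
  [seq vedge i%:Z 0 | i <- iota 0 n] ++
  [seq vedge i%:Z (H i%:Z) | i <- iota 0 n] ++
  flatten [seq [seq hedge i%:Z (Num.min (H (i%:Z - 1)) (H i%:Z) + k%:Z)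
    | k <- iota 0 `|H i%:Z - H (i%:Z - 1)|] | i <- iota 0 n.+1].

Let mem_hedge (x y : int) : 0 <= x <= n%:Z ->
  Num.min (H (x - 1)) (H x) <= y < Num.max (H (x - 1)) (H x) ->
  hedge x y \in subgraph_edges.
Proof.
move=> xn xy; rewrite 2!mem_cat; apply/orP; right; apply/orP; right.
apply/flattenP; exists [seq hedge x (Num.min (H (x - 1)) (H x) + k%:Z)
    | k <- iota 0 `|H x - H (x - 1)|].
  apply/mapP; exists `|x|%N; first by rewrite mem_iota; lia.
  by have -> : `|x|%N%:Z = x by lia.
apply/mapP; exists `|y - Num.min (H (x - 1)) (H x)|%N.
  by rewrite mem_iota; lia.
by congr hedge; lia.
Qed.

Let boundary_edge e : e \in edge_boundary A ->
  (exists x y, [/\ e = hedge x y, 0 <= x <= n%:Z &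
     Num.min (H (x - 1)) (H x) <= y < Num.max (H (x - 1)) (H x)]) \/
  (exists2 x, 0 <= x < n%:Z & e = vedge x 0 \/ e = vedge x (H x)).
Proof.
move=> /imfset2P[v] /= vA [w]. move: vA; rewrite memA => vA.
rewrite !inE /= memA => wvA ->; case: v vA wvA => x y /= xy /andP[wv wA].
have x0n : 0 <= x < n%:Z by apply: contraT => /H_out Hx; lia.
move: wv wA; rewrite -!orbA => /or4P[] /eqP -> /= wA {w}.
- left; exists (x + 1), y; have Hx := H_ge0 (x + 1).
  by rewrite /hedge addrK; split=> //; lia.
- left; exists x, y; have Hx := H_ge0 (x - 1).
  by rewrite /hedge fsetUC; split=> //; lia.
- right; exists x => //; right; rewrite /vedge.
  have Hy : H x = y + 1 by lia.
  by rewrite Hy addrK.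
- right; exists x => //; left; rewrite /vedge fsetUC.
  have y0 : y = 0 by lia.
  by rewrite y0.
Qed.

Let boundary_edge_in (e : {fset Z2}) : e \in edge_boundary A ->
  e \in subgraph_edges.
Proof.
move=> /boundary_edge[[x [y [-> xn yH]]]|[x xn]]; first exact: mem_hedge.
have xE : x = `|x|%N%:Z by lia.
have xi : `|x|%N \in iota 0 n by rewrite mem_iota; lia.
rewrite 2!mem_cat => -[->|->]; apply/orP.
  by left; apply/mapP; exists `|x|%N; rewrite // -xE.
by right; apply/orP; left; apply/mapP; exists `|x|%N; rewrite // -xE.
Qed.

(** Each of the [n] columns has a bottom and a top edge, and neighbouring columns are separated by
    as many edges as their heights differ. The empty columns at both ends account for [n + 1]
    differences. *)
Lemma subgraph_boundary : (#|` edge_boundary A| <=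
  n + n + \sum_(i < n.+1) `|H i%:Z - H (i%:Z - 1)|)%N.
Proof.
have -> : (n + n + \sum_(i < n.+1) `|H i%:Z - H (i%:Z - 1)| =
    size subgraph_edges)%N.
  have sz (s : seq nat) : size (flatten [seq [seq
      hedge i%:Z (Num.min (H (i%:Z - 1)) (H i%:Z) + k%:Z)
      | k <- iota 0 `|H i%:Z - H (i%:Z - 1)|] | i <- s]) =
      (\sum_(i <- s) `|H i%:Z - H (i%:Z - 1)|)%N.
    rewrite size_flatten /shape sumnE !big_map.
    by apply: eq_bigr => i _; rewrite size_map size_iota.
  rewrite size_cat size_cat sz 2!size_map size_iota addnA; congr addn.
  rewrite -(big_mkord xpredT (fun i : nat => `|H i%:Z - H (i%:Z - 1)|%N)).
  by rewrite /index_iota subn0.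
apply: leq_trans (size_undup _); rewrite -card_fseq.
apply: fsubset_leq_card; apply/fsubsetP => e.
by move=> eA; apply/imfsetP; exists e => //; exact: boundary_edge_in.
Qed.

Lemma subgraph_animal (N : nat) : (n <= N.+1)%N -> (forall x, H x <= N.+1%:Z) ->
  simply_connected_animals N A.
Proof.
move=> nN HN; split; last exact: (@subgraph_compl_connected N.+1%:Z).
split; last exact: subgraph_connected.
  move=> [x y]; rewrite memA /supnorm /= => xy.
  have x0n : 0 <= x < n%:Z by apply: contraT => /H_out Hx; lia.
  by have := HN x; rewrite ge_max; lia.
by rewrite memA /= H_gt0 // n_gt0.
Qed.

End subgraph_animals.

(** * Families of profiles with optional bumps *)

Section bump_families.
Variable c : nat.
Local Notation D := ((4 ^ c)%N%:Z).
Implicit Types (a y z : int) (G : int -> int).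

Let D_gt0 : 0 < D.
Proof. by have := expn_gt0 4 c; lia. Qed.

(** Profiles are measured in units of [1 / D] of a cell, so that slopes of order [4^-c] become
    integers; column [x] holds the floor of [G x / D] cells. *)
Definition region a (n : nat) G : {fset Z2} :=
  let cells := [seq (a + i%:Z, k%:Z) | i <- iota 0 n, k <- iota 0 `|G (a + i%:Z)|]
  in [fset v in [seq v : Z2 <- cells | (v.2 + 1) * D <= G v.1]]%fset.

Lemma in_region a n G (v : Z2) : (v \in region a n G) =
  [&& a <= v.1, v.1 < a + n%:Z, 0 <= v.2 & (v.2 + 1) * D <= G v.1].
Proof.
case: v => x y; rewrite /region inE mem_filter /= andbC.
apply/andP/and4P => [[/allpairsPdep[i [k [+ + [-> ->]]]] Gk]|[ax xn y0 yG]].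
  by rewrite !mem_iota; split; lia.
split=> //; apply/allpairsPdep; exists `|x - a|%N, `|y|%N.
have xE : a + `|x - a|%N%:Z = x by lia.
rewrite xE !mem_iota; split; [lia|nia|].
by congr pair; lia.
Qed.

Definition line a y z (x : int) := y + z * (x - a).

(** The profile starts at height [y] and has mean slope [z]. A bump changes the slope to [z + 1] on
    the first half and to [z - 1] on the second: a tent of height [2 ^ k] above the chord. Finer
    choices on the two halves are combined freely. *)
Fixpoint bumps (j : nat) a y z : seq {fset Z2} :=
  if j is k.+1 then
    let w := (2 ^ k)%N%:Z in
    [seq (A `|` B)%fset | A <- bumps k a y z, B <- bumps k (a + w) (y + z * w) z]
    ++ (if odd k then
          [seq (A `|` B)%fset | A <- bumps k a y (z + 1),
             B <- bumps k (a + w) (y + (z + 1) * w) (z - 1)]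
        else [::])
  else [:: region a 1 (line a y z)].

Definition energy a n G : int := \sum_(i < n) (G (a + i%:Z + 1) - G (a + i%:Z)) ^+ 2.

(* [G] stays above its chord, by at most a third of the height of the next
   coarser bump. *)
Definition bump_profile j a y z G :=
  [/\ G a = y, G (a + (2 ^ j)%N%:Z) = y + z * (2 ^ j)%N%:Z,
      forall x, a <= x <= a + (2 ^ j)%N%:Z -> line a y z x <= G x /\
        3 * (G x - line a y z x) <= (if odd j then 1 else 2) * (2 ^ j)%N%:Z &
      energy a (2 ^ j) G <= (2 ^ j)%N%:Z * (z ^+ 2 + j%:Z)].

Let pow_gt0 j : 0 < (2 ^ j)%N%:Z.
Proof. by have := expn_gt0 2 j; lia. Qed.

Let powS j : (2 ^ j.+1)%N%:Z = 2 * (2 ^ j)%N%:Z.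
Proof. by rewrite expnS; lia. Qed.

Lemma energy_cat a n m G : energy a (n + m) G = energy a n G + energy (a + n%:Z) m G.
Proof.
rewrite /energy big_split_ord /=; congr (_ + _); apply: eq_bigr => i _ /=.
by rewrite PoszD !addrA.
Qed.

Lemma eq_energy a n G G' : (forall x, a <= x <= a + n%:Z -> G x = G' x) ->
  energy a n G = energy a n G'.
Proof.
move=> GG; apply: eq_bigr => i _; have := ltn_ord i => i_lt.
by rewrite !GG //; lia.
Qed.

Lemma region_cat a n m G1 G2 :
  (region a n G1 `|` region (a + n%:Z) m G2)%fset =
  region a (n + m) (fun x => if x < a + n%:Z then G1 x else G2 x).
Proof.
apply/fsetP => v; rewrite in_fsetU !in_region PoszD.
by case: ltP => vn; lia.
Qed.

(** The energy budget is closed by [(z + e)^2 + (z - e)^2 = 2 z^2 + 2 e^2]: one more level costs at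
    most one unit of squared slope per column. The second conclusion says that an accepted bump
    lifts the profile above the whole tent. *)
Lemma bump_glue (bump : bool) j a y z G1 G2 : (bump -> odd j) ->
  let w := (2 ^ j)%N%:Z in let e : int := bump%:Z in
  bump_profile j a y (z + e) G1 ->
  bump_profile j (a + w) (y + (z + e) * w) (z - e) G2 ->
  bump_profile j.+1 a y z (fun x => if x < a + w then G1 x else G2 x) /\
  (forall x, a <= x <= a + 2 * w ->
     line a y z x + e * Num.min (x - a) (2 * w - (x - a)) <=
     (if x < a + w then G1 x else G2 x)).
Proof.
move=> bj w e [G1a G1w G1l G1e] [G2a G2w G2l G2e].
have w0 : 0 < w by exact: pow_gt0.
have eE : e = 0 \/ e = 1 by rewrite /e; case: (bump); [right|left].
have eo : e = 1 -> odd j by rewrite /e; case: (bump) bj => // ->.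
rewrite -/w in G1w G1l G1e G2w G2l G2e.
set G := fun x => _.
have low x : a <= x <= a + 2 * w ->
    line a y z x + e * Num.min (x - a) (2 * w - (x - a)) <= G x.
  move=> xw; rewrite /G /line; case: ltP => xaw.
    have [+ _] := G1l x ltac:(lia); rewrite /line.
    have -> : Num.min (x - a) (2 * w - (x - a)) = x - a by lia.
    nia.
  have [+ _] := G2l x ltac:(lia); rewrite /line.
  have -> : Num.min (x - a) (2 * w - (x - a)) = 2 * w - (x - a) by lia.
  nia.
split=> //; split.
- by rewrite /G ifT //; lia.
- rewrite powS -/w /G ifF; last by lia.
  have -> : a + 2 * w = a + w + w by lia.
  by rewrite G2w; nia.
- rewrite powS -/w => x xw; split.
    have := low x xw; case: eE => ->; rewrite ?mul0r ?mul1r; lia.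
  (* For odd [j] the halves rise by at most [w / 3] and the tent by at most [w], together two thirds
     of [2 * w]. For even [j] there is no bump, and [2 * w / 3] is one third of [2 * w]. *)
  rewrite /G /line; case: ltP => xaw.
    have [_] := G1l x ltac:(lia); rewrite /line /=.
    case: eE => eE; rewrite eE ?addr0 in eo *; last rewrite eo //=; last by nia.
    by case: (odd j) => /=; nia.
  have [_] := G2l x ltac:(lia); rewrite /line /=.
  case: eE => eE; rewrite eE ?addr0 ?subr0 in eo *; last rewrite eo //=; last by nia.
  by case: (odd j) => /=; nia.
- rewrite expnS mul2n -addnn energy_cat.
  rewrite (@eq_energy a _ G G1); last first.
    move=> x xw; rewrite /G; case: ltP => // xaw.
    have -> : x = a + w by lia.
    by rewrite G2a G1w.
  rewrite (@eq_energy (a + w) _ G G2); last first.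
    by move=> x xw; rewrite /G ifF //; lia.
  apply: le_trans (lerD G1e G2e) _.
  rewrite PoszD -/w; case: eE => ->; nia.
Qed.

Lemma bumpsP j a y z A : A \in bumps j a y z ->
  exists2 G, bump_profile j a y z G & A = region a (2 ^ j) G.
Proof.
elim: j a y z A => [|j IHj] a y z A.
  rewrite inE => /eqP ->; exists (line a y z) => //.
  split; rewrite /line ?expn0; try by nia.
    by move=> x _ /=; lia.
  by rewrite /energy big_ord1 /=; nia.
set w := (2 ^ j)%N%:Z.
suff glue (bump : bool) z1 z2 : (bump -> odd j) ->
    z1 = z + bump%:Z -> z2 = z - bump%:Z ->
    A \in [seq (A `|` B)%fset | A <- bumps j a y z1,
       B <- bumps j (a + w) (y + z1 * w) z2] ->
    exists2 G, bump_profile j.+1 a y z G & A = region a (2 ^ j.+1) G.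
  rewrite /= mem_cat => /orP[|].
    by apply: (glue false) => //; rewrite ?addr0 ?subr0.
  by case: ifP => // jo; apply: (glue true).
move=> bj -> -> /allpairsP[[A1 A2] /= [A1F A2F ->]].
have [G1 G1p ->] := IHj _ _ _ _ A1F; have [G2 G2p ->] := IHj _ _ _ _ A2F.
have [Gp _] := bump_glue bj G1p G2p.
exists (fun x => if x < a + w then G1 x else G2 x) => //.
by rewrite region_cat expnS mul2n -addnn.
Qed.

End bump_families.

Section bump_gain.
Context d (T : measurableType d) (R : realType) (P : probability T R).
Variable h : Z2 -> {RV P >-> R}.
Hypothesis iid : iid_standard_gaussian h.
Variable c : nat.
Local Notation D := ((4 ^ c)%N%:Z).
Implicit Types (a y z : int).

Lemma best_sub (F0 F : seq {fset Z2}) : F0 != [::] -> {subset F0 <= F} ->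
  mean P (best h F0) <= mean P (best h F).
Proof.
move=> F0n F0F; apply: le_mean; [exact: summable_best|exact: summable_best|].
by move=> t; have [A AF ->] := best_attained h t F0n; rewrite best_ge// F0F.
Qed.

Lemma bumps_neq0 j a y z : bumps c j a y z != [::].
Proof.
elim: j a y z => [//|j IHj] a y z /=; rewrite -size_eq0 size_cat size_allpairs.
by rewrite addn_eq0 muln_eq0 !size_eq0 !(negbTE (IHj _ _ _)).
Qed.

(* The cells lying, over the middle half of an interval of length [2 ^ j.+1],
   between every profile without the bump of height [2 ^ j] and every profile
   with it. *)
Definition bump_cells j a y z : {fset Z2} :=
  let w := (2 ^ j)%N%:Z in
  let x i : int := a + w - (2 ^ j.-1)%N%:Z + i%:Z in
  let cells := [seq (x i, ((3 * line a y z (x i) + w) %/ (3 * D))%Z + k%:Z)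
    | i <- iota 0 (2 ^ j), k <- iota 0 (2 ^ (j - (2 * c + 4)))] in
  [fset v in cells]%fset.

Lemma in_bump_cells j a y z (v : Z2) : v \in bump_cells j a y z ->
  exists2 q : int,
    q * (3 * D) <= 3 * line a y z v.1 + (2 ^ j)%N%:Z < (q + 1) * (3 * D) &
    [/\ a + (2 ^ j)%N%:Z - (2 ^ j.-1)%N%:Z <= v.1,
       v.1 < a + 2 * (2 ^ j)%N%:Z - (2 ^ j.-1)%N%:Z &
       q <= v.2 < q + (2 ^ (j - (2 * c + 4)))%N%:Z].
Proof.
rewrite inE => /allpairsP[[i k] /=]; rewrite !mem_iota => -[+ + ->] /=.
set x := _ + i%:Z; set w := (2 ^ j)%N%:Z => iw kM.
exists ((3 * line a y z x + w) %/ (3 * D))%Z; last by rewrite /x; split; lia.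
have D0 : 0 < 3 * D by have := expn_gt0 4 c; lia.
set n := 3 * _ + w.
have := divz_eq n (3 * D); have := modz_ge0 n (lt0r_neq0 D0).
have := ltz_pmod n D0; lia.
Qed.

Lemma card_bump_cells j a y z :
  #|` bump_cells j a y z| = (2 ^ j * 2 ^ (j - (2 * c + 4)))%N.
Proof.
rewrite card_fseq undup_id; first by rewrite size_allpairs !size_iota.
apply: allpairs_uniq; rewrite ?iota_uniq //.
move=> [i k] [i' k'] _ _ /= [] ii.
have -> : i = i' by lia.
by move=> kk; congr pair; lia.
Qed.

(** Below level [2 * c + 4] a sixteenth of the bump is thinner than one cell, so nothing is counted
    there. *)
Fixpoint gains j : nat :=
  if j is k.+1 then (gains k + (odd k && (2 * c + 4 <= k)))%N else 0%N.

Let pow_gt0 j : 0 < (2 ^ j)%N%:Z.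
Proof. by have := expn_gt0 2 j; lia. Qed.

(** Without the bump a profile exceeds the chord by at most [w / 3], and the cells start at the
    first row whose top is above that level. *)
Lemma bump_cells_disjoint j a y z A1 A2 : odd j ->
  A1 \in bumps c j a y z ->
  A2 \in bumps c j (a + (2 ^ j)%N%:Z) (y + z * (2 ^ j)%N%:Z) z ->
  [disjoint (A1 `|` A2) & bump_cells j a y z]%fset.
Proof.
move=> jo /bumpsP[G1 [_ _ + _] ->] /bumpsP[G2 [_ _ + _] ->].
set w := (2 ^ j)%N%:Z; rewrite jo !mul1r => G1l G2l.
apply/fdisjointP => -[x y'] vA; apply/negP => /in_bump_cells[q] /=.
rewrite -/w => qE [_ _ vq]; have D0 : 0 < D by have := expn_gt0 4 c; lia.
have qv : (q + 1) * D <= (y' + 1) * D by rewrite ler_pM2r//; lia.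
move: vA; rewrite in_fsetU !in_region -/w /= => /orP[] /and4P[v1 v2 _ vG].
  by have [_ Gl] := G1l x ltac:(lia); lia.
have [_ Gl] := G2l x ltac:(lia).
have lE : line (a + w) (y + z * w) z x = line a y z x by rewrite /line; lia.
by rewrite lE in Gl; lia.
Qed.

(** The cells fill a strip of height [M * D = w / 16] that starts no higher than [w / 3] above the
    chord, and [w / 3 + w / 16] is less than [w / 2], the height of the tent at the ends of its
    middle half. Nonnegative end heights keep the strip above the axis. *)
Lemma bump_cells_sub j a y z A1 A2 : odd j -> (2 * c + 4 <= j)%N ->
  0 <= y -> 0 <= y + z * (2 ^ j.+1)%N%:Z ->
  A1 \in bumps c j a y (z + 1) ->
  A2 \in bumps c j (a + (2 ^ j)%N%:Z) (y + (z + 1) * (2 ^ j)%N%:Z) (z - 1) ->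
  (bump_cells j a y z `<=` (A1 `|` A2))%fset.
Proof.
move=> jo jc y0 yw /bumpsP[G1 G1p ->] /bumpsP[G2 G2p ->].
have [_ Gl] := @bump_glue c true j a y z G1 G2 (fun=> jo) G1p G2p.
set w := (2 ^ j)%N%:Z in Gl *; pose G x := if x < a + w then G1 x else G2 x.
rewrite region_cat addnn -mul2n -/w.
apply/fsubsetP => -[x y'] /in_bump_cells[q] /=; rewrite -/w => qE [v1 v2 vq].
have D0 : 0 < D by have := expn_gt0 4 c; lia.
set M := (2 ^ (j - (2 * c + 4)))%N%:Z in vq.
have wE : w = 16 * (M * D).
  rewrite /w /M -{1}(subnK jc) expnD [(2 ^ (_ + 4))%N]expnD expnM.
  by rewrite -[(2 ^ 2)%N]/4%N -[(2 ^ 4)%N]/16%N; lia.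
have hwE : w = 2 * (2 ^ j.-1)%N%:Z.
  by rewrite /w -{1}(prednK (odd_gt0 jo)) expnS; lia.
have M0 : 0 < M by exact: pow_gt0.
have MD : 0 < M * D by exact: mulr_gt0.
have lv : 0 <= line a y z x.
  rewrite expnS in yw; have {}yw : 0 <= y + 2 * (z * w) by rewrite /w; lia.
  rewrite /line; case: (leP 0 z) => z0; first by nia.
  have : z * (x - a) >= z * (2 * w) by nia.
  by lia.
have Gv := Gl x ltac:(lia); rewrite mul1r -/(G x) in Gv.
have mn : (2 ^ j.-1)%N%:Z <= Num.min (x - a) (2 * w - (x - a)) by lia.
have q0 : 0 <= q by nia.
have vM : (y' + 1) * D <= (q + M) * D by nia.
by rewrite in_region /=; apply/and4P; split; [lia|lia|lia|rewrite -/(G x); nia].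
Qed.

(** The bound does not involve the slope, so families with and without the bump have the same lower
    bound, twice that of a half. The choice adds the root of the number of cells, [2^j / (4 * 2^c)],
    over 512, that is [2^(j+1) / (4096 * 2^c)]. *)
Lemma bumps_gain j a y z : 0 <= y -> 0 <= y + z * (2 ^ j)%N%:Z ->
  (2 ^ j)%N%:R * (gains j)%:R / (4096 * (2 ^ c)%N%:R) <=
  mean P (best h (bumps c j a y z)).
Proof.
elim: j a y z => [|j IHj] a y z y0 yw.
  rewrite /= mulr0 mul0r -(mean_field_sum iid (region c a 1 (line a y z))).
  apply: le_mean; [exact: summable_field_sum|exact: summable_best|].
  by move=> t; apply: best_ge; rewrite mem_head.
set w := (2 ^ j)%N%:Z; have w0 : 0 < w by exact: pow_gt0.
have wS : (2 ^ j.+1)%N%:Z = 2 * w by rewrite expnS /w; lia.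
rewrite wS in yw.
set v := (2 ^ j)%N%:R * (gains j)%:R / (4096 * (2 ^ c)%N%:R) in IHj *.
pose pairs z1 z2 := [seq (A `|` B)%fset | A <- bumps c j a y z1,
  B <- bumps c j (a + w) (y + z1 * w) z2].
have pairs0 z1 z2 : pairs z1 z2 != [::].
  rewrite -size_eq0 size_allpairs muln_eq0 !size_eq0.
  by rewrite !(negbTE (bumps_neq0 _ _ _ _)).
have pairs_gain z1 z2 : 0 <= y + z1 * w -> 0 <= y + z1 * w + z2 * w ->
    v + v <= mean P (best h (pairs z1 z2)).
  move=> yz1 yz2; apply: le_trans
    (best_product (K1 := [pred u : Z2 | u.1 < a + w]) iid
      (bumps_neq0 j a y z1) (bumps_neq0 j (a + w) (y + z1 * w) z2) _ _ _).
  - by apply: lerD; exact: IHj.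
  - by move=> A u /bumpsP[G _ ->]; rewrite in_region /= => /and4P[].
  - move=> A u /bumpsP[G _ ->]; rewrite in_region /= => /and4P[+ _ _ _].
    by rewrite leNgt.
  - by move=> A B AF BF; apply: allpairs_f.
have sub0 : {subset pairs z z <= bumps c j.+1 a y z}.
  by move=> A AF /=; rewrite mem_cat AF.
have g0 : v + v <= mean P (best h (pairs z z)) by apply: pairs_gain; lia.
have vS : (2 ^ j.+1)%N%:R * (gains j.+1)%:R / (4096 * (2 ^ c)%N%:R) =
    v + v + (odd j && (2 * c + 4 <= j))%N%:R *
      ((2 ^ j)%N%:R / (2048 * (2 ^ c)%N%:R)) :> R.
  rewrite /v /= expnS natrM natrD.
  have c0 : (2 ^ c)%N%:R != 0 :> R by rewrite pnatr_eq0 expn_eq0.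
  set p := (2 ^ j)%N%:R; set n := (gains j)%:R; set b := (nat_of_bool _)%:R.
  have -> : (2048 * (2 ^ c)%N%:R)^-1 = 2 * (4096 * (2 ^ c)%N%:R)^-1 :> R.
    by rewrite !invfM; lra.
  by set k := _^-1; lra.
rewrite vS; case: (boolP (odd j && _)) => [/andP[jo jc]|_]; last first.
  by rewrite mul0r addr0 (le_trans g0)// best_sub.
have g1 : v + v <= mean P (best h (pairs (z + 1) (z - 1))).
  by apply: pairs_gain; nia.
apply: le_trans (best_split iid (F0 := pairs z z) (F1 := pairs (z + 1) (z - 1))
  (S := bump_cells j a y z) (pairs0 _ _) (pairs0 _ _) sub0 _ _ _).
- rewrite mul1r addrC lerD//; last by rewrite le_min g0.
  rewrite card_bump_cells.
  have -> : (2 ^ j * 2 ^ (j - (2 * c + 4)) = (2 ^ (j - (c + 2))) ^ 2)%N.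
    by rewrite -expnD -expnM; congr expn; lia.
  rewrite (natrX _ (2 ^ (j - (c + 2))) 2) sqrtr_sqr ger0_norm//.
  have -> : (2 ^ j = 2 ^ (j - (c + 2)) * (2 ^ c * 4))%N.
    by rewrite -[4%N]/(2 ^ 2)%N -!expnD; congr expn; lia.
  have c0 : 0 < (2 ^ c)%N%:R :> R by rewrite ltr0n expn_gt0.
  rewrite !natrM; set p := (2 ^ (j - _))%N%:R; set q := (2 ^ c)%N%:R in c0 *.
  have -> : p * (q * 4%:R) / (2048 * q) = p / 512.
    have qi : q * q^-1 = 1 by rewrite mulfV// gt_eqF.
    rewrite invfM; set i := q^-1 in qi *.
    have -> : p * (q * 4%:R) * (2048^-1 * i) = p * (q * i) / 512 by lra.
    by rewrite qi mulr1.
  by [].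
- by move=> A AF /=; rewrite mem_cat jo AF orbT.
- by move=> A /allpairsP[[A1 A2] /= [A1F A2F ->]]; exact: bump_cells_disjoint.
- move=> A /allpairsP[[A1 A2] /= [A1F A2F ->]]; apply: bump_cells_sub => //.
  by rewrite wS.
Qed.

End bump_gain.

Section bump_animals.
Variables (c K : nat).
Local Notation D := ((4 ^ c)%N%:Z).
Local Notation n := (2 ^ K)%N.

Let D_gt0 : 0 < D.
Proof. by have := expn_gt0 4 c; lia. Qed.

Let n_gt0 : (0 < n)%N.
Proof. by rewrite expn_gt0. Qed.

Section profile.
Variable G : int -> int.
Hypothesis Gp : bump_profile K 0 D 0 G.

Let H (x : int) : int := if 0 <= x < n%:Z then (G x %/ D)%Z else 0.

Let G_bounds x : 0 <= x <= n%:Z -> D <= G x /\ G x <= D + n%:Z.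
Proof.
move=> xn; have [_ _ Gl _] := Gp; have [] := Gl x; rewrite ?add0r// /line !mul0r addr0.
by case: (odd K); lia.
Qed.

Let H_gt0 (x : int) : 0 <= x < n%:Z -> 0 < H x.
Proof.
move=> xn; rewrite /H xn; have [Gx _] := G_bounds (x := x) ltac:(lia).
by rewrite gtz0_ge1 lez_divRL // mul1r.
Qed.

Let H_out (x : int) : ~~ (0 <= x < n%:Z) -> H x = 0.
Proof. by rewrite /H => /negbTE ->. Qed.

Let H_le (x : int) : H x <= n%:Z + 1.
Proof.
rewrite /H; case: ifP => [xn|_]; last by lia.
have [_ Gx] := G_bounds (x := x) ltac:(lia).
by rewrite -ltzD1 ltz_divLR //; nia.
Qed.

(** Rounding gives [D |dH| <= |dG| + D], and [2 D |dG| <= dG^2 + D^2] converts the variation into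
    energy. *)
Let H_step (x : int) : 0 <= x -> x + 1 < n%:Z ->
  2 * D ^+ 2 * `|H (x + 1) - H x| <= (G (x + 1) - G x) ^+ 2 + 3 * D ^+ 2.
Proof.
move=> x0 xn; rewrite /H !ifT; [|lia|lia].
set g := G x; set g' := G (x + 1).
have D0 := lt0r_neq0 D_gt0.
have := divz_eq g D; have := divz_eq g' D.
have := modz_ge0 g D0; have := modz_ge0 g' D0.
have := ltz_pmod g D_gt0; have := ltz_pmod g' D_gt0.
set q := (g %/ D)%Z; set r := (g %% D)%Z; set q' := (g' %/ D)%Z; set r' := (g' %% D)%Z.
move=> r'D rD r'0 r0 g'E gE.
have h1 : D * `|q' - q| <= `|g' - g| + D by nia.
have h2 : 2 * (D * `|g' - g|) <= (g' - g) ^+ 2 + D ^+ 2.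
  have : 0 <= (`|g' - g| - D) ^+ 2 by exact: sqr_ge0.
  nia.
rewrite !expr2 in h2 *; nia.
Qed.

Let H_sum (m : nat) : (m < n)%N ->
  2 * D ^+ 2 * (\sum_(i < m) `|H i.+1%:Z - H i%:Z|) <=
  energy 0 m G + 3 * D ^+ 2 * m%:Z.
Proof.
elim: m => [|m IHm] mn; first by rewrite /energy !big_ord0 !mulr0.
have := IHm ltac:(lia); rewrite /energy !big_ord_recr /= mulrDr => h1.
have := H_step (x := m%:Z) ltac:(lia) ltac:(lia).
have -> : m%:Z + 1 = m.+1%:Z by lia.
have -> : 3 * D ^+ 2 * m.+1%:Z = 3 * D ^+ 2 * m%:Z + 3 * D ^+ 2.
  by rewrite (_ : m.+1%:Z = m%:Z + 1) ?mulrDr ?mulr1 //; lia.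
rewrite add0r; lra.
Qed.

Lemma profile_animal (N : nat) : (n <= N)%N ->
  simply_connected_animals N (region c 0 n G).
Proof.
move=> nN; apply: (subgraph_animal (H := H) n_gt0 H_gt0 H_out).
- move=> v; rewrite in_region add0r /H; case: ifP => vn; last by lia.
  by rewrite -lez_divRL //; lia.
- by lia.
- by move=> x; have := H_le x; lia.
Qed.

(** The energy is at most [n K <= n D^2], so by [H_step] the inner jumps add up to at most [2 n].
    Bottom and top give [2 n], the two end columns at most [1] and [n + 1]; the total [5 n + 2] is
    at most [7 n]. *)
Lemma profile_boundary : (K <= 16 ^ c)%N ->
  (#|` edge_boundary (region c 0 n G)| <= 7 * n)%N.
Proof.
move=> Kc.
have memA (v : Z2) : (v \in region c 0 n G) = (0 <= v.2 < H v.1).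
  rewrite in_region add0r /H; case: ifP => vn; last by lia.
  by rewrite -lez_divRL //; lia.
have bd := subgraph_boundary n_gt0 H_gt0 H_out memA; apply: leq_trans bd _.
rewrite big_ord_recl /=.
pose f (i : nat) := `|H i.+1%:Z - H i%:Z|%N.
have -> : (\sum_(i < n) `|H (bump 0 i)%:Z - H ((bump 0 i)%:Z - 1)| =
    \sum_(i < n.-1) f i + f n.-1)%N.
  rewrite -[in LHS](prednK n_gt0) big_ord_recr /=.
  have fE i : `|H (bump 0 i)%:Z - H ((bump 0 i)%:Z - 1)|%N = f i.
    by rewrite /f /bump add1n; have -> : i.+1%:Z - 1 = i%:Z by lia.
  by rewrite fE; congr (_ + _)%N; apply: eq_bigr => i _; exact: fE.
have H1 : H (0 - 1) = 0 by apply: H_out; lia.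
have nP : n.-1.+1 = n by rewrite prednK.
have fn : (f n.-1 <= n + 1)%N.
  rewrite /f (H_out (x := n.-1.+1%:Z)); last by lia.
  have := H_le n.-1%:Z; have := H_gt0 (x := n.-1%:Z) ltac:(lia); lia.
have H0 : H 0 = 1.
  have [G0 _ _ _] := Gp; rewrite /H ifT; last by lia.
  by rewrite G0 divzz lt0r_neq0.
have Ge : energy 0 n.-1 G <= n%:Z * K%:Z.
  have [_ _ _] := Gp; rewrite expr0n add0r; apply: le_trans.
  have := energy_cat 0 n.-1 1 G; rewrite addn1 nP => ->.
  by rewrite lerDl /energy big_ord1 sqr_ge0.
have D2 : (16 ^ c)%N%:Z = D ^+ 2.
  by rewrite -[16%N]/(4 * 4)%N expnMn expr2.
have sumE : (\sum_(i < n.-1) f i)%N%:Z = \sum_(i < n.-1) `|H i.+1%:Z - H i%:Z|.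
  by rewrite (big_morph Posz PoszD (erefl _)); apply: eq_bigr => i _; rewrite abszE.
have := H_sum (m := n.-1) ltac:(lia); rewrite -sumE.
set s := (\sum_(i < n.-1) f i)%N => sle.
have Kc' : K%:Z <= D ^+ 2 by rewrite -D2; lia.
have s2 : 2 * D ^+ 2 * s%:Z <= 4 * (D ^+ 2 * n%:Z).
  have : n%:Z * K%:Z <= n%:Z * D ^+ 2 by rewrite ler_pM2l; lia.
  have : 3 * D ^+ 2 * n.-1%:Z <= 3 * D ^+ 2 * n%:Z.
    by apply: ler_wpM2l; [rewrite mulr_ge0 // sqr_ge0|lia].
  lia.
have DD : 0 < D ^+ 2 by rewrite exprn_gt0.
have sn : s%:Z <= 2 * n%:Z.
  by rewrite -(ler_pM2l (x := 2 * D ^+ 2)); lia.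
rewrite H1 H0; lia.
Qed.

End profile.
End bump_animals.

(** * Integrability of the maxima, and the lower bound *)

Section greedy_summable.
Context d (T : measurableType d) (R : realType) (P : probability T R).
Variable h : Z2 -> {RV P >-> R}.
Hypothesis iid : iid_standard_gaussian h.
Variables (N : nat) (F : set {fset Z2}).
Hypotheses (FN : F `<=` animals N) (F0 : F !=set0).

Lemma ratio_le_max_ratio A t : F A ->
  field_sum h A t / #|` edge_boundary A|%:R <= max_ratio F (h ^~ t).
Proof. by have [_] := max_ratioP (h ^~ t) FN F0; exact. Qed.

Lemma summable_max_ratio : summable P (fun t => max_ratio F (h ^~ t)).
Proof.
have /finite_seqP[s Fs] : finite_set F.
  by apply: sub_finite_set FN _; exact: finite_animals.
have [A0 FA0] := F0.
have -> : (fun t => max_ratio F (h ^~ t)) =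
    (fun t => \big[Num.max/ratio (h ^~ t) A0]_(A <- s) ratio (h ^~ t) A).
  apply/funext => t; have [[A FA AE] Amax] := max_ratioP (h ^~ t) FN F0.
  apply/eqP; rewrite eq_le; apply/andP; split.
    rewrite AE; apply: (@le_bigmax_seq _ _ _ s _ A xpredT (ratio (h ^~ t))) => //.
    by move: FA; rewrite Fs.
  rewrite big_seq; apply: (big_ind (fun x => x <= max_ratio F (h ^~ t))).
  - exact: Amax.
  - by move=> x y xm ym; rewrite ge_max xm.
  - by move=> B Bs; apply: Amax; rewrite Fs.
have sr A : summable P (fun t => ratio (h ^~ t) A).
  have -> : (fun t => ratio (h ^~ t) A) =
      (fun t => #|` edge_boundary A|%:R^-1 * field_sum h A t).
    by apply/funext => t; rewrite mulrC.
  by apply: summableZ; exact: summable_field_sum.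
elim: s {Fs} => [|A s IHs].
  have -> // : (fun t => \big[Num.max/ratio (h ^~ t) A0]_(A <- [::]) ratio (h ^~ t) A)
    = (fun t => ratio (h ^~ t) A0) by apply/funext => t; rewrite big_nil.
have -> : (fun t => \big[Num.max/ratio (h ^~ t) A0]_(B <- A :: s) ratio (h ^~ t) B)
    = (fun t => Num.max (ratio (h ^~ t) A)
        (\big[Num.max/ratio (h ^~ t) A0]_(B <- s) ratio (h ^~ t) B)).
  by apply/funext => t; rewrite big_cons.
exact: summable_max.
Qed.

End greedy_summable.

Section lower_bounds.
Context d (T : measurableType d) (R : realType) (P : probability T R).
Variable h : Z2 -> {RV P >-> R}.
Hypothesis iid : iid_standard_gaussian h.
Variable N : nat.
Hypothesis N_gt0 : (0 < N)%N.
Local Notation S := (greedy_simply_connected_animal h N).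

Let bar (k : nat) : {fset Z2} := region 0 0 k (fun=> 1).

Let mem_bar k (v : Z2) : (v \in bar k) = (0 <= v.2 < (if 0 <= v.1 < k%:Z then 1 else 0)).
Proof.
by rewrite in_region add0r expn0 mulr1; case: ifP; lia.
Qed.

Lemma bar_animal k : (0 < k)%N -> (k <= N.+1)%N -> simply_connected_animals N (bar k).
Proof.
move=> k0 kN.
apply: (subgraph_animal (H := fun x => if 0 <= x < k%:Z then 1 else 0)
  k0 _ _ (mem_bar k) kN).
- by move=> x /= ->.
- by move=> x /negbTE /= ->.
- by move=> x; case: ifP; lia.
Qed.

Let sc_sub : simply_connected_animals N `<=` animals N.
Proof. by move=> A []. Qed.

Let sc_neq0 : simply_connected_animals N !=set0.
Proof. by exists (bar 1); exact: bar_animal. Qed.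

Lemma summable_greedy_sc : summable P S.
Proof. exact: (summable_max_ratio iid sc_sub). Qed.

Lemma summable_greedy : summable P (greedy_animal h N).
Proof.
apply: (summable_max_ratio iid (N := N)) => //.
by have [A /sc_sub FA] := sc_neq0; exists A.
Qed.

Lemma greedy_sc_le t : S t <= greedy_animal h N t.
Proof.
have [[A FA AE] _] := max_ratioP (h ^~ t) sc_sub sc_neq0.
have aN : animals N `<=` animals N by [].
have a0 : animals N !=set0 by exists A; exact: sc_sub.
have [_ amax] := max_ratioP (h ^~ t) aN a0.
by rewrite [S t]AE; exact: amax (sc_sub FA).
Qed.

Let greedy_ge A t : simply_connected_animals N A ->
  field_sum h A t / #|` edge_boundary A|%:R <= S t.
Proof. by move=> FA; exact: (ratio_le_max_ratio h sc_sub sc_neq0 t FA). Qed.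

Lemma edge_boundary_gt0 (A : {fset Z2}) : origin \in A -> (0, -1) \notin A ->
  (0 < #|` edge_boundary A|)%N.
Proof.
move=> A0 A1; rewrite cardfs_gt0; apply/fset0Pn; exists [fset origin; (0, -1)]%fset.
apply/imfset2P; exists origin => //.
by exists (0, -1) => //; rewrite inE /= A1 andbT !inE.
Qed.

Let bar1 t : field_sum h (bar 1) t = h origin t.
Proof.
have -> : bar 1 = [fset origin]%fset.
  apply/fsetP => -[x y]; rewrite mem_bar inE /= xpair_eqE.
  by case: ifP; lia.
by rewrite /field_sum big_seq_fset1.
Qed.

(** The singleton of the origin gives a floor for [S] where the best bump animal has a negative sum,
    since an upper bound on its perimeter is then useless. *)
Lemma greedy_ge_origin t : - `|h origin t| <= S t.
Proof.
apply: le_trans (greedy_ge t (bar_animal (k := 1) isT isT)).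
rewrite bar1; set k := #|` _|.
have [->|k0] := posnP k; first by rewrite invr0 mulr0 oppr_le0.
rewrite lerNl -mulNr ler_pdivrMr ?ltr0n//.
apply: (@le_trans _ _ `|h origin t|); first by rewrite -normrN ler_norm.
by rewrite ler_peMr// ler1n.
Qed.

Lemma mean_norm_le v : mean P (fun t => `|h v t|) <= 4.
Proof.
have sE (a : R) : summable P (fun t => expR (a * h v t)).
  have := summable_expR_lin iid (fun=> a) (s := [:: v]) isT.
  by under eq_fun do rewrite big_seq1.
have mE (a : R) : mean P (fun t => expR (a * h v t)) = expR (a ^+ 2 / 2).
  have := mean_expR_lin iid (fun=> a) (s := [:: v]) isT.
  by under eq_fun do rewrite big_seq1; rewrite big_seq1.
apply: (@le_trans _ _ (mean P (fun t => expR (1 * h v t) + expR (-1 * h v t)))).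
  apply: le_mean.
  - by apply: summable_norm; exact: summable_gaussian.
  - exact: summableD.
  - by move=> t; rewrite mul1r mulN1r norm_le_expR.
rewrite meanD// !mE sqrrN !expr1n.
by have := @expR_le_inv R (1 / 2); lra.
Qed.

(** The profiles start at height [D], one full cell, with slope 0, so every column is nonempty. The
    loss of 4 bounds the mean of [|h origin|]. *)
Lemma mean_greedy_sc_ge_bumps (c K : nat) : (K <= 16 ^ c)%N -> (2 ^ K <= N)%N ->
  (gains c K)%:R / (7 * (4096 * (2 ^ c)%N%:R)) - 4 <= mean P S.
Proof.
move=> Kc KN; set D := (4 ^ c)%N%:Z; set n : R := (2 ^ K)%N%:R.
have n0 : 0 < n by rewrite ltr0n expn_gt0.
pose F := bumps c K 0 D 0.
have sb := summable_best iid F; have sS := summable_greedy_sc.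
have sn : summable P (fun t => `|h origin t|).
  by apply: summable_norm; exact: summable_gaussian.
have key t : (7 * n)^-1 * best h F t + -1 * `|h origin t| <= S t.
  have [A AF ->] := best_attained h t (bumps_neq0 c K 0 D 0).
  have [G Gp AE] := bumpsP AF.
  have scA : simply_connected_animals N A by rewrite AE; exact: profile_animal.
  have bA : (#|` edge_boundary A| <= 7 * 2 ^ K)%N by rewrite AE profile_boundary.
  have A0 : (0 < #|` edge_boundary A|)%N.
    have [[_ + _] _] := scA; move/edge_boundary_gt0; apply.
    by rewrite AE in_region /=; lia.
  have i0 : 0 < (7 * n)^-1 by rewrite invr_gt0; lra.
  have nr := normr_ge0 (h origin t).
  case: (leP 0 (field_sum h A t)) => s0; last first.
    have := greedy_ge_origin t; have : (7 * n)^-1 * field_sum h A t <= 0.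
      by rewrite pmulr_rle0// ltW.
    lra.
  have := greedy_ge t scA.
  have : (7 * n)^-1 * field_sum h A t <= field_sum h A t / #|` edge_boundary A|%:R.
    rewrite mulrC ler_wpM2l// lef_pV2 ?posrE ?ltr0n//; last by lra.
    by rewrite /n -natrM ler_nat.
  lra.
have D0 : 0 <= D by [].
have := bumps_gain iid c (j := K) 0 (y := D) (z := 0) D0; rewrite mul0r addr0.
move=> /(_ D0); rewrite -/n -/F => gain.
apply: (@le_trans _ _ (mean P (fun t => (7 * n)^-1 * best h F t
  + -1 * `|h origin t|))); last first.
  by apply: le_mean => //; apply: summableD; exact: summableZ.
rewrite meanD; [|exact: summableZ|exact: summableZ].
rewrite !meanZ//; have := mean_norm_le origin.
have i0 : 0 < (7 * n)^-1 by rewrite invr_gt0; lra.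
suff : (gains c K)%:R / (7 * (4096 * (2 ^ c)%N%:R)) <= (7 * n)^-1 * mean P (best h F).
  lra.
apply: le_trans (ler_wpM2l (ltW i0) gain).
rewrite !invfM; set m := n^-1; set q := (2 ^ c)%N%:R^-1; set g := (gains c K)%:R.
have mn : m * n = 1 by rewrite mulVf// gt_eqF.
have -> : 7^-1 * m * (n * g * (4096^-1 * q)) = (m * n) * (g * (7^-1 * (4096^-1 * q))).
  by lra.
by rewrite mn mul1r.
Qed.

(** The bump bound is negative for small [N]; this one is uniform. The cell [e] is added to the
    origin exactly when its value is positive, a choice independent of the value at the origin, and
    the gain is at least [1/512] over a perimeter of at most 6. *)
Lemma mean_greedy_sc_ge : 3072^-1 <= mean P S.
Proof.
pose e : Z2 := (1, 0).
have b2 : bar 2 = [fset origin; e]%fset.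
  apply/fsetP => -[x y]; rewrite mem_bar !inE /= !xpair_eqE.
  by case: ifP; lia.
have oe : origin != e by [].
have f2 t : field_sum h (bar 2) t = h origin t + h e t.
  rewrite b2 field_sumU ?fdisjoint1X ?inE//.
  by rewrite /field_sum !big_seq_fset1.
have sc2 : simply_connected_animals N (bar 2) by apply: bar_animal; lia.
have b2_le : (#|` edge_boundary (bar 2)| <= 6)%N.
  have := @subgraph_boundary 2 (fun x => if 0 <= x < 2%:Z then 1 else 0) (bar 2).
  move=> bd; apply: leq_trans (bd _ _ _ (mem_bar 2)) _ => //.
  - by move=> x /= ->.
  - by move=> x /negbTE /= ->.
  by rewrite !big_ord_recl big_ord0.
have b2_gt0 : (0 < #|` edge_boundary (bar 2)|)%N.
  by apply: edge_boundary_gt0; rewrite mem_bar.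
set b : R := #|` edge_boundary (bar 2)|%:R^-1.
have b16 : 6^-1 <= b.
  by rewrite lef_pV2 ?posrE ?ltr0n// ler_nat.
set k : R := #|` edge_boundary (bar 1)|%:R^-1.
pose p t : R := if 0 < h e t then 1 else 0.
have de : determined h [fset e]%fset (h e) by apply: determined_coord; rewrite inE.
have dor : determined h [fset origin]%fset (h origin).
  by apply: determined_coord; rewrite inE.
have dp : determined h [fset e]%fset p.
  by apply: measurable_fun_ifT => //; exact: measurable_fun_ltr.
have p0 t : 0 <= p t by rewrite /p; case: ifP.
have se := summable_gaussian iid e; have so := summable_gaussian iid origin.
have sp : summable P p.
  apply: (@le_summable _ _ _ _ _ (fun=> 1)); last exact: summable_cst.
    exact: determined_measurable dp.
  by move=> t; rewrite ger0_norm// /p; case: ifP.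
have dis : [disjoint [fset e] & [fset origin]]%fset by rewrite fdisjoint1X inE.
have [spo Epo] := mean_indep iid.1 dis dp dor p0 sp so.
have spos : summable P (fun t => Num.max (h e t) 0).
  by apply: summable_max => //; exact: summable_cst.
have pos : 512^-1 <= mean P (fun t => Num.max (h e t) 0).
  have := mean_pos_part_ge iid (S := [:: e]) isT.
  rewrite sqrtr1 div1r.
  by under eq_fun do rewrite big_seq1.
have key t : b * Num.max (h e t) 0 + ((b - k) * (p t * h origin t)
    + k * h origin t) <= S t.
  rewrite /p; case: ltP => e0.
    have := greedy_ge t sc2; rewrite f2 -/b; lra.
  have := greedy_ge t (bar_animal (k := 1) isT isT).
  rewrite bar1 -/k; lra.
apply: (@le_trans _ _ (mean P (fun t => b * Num.max (h e t) 0 +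
  ((b - k) * (p t * h origin t) + k * h origin t)))); last first.
  apply: le_mean => //; last exact: summable_greedy_sc.
  by apply: summableD; [exact: summableZ|apply: summableD; exact: summableZ].
rewrite meanD; [|exact: summableZ|by apply: summableD; exact: summableZ].
rewrite meanD; [|exact: summableZ|exact: summableZ].
rewrite !meanZ// Epo (mean_gaussian iid) !mulr0 !addr0.
nra.
Qed.

End lower_bounds.

Section logarithmic_scales.
Variable R : realType.

Lemma powR_16 (n : nat) : (16 ^+ n) `^ (3 / 4) = 8 ^+ n :> R.
Proof.
have -> : 16 ^+ n = ((2 ^+ n) `^ 4%:R) :> R.
  by rewrite powR_mulrn ?exprn_ge0// -exprM mulnC exprM; congr (_ ^+ _); lra.
rewrite -powRrM (_ : 4%:R * (3 / 4) = 3%:R); last by lra.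
by rewrite powR_mulrn ?exprn_ge0// -exprM mulnC exprM; congr (_ ^+ _); lra.
Qed.

Lemma ln2_bounds : 1 / 2 <= (ln 2 : R) <= 1.
Proof.
apply/andP; split.
  rewrite -(@expRK R (1 / 2)) ler_ln ?posrE ?expR_gt0//.
  by have := @expR_le_inv R (1 / 2); lra.
rewrite -[X in _ <= X](@expRK R) ler_ln ?posrE ?expR_gt0//.
by have := @expR_ge1Dx R 1; lra.
Qed.

(** [c] is the base 16 logarithm of [K] rounded up, so [16^c] is within a factor 16 of [K], and
    [8^c] is its power [3/4]. The constants are [16^(3/4) = 8] and [256^(3/4) = 64]. *)
Lemma log_scales (N : nat) : (3 <= N)%N -> exists c K : nat,
  [/\ (2 ^ K <= N < 2 ^ K.+1)%N, (0 < K)%N, (K <= 16 ^ c <= 16 * K)%N,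
    (ln N%:R) `^ (3 / 4) <= 8 * 8 ^+ c :> R &
    8 ^+ c <= 64 * (ln N%:R) `^ (3 / 4) :> R].
Proof.
move=> N3; pose K := trunc_log 2 N; pose c := up_log 16 K.
have /andP[KN NK] : (2 ^ K <= N < 2 ^ K.+1)%N by apply: trunc_log_bounds; lia.
have K0 : (0 < K)%N by rewrite trunc_log_gt0; lia.
have Kc : (K <= 16 ^ c)%N by apply: up_logP.
have cK : (16 ^ c <= 16 * K)%N.
  case: (ltnP 1 K) => K1; last first.
    by rewrite /c (_ : K = 1)%N ?up_log1; lia.
  have /andP[+ _] := up_log_bounds (isT : 1 < 16)%N K1; rewrite -/c.
  have : (0 < c)%N by rewrite up_log_gt0.
  by case: (c) => // c' _ /=; rewrite expnS; lia.
have /andP[l1 l2] := ln2_bounds.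
have lnX k : ln ((2 ^ k)%N%:R : R) = k%:R * ln 2.
  by rewrite natrX lnXn// mulr_natl.
have N0 : 0 < N%:R :> R by rewrite ltr0n; lia.
have p0 k : 0 < (2 ^ k)%N%:R :> R by rewrite ltr0n expn_gt0.
have lnN1 : K%:R * (1 / 2) <= ln (N%:R : R).
  apply: (@le_trans _ _ (K%:R * ln 2)); first exact: ler_wpM2l.
  by rewrite -lnX ler_ln ?posrE// ler_nat.
have lnN2 : ln (N%:R : R) <= K.+1%:R.
  apply: (@le_trans _ _ (K.+1%:R * ln 2)); last by rewrite ler_piMr.
  by rewrite -lnX ler_ln ?posrE// ler_nat ltnW.
have lnN0 : 0 <= ln (N%:R : R).
  by apply: le_trans lnN1; rewrite mulr_ge0//; lra.
have X16 : (16 ^ c)%N%:R = 16 ^+ c :> R by rewrite natrX.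
exists c, K; split; rewrite ?KN ?NK ?Kc ?cK//.
- rewrite -exprS -powR_16; apply: ge0_ler_powR; rewrite ?nnegrE; [lra|exact: lnN0|by rewrite exprn_ge0|].
  apply: le_trans lnN2 _; rewrite exprS -X16 -[16]/(16%:R) -natrM ler_nat.
  by lia.
- have -> : 64 = (16 ^+ 2) `^ (3 / 4) :> R by rewrite powR_16; lra.
  rewrite -powRM ?exprn_ge0// -powR_16.
  apply: ge0_ler_powR; rewrite ?nnegrE;
    [lra|by rewrite exprn_ge0|by rewrite mulr_ge0// exprn_ge0|].
  rewrite -X16; have : (16 ^ c)%N%:R <= (16 * K)%N%:R :> R by rewrite ler_nat.
  by rewrite natrM; lra.
Qed.

End logarithmic_scales.

Lemma gains_ge c K : (K <= 2 * gains c K + 2 * c + 5)%N.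
Proof.
elim: K {-2}K (leqnn K) => [|m IHm] K; first by rewrite leqn0 => /eqP ->.
case: K => [|[|K]]; [by []|by rewrite /=; lia|] => Km.
have := IHm K ltac:(lia); rewrite /=.
have [] := boolP (odd K) => /= _; case: (leqP (2 * c + 4) K) => cK;
  case: (leqP (2 * c + 4) K.+1) => cK1; lia.
Qed.

Section lower_bound.
Context d (T : measurableType d) (R : realType) (P : probability T R).
Variable h : Z2 -> {RV P >-> R}.
Hypothesis iid : iid_standard_gaussian h.

Lemma lower_bound (N : nat) : (3 <= N)%N ->
  2 ^- 42 * (ln N%:R) `^ (3 / 4) <= mean P (greedy_simply_connected_animal h N).
Proof.
move=> N3; have N0 : (0 < N)%N by lia.
have [c [K [/andP[KN _] K0 /andP[Kc cK] xle _]]] := log_scales R N3.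
have b1 := mean_greedy_sc_ge iid N0.
have b2 := mean_greedy_sc_ge_bumps iid N0 Kc KN.
set S := mean _ _ in b1 b2 *; set x := _ `^ _ in xle *.
set e : R := 8 ^+ c in xle; have e0 : 0 < e by rewrite exprn_gt0.
(* 7 is from the perimeter, 4096 from the gain, 64 from [16^c <= 64 * gains]. The second factor [p]
   absorbs the range of [N] where the bump bound is too weak. *)
pose p : R := 2 ^+ 21; have p_ge : 7 * 4096 * 64 <= p by rewrite /p; lra.
have p0 : 0 < p by lra.
have pV : 0 < p^-1 by rewrite invr_gt0.
have pp : p * p^-1 = 1 by rewrite mulfV// gt_eqF.
have -> : 2 ^- 42 = p^-1 * p^-1 :> R by rewrite -invfM -exprD.
have x0 : 0 <= x by exact: powR_ge0.
set i := p^-1 in pV pp *.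
(* [c <= 2] makes the left-hand side negative. *)
have b3 : e * i - 4 <= S.
  have [c2|c3] := leqP c 2.
    have : e <= 8 ^+ 2 by rewrite /e ler_eXn2l//; lra.
    have : 64 * i <= 1 by nra.
    nra.
  apply: le_trans b2; rewrite lerB//.
  (* For [c >= 3] the scales lost near the bottom number at most [16^c / 32], half of the guaranteed
     [K >= 16^c / 16]; every other remaining scale gains, hence 64. *)
  have gK := gains_ge c K; have c32 : (32 * (2 * c + 5) <= 16 ^ c)%N.
    rewrite -(subnK c3); elim: (c - 3)%N => [//|m IHm].
    by rewrite addSn expnS; move: (16 ^ _)%N IHm; clear; lia.
  have g64 : (16 ^ c <= 64 * gains c K)%N.
    by move: (16 ^ c)%N (gains c K) c32 cK gK; clear; lia.
  have p2 : 0 < (2 ^ c)%N%:R :> R by rewrite ltr0n expn_gt0.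
  rewrite ler_pdivlMr; last by lra.
  have eE : e * (2 ^ c)%N%:R = (16 ^ c)%N%:R.
    by rewrite /e -[8]/(8%:R) -natrX -natrM -expnMn.
  have gR : (16 ^ c)%N%:R <= 64 * (gains c K)%:R :> R.
    by rewrite -[64]/(64%:R) -natrM ler_nat.
  have i64 : 7 * 4096 * 64 * i <= 1 by nra.
  have g0 : 0 <= (gains c K)%:R :> R by [].
  nra.
(* For [e >= 8 p] the loss of 4 is at most half of [e / p]. Otherwise [x <= 64 p], and the uniform
   bound [1/3072] suffices. *)
have [ep|ep] := leP (8 * p) e.
  have xp : x * i <= 8 * e * i by rewrite ler_pM2r.
  have i16 : i <= 1 / 16 by nra.
  have : i * (x * i) <= 1 / 16 * (x * i).
    by rewrite ler_wpM2r// mulr_ge0// ltW.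
  have : 8 <= e * i by nra.
  lra.
have xp : x * i <= 64 by nra.
have : i * (x * i) <= i * 64 by rewrite ler_pM2l.
nra.
Qed.

End lower_bound.

(** * Total variation and closed walks *)

Section triangles.
Implicit Types (p q r v : Z2).

Definition cross p q r : int :=
  (q.1 - p.1) * (r.2 - p.2) - (q.2 - p.2) * (r.1 - p.1).

(** A cell is tested at its upper left corner, and columns form a half-open range, so that
    consecutive segments of a left-to-right chain share no column. *)
Definition below p q v : bool :=
  (p.1 <= v.1 < q.1) && (cross p q (v.1, v.2 + 1) <= 0).

(* [seg p q] is the indicator of the cells under the segment [pq], with sign, so
   that the sum of [seg] along a closed polygon is its winding number; the cell
   [v] has the lattice points [v] and [v + (1, 1)] as opposite corners. *)
Definition seg p q v : int := (below p q v)%:Z - (below q p v)%:Z.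

Definition tri p q r v : int := seg p q v + seg q r v + seg r p v.

Lemma segN p q v : seg q p v = - seg p q v.
Proof. by rewrite /seg opprB. Qed.

Lemma seg_id p v : seg p p v = 0.
Proof. by rewrite /seg subrr. Qed.

Definition height p q (x : int) : int :=
  ((p.2 * (q.1 - p.1) + (q.2 - p.2) * (x - p.1)) %/ (q.1 - p.1))%Z.

Lemma belowE p q v : p.1 <= v.1 < q.1 -> below p q v = (v.2 < height p q v.1).
Proof.
move=> vpq; rewrite /below vpq /= /height /cross /=.
rewrite -[RHS]lezD1 lez_divRL; last by lia.
by apply/idP/idP; lia.
Qed.

Lemma below_out p q v : ~~ (p.1 <= v.1 < q.1) -> below p q v = false.
Proof. by rewrite /below => /negbTE ->. Qed.

(** [X] is twice the signed area and [l] the width, which accounts for rounding in each column. A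
    degenerate triangle must count for nothing: otherwise every straight piece of a walk would be
    charged at every scale. *)
Definition tri_bound (X l : int) : int := if X == 0 then 0 else `|X| + l.

(** The fractions [N1 / d] and [N2 / c] differ by at most [|X| / c], hence their floors by less than
    [|X| / c + 1], and not at all if [X = 0]. *)
Let floor_gap (d c N1 N2 X : int) : 0 < d -> 0 < c ->
  `|c * N1 - d * N2| <= d * `|X| ->
  c * `|(N1 %/ d)%Z - (N2 %/ c)%Z| <= tri_bound X c.
Proof.
move=> d0 c0 gap.
have d0' := lt0r_neq0 d0; have c0' := lt0r_neq0 c0.
have := divz_eq N1 d; have := divz_eq N2 c.
have := modz_ge0 N1 d0'; have := modz_ge0 N2 c0'.
have := ltz_pmod N1 d0; have := ltz_pmod N2 c0.
set F1 := (N1 %/ d)%Z; set F2 := (N2 %/ c)%Z.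
set r1 := (N1 %% d)%Z; set r2 := (N2 %% c)%Z => r2c r1d r20 r10 N2E N1E.
have e1 : d * (c * (F1 - F2)) = (c * N1 - d * N2) - c * r1 + d * r2 by rewrite N1E N2E; lia.
have cr1 : 0 <= c * r1 < c * d by nia.
have dr2 : 0 <= d * r2 < d * c by nia.
have u1 : d * (c * (F1 - F2)) < d * (`|X| + c) by lia.
have u2 : d * (- (c * (F1 - F2))) < d * (`|X| + c) by lia.
rewrite ltr_pM2l // in u1; rewrite ltr_pM2l // in u2.
rewrite /tri_bound; case: eqP => [X0|_]; last by nia.
rewrite X0 normr0 add0r in u1 u2.
have F12 : F1 - F2 = 0 by nia.
by rewrite F12 normr0 mulr0.
Qed.

Variables xs ys : seq int.
Hypotheses (xs_uniq : uniq xs) (ys_uniq : uniq ys).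

Definition l1 (f : Z2 -> int) : int := \sum_(x <- xs) \sum_(y <- ys) `|f (x, y)|.

Lemma eq_l1 f g : (forall v, f v = g v) -> l1 f = l1 g.
Proof. by move=> fg; apply: eq_bigr => x _; apply: eq_bigr => y _; rewrite fg. Qed.

Lemma l1N f : l1 (fun v => - f v) = l1 f.
Proof. by apply: eq_bigr => x _; apply: eq_bigr => y _; rewrite normrN. Qed.

Lemma l1D f g : l1 (fun v => f v + g v) <= l1 f + l1 g.
Proof.
rewrite /l1 -big_split; apply: ler_sum => x _; rewrite -big_split.
by apply: ler_sum => y _; exact: ler_normD.
Qed.

Lemma l1_sum (I : Type) (s : seq I) (f : I -> Z2 -> int) :
  l1 (fun v => \sum_(i <- s) f i v) <= \sum_(i <- s) l1 (f i).
Proof.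
elim: s => [|i s IHs].
  rewrite big_nil (@eq_l1 _ (fun=> 0)); last by move=> v; rewrite big_nil.
  by rewrite /l1 big1 // => x _; rewrite big1.
rewrite big_cons (@eq_l1 _ (fun v => f i v + \sum_(j <- s) f j v)); last first.
  by move=> v; rewrite big_cons.
by apply: le_trans (l1D _ _) _; rewrite lerD2l.
Qed.

Let sum_interval (s : seq int) (a b : int) : uniq s -> a <= b ->
  \sum_(y <- s) (a <= y < b)%R%:Z <= b - a.
Proof.
move=> us ab.
have -> : \sum_(y <- s) (a <= y < b)%R%:Z = (count (fun y => a <= y < b) s)%:Z.
  by elim: (s) => [|y s' IHs]; rewrite ?big_nil // big_cons IHs.
have -> : b - a = (size [seq a + i%:Z | i <- iota 0 `|b - a|%N])%:Z.
  by rewrite size_map size_iota; lia.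
rewrite lez_nat -size_filter; apply: uniq_leq_size; first exact: filter_uniq.
move=> y; rewrite mem_filter => /andP[yab _]; apply/mapP.
by exists `|y - a|%N; [rewrite mem_iota; lia|lia].
Qed.

Let sum_gap (a b : int) :
  \sum_(y <- ys) `|(y < a)%R%:Z - (y < b)%R%:Z| <= `|a - b|.
Proof.
wlog ab : a b / a <= b => [hw|].
  case: (leP a b) => [|/ltW] /hw // hba; rewrite distrC.
  by apply: le_trans hba; apply: ler_sum => y _; rewrite distrC.
rewrite distrC ger0_norm ?subr_ge0 //; apply: le_trans (sum_interval ys_uniq ab).
by apply: ler_sum => y _; lia.
Qed.

(** The vertical gap between the long side and the other two is at most [|X| / l], its value at [b].
    A column therefore contains at most [|X| / l + 1] cells, and there are [l] columns. *)
Let tri_sorted (a b c : Z2) : a.1 <= b.1 -> b.1 <= c.1 ->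
  l1 (tri a b c) <= tri_bound (cross a b c) (c.1 - a.1).
Proof.
move=> ab bc; set X := cross a b c; set l := c.1 - a.1.
have triE v : tri a b c v = (below a b v)%:Z + (below b c v)%:Z - (below a c v)%:Z.
  have o1 : below b a v = false by apply: below_out; lia.
  have o2 : below c b v = false by apply: below_out; lia.
  have o3 : below c a v = false by apply: below_out; lia.
  by rewrite /tri /seg o1 o2 o3; lia.
have B0 : 0 <= tri_bound X l by rewrite /tri_bound; case: eqP => _; lia.
have col x : l * (\sum_(y <- ys) `|tri a b c (x, y)|) <=
    (a.1 <= x < c.1)%R%:Z * tri_bound X l.
  case: (boolP (a.1 <= x < c.1)) => xac; last first.
    rewrite mul0r big1 ?mulr0 // => y _; rewrite triE !below_out //=; lia.
  have l0 : 0 < l by lia.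
  have [xb|xb] := boolP (x < b.1).
    have -> : \sum_(y <- ys) `|tri a b c (x, y)| =
        \sum_(y <- ys) `|(y < height a b x)%R%:Z - (y < height a c x)%R%:Z|.
      apply: eq_bigr => y _; rewrite triE (below_out (p := b)) /=; last by lia.
      by rewrite addr0 !belowE //=; lia.
    apply: le_trans (ler_wpM2l (ltW l0) (sum_gap _ _)) _.
    rewrite mul1r; apply: floor_gap => //; first by lia.
    have -> : l * (a.2 * (b.1 - a.1) + (b.2 - a.2) * (x - a.1)) -
        (b.1 - a.1) * (a.2 * (c.1 - a.1) + (c.2 - a.2) * (x - a.1)) =
        - ((x - a.1) * X) by rewrite /l /X /cross; lia.
    rewrite normrN normrM ler_wpM2r //; lia.
  have -> : \sum_(y <- ys) `|tri a b c (x, y)| =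
      \sum_(y <- ys) `|(y < height b c x)%R%:Z - (y < height a c x)%R%:Z|.
    apply: eq_bigr => y _; rewrite triE (below_out (p := a) (q := b)) /=; last by lia.
    by rewrite add0r !belowE //=; lia.
  apply: le_trans (ler_wpM2l (ltW l0) (sum_gap _ _)) _.
  rewrite mul1r; apply: floor_gap => //; first by lia.
  have -> : l * (b.2 * (c.1 - b.1) + (c.2 - b.2) * (x - b.1)) -
      (c.1 - b.1) * (a.2 * (c.1 - a.1) + (c.2 - a.2) * (x - a.1)) =
      - ((c.1 - x) * X) by rewrite /l /X /cross; lia.
  rewrite normrN normrM ler_wpM2r //; lia.
have [l0|l0] := leP l 0.
  rewrite /l1 big1 // => x _; rewrite big1 // => y _.
  by rewrite triE !below_out //=; lia.
rewrite -(ler_pM2l l0) mulr_sumr.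
apply: le_trans (ler_sum _ (fun x _ => col x)) _.
by rewrite -mulr_suml ler_wpM2r // sum_interval //; lia.
Qed.

Lemma l1_tri p q r (l : int) :
  `|p.1 - q.1| <= l -> `|q.1 - r.1| <= l -> `|p.1 - r.1| <= l ->
  l1 (tri p q r) <= tri_bound (cross p q r) l.
Proof.
move=> pq qr pr.
have cyc (a b c : Z2) : l1 (tri a b c) = l1 (tri b c a) /\ cross a b c = cross b c a.
  by split; [apply: eq_l1 => v; rewrite /tri; lia|rewrite /cross; lia].
have swp (a b c : Z2) : l1 (tri a b c) = l1 (tri b a c) /\ cross a b c = - cross b a c.
  split; last by rewrite /cross; lia.
  rewrite -l1N; apply: eq_l1 => v; rewrite /tri.
  by rewrite (segN a b) (segN c a) (segN b c); lia.
have tbN X : tri_bound (- X) l = tri_bound X l by rewrite /tri_bound oppr_eq0 normrN.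
have sorted (a b c : Z2) : a.1 <= b.1 -> b.1 <= c.1 -> c.1 - a.1 <= l ->
    l1 (tri a b c) <= tri_bound (cross a b c) l.
  move=> ab bc ac; apply: le_trans (tri_sorted ab bc) _.
  by rewrite /tri_bound; case: eqP => _; lia.
have [s1 c1] := swp p q r; have [s2 c2] := cyc p q r; have [s3 c3] := cyc q r p.
have [s4 c4] := swp q r p; have [s5 c5] := swp r p q.
case: (leP p.1 q.1) => h1; case: (leP q.1 r.1) => h2; case: (leP p.1 r.1) => h3.
- by apply: sorted; lia.
- by apply: sorted; lia.
- by rewrite s2 s3 s5 c2 c3 c5 tbN; apply: sorted; lia.
- by rewrite s2 s3 c2 c3; apply: sorted; lia.
- by rewrite s1 c1 tbN; apply: sorted; lia.
- by rewrite s2 c2; apply: sorted; lia.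
- by lia.
- by rewrite s2 s4 c2 c4 tbN; apply: sorted; lia.
Qed.

End triangles.

(** * Boundary flows of integer weights and windings of closed walks *)

Section total_variation.
Variable N : nat.
Implicit Types (p q e v : Z2) (w : Z2 -> int).

Definition irange (a : int) (n : nat) : seq int := [seq a + i%:Z | i <- iota 0 n].

Lemma mem_irange a n x : (x \in irange a n) = (a <= x < a + n%:Z).
Proof.
apply/mapP/idP => [[i]|xa]; first by rewrite mem_iota => + ->; lia.
by exists `|x - a|%N; [rewrite mem_iota; lia|lia].
Qed.

Lemma irange_uniq a n : uniq (irange a n).
Proof. by rewrite map_inj_uniq ?iota_uniq // => i j /addrI []. Qed.

Definition cells := irange (- N%:Z) (N + N).+1.
Definition corners := irange (- N%:Z) (N + N).+2.

Definition in_corners p := (- N%:Z <= p.1 <= N%:Z + 1) && (- N%:Z <= p.2 <= N%:Z + 1).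

Definition supported w := forall v,
  ~~ ((- N%:Z <= v.1 <= N%:Z) && (- N%:Z <= v.2 <= N%:Z)) -> w v = 0.

(* The signed number of boundary edges of [w] traversed from [p] to its right
   (resp. upper) neighbour, [w] being on the right of its boundary. *)
Definition rflow w p : int := w (p.1, p.2 - 1) - w p.
Definition uflow w p : int := w p - w (p.1 - 1, p.2).

Definition tv w : int :=
  \sum_(x <- corners) \sum_(y <- corners) (`|rflow w (x, y)| + `|uflow w (x, y)|).

Lemma tv_ge0 w : 0 <= tv w.
Proof. by apply: sumr_ge0 => x _; apply: sumr_ge0 => y _; rewrite addr_ge0. Qed.

Lemma tv_add w w1 w2 :
  (forall p, `|rflow w p| = `|rflow w1 p| + `|rflow w2 p|) ->
  (forall p, `|uflow w p| = `|uflow w1 p| + `|uflow w2 p|) ->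
  tv w = tv w1 + tv w2.
Proof.
move=> r12 u12; rewrite /tv -big_split; apply: eq_bigr => x _.
by rewrite -big_split; apply: eq_bigr => y _; rewrite r12 u12 addrACA.
Qed.

Lemma rflow_supp w p : supported w -> rflow w p != 0 ->
  in_corners p && in_corners (p.1 + 1, p.2).
Proof.
move=> ws; apply: contraR => pV; apply/eqP; rewrite /rflow !ws ?subr0 //.
  by move: pV; rewrite /in_corners /=; lia.
by move: pV; rewrite /in_corners /=; lia.
Qed.

Lemma uflow_supp w p : supported w -> uflow w p != 0 ->
  in_corners p && in_corners (p.1, p.2 + 1).
Proof.
move=> ws; apply: contraR => pV; apply/eqP; rewrite /uflow !ws ?subr0 //.
  by move: pV; rewrite /in_corners /=; lia.
by move: pV; rewrite /in_corners /=; lia.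
Qed.

Lemma rflow_neq0 w v : supported w -> w v != 0 -> exists p, rflow w p != 0.
Proof.
move=> ws wv; apply: contrapT => nex.
have col (k : nat) : w (v.1, v.2 + k%:Z) = w v.
  elim: k => [|k IHk]; first by rewrite addr0 -surjective_pairing.
  have /eqP : rflow w (v.1, v.2 + k.+1%:Z) == 0.
    by apply: contraT => r0; exfalso; apply: nex; exists (v.1, v.2 + k.+1%:Z).
  rewrite /rflow /= => /eqP; rewrite subr_eq0 => /eqP <-.
  by rewrite -IHk; congr (w (_, _)); lia.
have v_in : - N%:Z <= v.2.
  by apply: contraT => vN; move: wv; rewrite ws //; lia.
have out : w (v.1, v.2 + (N + N).+1%:Z) = 0 by apply: ws => /=; lia.
by rewrite col in out; rewrite out in wv.
Qed.

Lemma tv_gt0 w v : supported w -> w v != 0 -> 0 < tv w.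
Proof.
move=> ws /(rflow_neq0 ws)[p r0].
have /andP[pV _] := rflow_supp ws r0.
have [p1 p2] : p.1 \in corners /\ p.2 \in corners.
  by rewrite !mem_irange; move: pV; rewrite /in_corners; lia.
have inner x : 0 <= \sum_(y <- corners) (`|rflow w (x, y)| + `|uflow w (x, y)|).
  by apply: sumr_ge0 => y _; rewrite addr_ge0.
rewrite /tv (big_rem p.1) //= ltr_wpDr //; first by apply: sumr_ge0 => x _.
rewrite (big_rem p.2) //= ltr_wpDr //.
  by apply: sumr_ge0 => y _; rewrite addr_ge0.
by rewrite -surjective_pairing ltr_wpDr // normr_gt0.
Qed.

Definition active w p := [|| 0 < rflow w p, 0 < uflow w p,
  rflow w (p.1 - 1, p.2) < 0 | uflow w (p.1, p.2 - 1) < 0].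

Definition next w p : Z2 :=
  if 0 < rflow w p then (p.1 + 1, p.2) else
  if 0 < uflow w p then (p.1, p.2 + 1) else
  if rflow w (p.1 - 1, p.2) < 0 then (p.1 - 1, p.2) else (p.1, p.2 - 1).

Definition step_along w p q := [||
  (q == (p.1 + 1, p.2)) && (0 < rflow w p),
  (q == (p.1, p.2 + 1)) && (0 < uflow w p),
  (p == (q.1 + 1, q.2)) && (rflow w q < 0) |
  (p == (q.1, q.2 + 1)) && (uflow w q < 0)].

Lemma next_step w p : active w p -> step_along w p (next w p).
Proof.
rewrite /active /step_along /next; case: p => x y /=.
case: ifPn => [r1 _|r1]; first by rewrite eqxx.
case: ifPn => [u1 _|u1] /=; first by rewrite eqxx orbT.
by case: ifPn => [r2 _|r2 /= u2]; rewrite /= ?subrK ?eqxx ?r2 ?u2 /= ?orbT.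
Qed.

(** The boundary flow of [w] is conserved at every corner, so a corner that is entered can be
    left. *)
Lemma next_active w p : active w p -> active w (next w p).
Proof.
move=> /next_step; move: (next w p) => -[x y]; case: p => x' y'.
rewrite /step_along /active /rflow /uflow /= !xpair_eqE.
by move=> /or4P[] /andP[/andP[/eqP e1 /eqP e2]]; subst; rewrite ?addrK ?subrK; lia.
Qed.

Lemma active_corner w p : supported w -> active w p -> in_corners p.
Proof.
move=> ws /or4P[] f0.
- by have /andP[] := rflow_supp ws (lt0r_neq0 f0).
- by have /andP[] := uflow_supp ws (lt0r_neq0 f0).
- by have /andP[_] := rflow_supp ws (ltr0_neq0 f0); rewrite /= subrK; case: (p).
- by have /andP[_] := uflow_supp ws (ltr0_neq0 f0); rewrite /= subrK; case: (p).
Qed.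

Lemma ex_active w v : supported w -> w v != 0 -> exists p, active w p.
Proof.
move=> ws /(rflow_neq0 ws)[p]; rewrite neq_lt => /orP[r0|r0].
  exists (p.1 + 1, p.2); rewrite /active /= addrK -surjective_pairing r0.
  by rewrite !orbT.
by exists p; rewrite /active r0.
Qed.

(* Following the flow from an active corner eventually closes up. *)
Lemma ex_cycle w v : supported w -> w v != 0 ->
  exists g : nat -> Z2, exists2 L : nat, (0 < L)%N &
    [/\ forall t, in_corners (g t), forall t, (L <= t)%N -> g t = g 0%N,
        forall t, (t < L)%N -> step_along w (g t) (g t.+1) &
        forall s t, (s < L)%N -> (t < L)%N -> g s = g t -> s = t].
Proof.
move=> ws /(ex_active ws)[p0 p0a].
pose f t := iter t (next w) p0.
have fa t : active w (f t) by elim: t => //= t IHt; exact: next_active.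
pose V : seq Z2 := [seq (x, y) | x <- corners, y <- corners].
have fV t : f t \in V.
  have := active_corner ws (fa t); case: (f t) => x y; rewrite /in_corners /= => xy.
  by apply: (allpairs_f pair); rewrite mem_irange; lia.
have ex_rep : exists j, [exists i : 'I_j, f i == f j].
  have : ~~ uniq [seq f i | i <- iota 0 (size V).+1].
    apply/negP => fu; have := uniq_leq_size fu (s2 := V).
    rewrite size_map size_iota ltnn => /(_ _)/negP; apply => // x /mapP[i _ ->].
    exact: fV.
  move=> /(uniqPn p0)[i [j [ij]]]; rewrite size_map size_iota => jV.
  rewrite !(nth_map 0%N) ?size_iota ?nth_iota ?add0n; try by lia.
  by move=> fij; exists j; apply/existsP; exists (Ordinal ij); rewrite fij.
(* The first repetition closes a cycle without inner repetitions. The closed walk then stays at its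
   starting point, which later allows padding to any length. *)
have [j /existsP[i /eqP fij] jmin] := ex_minnP ex_rep.
have ij := ltn_ord i; exists (fun t => if (t < j - i)%N then f (i + t)%N else f i).
exists (j - i)%N; first by lia.
split.
- by move=> t; case: ifP => _; apply: (active_corner ws).
- by move=> t tL; rewrite ifF ?ifT ?addn0 //; lia.
- move=> t tL; rewrite tL.
  have -> : (if (t.+1 < j - i)%N then f (i + t.+1)%N else f i) = f (i + t).+1.
    case: ifP => tL'; first by rewrite addnS.
    by have -> : (i + t).+1 = j by lia; rewrite -fij.
  exact: next_step (fa _).
- move=> s t sL tL; rewrite sL tL => fst; apply/eqP; apply: contraT => st.
  wlog {st} st : s t sL tL fst / (s < t)%N => [hw|].
    by case: (ltngtP s t) st => // st _; [apply: (hw s t)|apply: (hw t s)].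
  have : (j <= i + t)%N.
    apply: jmin; apply/existsP; have h : (i + s < i + t)%N by lia.
    by exists (Ordinal h); apply/eqP.
  by lia.
Qed.

Lemma double_sum_ge (F : Z2 -> int) e : (forall p, 0 <= F p) -> in_corners e ->
  F e <= \sum_(x <- corners) \sum_(y <- corners) F (x, y).
Proof.
move=> F0 eV; have [e1 e2] : e.1 \in corners /\ e.2 \in corners.
  by rewrite !mem_irange; move: eV; rewrite /in_corners; lia.
rewrite (big_rem e.1) //= (big_rem e.2) //= -surjective_pairing -addrA lerDl.
rewrite addr_ge0 //; first by apply: sumr_ge0.
by apply: sumr_ge0 => x _; apply: sumr_ge0.
Qed.

Definition unit_step p q := [|| q == (p.1 + 1, p.2), q == (p.1, p.2 + 1),
  p == (q.1 + 1, q.2) | p == (q.1, q.2 + 1)].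

Lemma step_along_unit w p q : step_along w p q -> unit_step p q.
Proof.
by rewrite /unit_step => /or4P[] /andP[-> _]; rewrite ?orbT.
Qed.

Lemma seg_right a b v : seg (a, b) (a + 1, b) v = ((v.1 == a) && (v.2 < b))%:Z.
Proof. by rewrite /seg /below /cross /=; lia. Qed.

Lemma seg_up a b v : seg (a, b) (a, b + 1) v = 0.
Proof. by rewrite /seg /below /cross /=; lia. Qed.

Lemma unit_stepP (Q : Z2 -> Z2 -> Prop) :
  (forall a b, Q (a, b) (a + 1, b)) -> (forall a b, Q (a, b) (a, b + 1)) ->
  (forall p q, Q p q -> Q q p) -> forall p q, unit_step p q -> Q p q.
Proof.
move=> Qr Qu Qs [a b] [a' b'] /or4P[] /eqP[-> ->] //; apply: Qs => //.
Qed.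

Definition rstep p q e : int :=
  ((p == e) && (q == (e.1 + 1, e.2)))%:Z - ((q == e) && (p == (e.1 + 1, e.2)))%:Z.

Definition ustep p q e : int :=
  ((p == e) && (q == (e.1, e.2 + 1)))%:Z - ((q == e) && (p == (e.1, e.2 + 1)))%:Z.

Definition above e p : bool := (p.1 == e.1) && (e.2 < p.2).

Lemma seg_rstep p q e : unit_step p q ->
  seg p q (e.1, e.2 - 1) - seg p q e = rstep p q e.
Proof.
move: p q; apply: unit_stepP => [a b|a b|p q pq].
- case: e => x y; rewrite !seg_right /rstep /= !xpair_eqE; lia.
- case: e => x y; rewrite !seg_up /rstep /= !xpair_eqE; lia.
- have -> : rstep q p e = - rstep p q e by rewrite /rstep opprB.
  by rewrite !(segN p q); lia.
Qed.

(** The column of cells under a step has its vertical sides on downward rays from [p] and [q]. The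
    [above] terms record these rays and telescope along a closed walk. *)
Lemma seg_ustep p q e : unit_step p q ->
  seg p q e - seg p q (e.1 - 1, e.2) =
  ustep p q e + ((above e p)%:Z - (above e q)%:Z).
Proof.
move: p q; apply: unit_stepP => [a b|a b|p q pq].
- by case: e => x y; rewrite !seg_right /ustep /above /= !xpair_eqE; lia.
- by case: e => x y; rewrite !seg_up /ustep /above /= !xpair_eqE; lia.
- have -> : ustep q p e = - ustep p q e by rewrite /ustep opprB.
  by rewrite !(segN p q); lia.
Qed.

Lemma seg_far p q v : unit_step p q -> v.2 < p.2 -> v.2 < q.2 ->
  seg p q v = (v.1 < q.1)%R%:Z - (v.1 < p.1)%R%:Z.
Proof.
move: p q; apply: (unit_stepP (Q := fun p q => v.2 < p.2 -> v.2 < q.2 -> _)) => [a b|a b|p q pq].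
- by rewrite seg_right /=; lia.
- by rewrite seg_up /=; lia.
- by move=> h1 h2; rewrite (segN p q) pq //; lia.
Qed.

Lemma seg_outside p q v : unit_step p q -> in_corners p -> in_corners q ->
  ~~ (- N%:Z <= v.1 <= N%:Z) || (N%:Z < v.2) -> seg p q v = 0.
Proof.
move: p q; apply: (unit_stepP (Q := fun p q => in_corners p -> in_corners q -> _ -> _ = 0)) => [a b|a b|p q pq].
- by rewrite seg_right /in_corners /=; lia.
- by rewrite seg_up.
- by move=> h1 h2 h3; rewrite (segN p q) pq ?oppr0.
Qed.

Lemma sum_at_most_one (L : nat) (Q : 'I_L -> bool) :
  (forall s t, Q s -> Q t -> s = t) ->
  \sum_(t < L) (Q t)%:Z = [exists t, Q t]%:Z.
Proof.
move=> Q1; case: (boolP [exists t, Q t]) => [/existsP[s Qs]|nQ].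
  rewrite (bigD1 s) //= Qs big1 ?addr0 // => t ts.
  by case Qt: (Q t) => //; case/eqP: ts; exact: Q1.
rewrite big1 // => t _; case Qt: (Q t) => //.
by case/existsP: nQ; exists t.
Qed.

Section winding.
Variables (g : nat -> Z2) (L : nat).
Hypotheses (gV : forall t, in_corners (g t))
  (gL : forall t, (L <= t)%N -> g t = g 0%N)
  (gstep : forall t, (t < L)%N -> unit_step (g t) (g t.+1)).

Definition winding v : int := \sum_(t < L) seg (g t) (g t.+1) v.

Let telescope (f : Z2 -> int) : \sum_(t < L) (f (g t) - f (g t.+1)) = 0.
Proof.
have -> : \sum_(t < L) (f (g t) - f (g t.+1)) = f (g 0%N) - f (g L).
  elim: (L) => [|m IHm]; first by rewrite big_ord0 subrr.
  by rewrite big_ord_recr IHm /=; lia.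
by rewrite (gL (leqnn L)) subrr.
Qed.

Lemma rflow_winding e : rflow winding e = \sum_(t < L) rstep (g t) (g t.+1) e.
Proof.
rewrite /rflow /winding -sumrB; apply: eq_bigr => t _.
by apply: seg_rstep; exact: gstep.
Qed.

Lemma uflow_winding e : uflow winding e = \sum_(t < L) ustep (g t) (g t.+1) e.
Proof.
transitivity (\sum_(t < L) (ustep (g t) (g t.+1) e +
    ((above e (g t))%:Z - (above e (g t.+1))%:Z))); last first.
  by rewrite big_split /= (telescope (fun p => (above e p)%:Z)) addr0.
rewrite /uflow /winding -sumrB; apply: eq_bigr => t _.
by apply: seg_ustep; exact: gstep.
Qed.

(** Beside and above the box no step has a cell under it; below the box every step is a difference
    of one function of its ends, and the sum telescopes. *)
Lemma winding_supported : supported winding.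
Proof.
move=> v vN; have [out|inn] := boolP (~~ (- N%:Z <= v.1 <= N%:Z) || (N%:Z < v.2)).
  by rewrite /winding big1 // => t _; apply: seg_outside => //; exact: gstep.
rewrite -oppr0 -(telescope (fun p => (v.1 < p.1)%R%:Z)) -sumrN.
apply: eq_bigr => t _; rewrite seg_far ?opprB //; first exact: gstep.
  by have := gV t; rewrite /in_corners; lia.
by have := gV t.+1; rewrite /in_corners; lia.
Qed.

Hypothesis ginj : forall s t, (s < L)%N -> (t < L)%N -> g s = g t -> s = t.
Variable w : Z2 -> int.
Hypothesis galong : forall t, (t < L)%N -> step_along w (g t) (g t.+1).

(** A simple cycle that follows the flow uses each edge at most once and in the direction of [f].
    Removing it brings [f] closer to zero, so absolute values add up. *)
Let norm_flow (a b : bool) (f : int) : (a -> 0 < f) -> (b -> f < 0) ->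
  `|a%:Z - b%:Z| = a%:Z + b%:Z /\ `|f| = `|a%:Z - b%:Z| + `|f - (a%:Z - b%:Z)|.
Proof. by case: a; case: b => // ha hb; have := ha; have := hb; lia. Qed.

Let rflow_split e :
  `|rflow winding e| = \sum_(t < L) (((g t == e) && (g t.+1 == (e.1 + 1, e.2)))%:Z
     + ((g t.+1 == e) && (g t == (e.1 + 1, e.2)))%:Z) /\
  `|rflow w e| = `|rflow winding e| + `|rflow w e - rflow winding e|.
Proof.
rewrite rflow_winding /rstep sumrB big_split /= !sum_at_most_one; last 2 first.
- move=> s t /andP[_ /eqP gs] /andP[_ /eqP gt].
  by apply/val_inj/ginj; rewrite ?ltn_ord // gs gt.
- move=> s t /andP[/eqP gs _] /andP[/eqP gt _].
  by apply/val_inj/ginj; rewrite ?ltn_ord // gs gt.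
apply: norm_flow => /existsP[t /andP[/eqP g1 /eqP g2]].
  have := galong (ltn_ord t); rewrite g1 g2 /step_along; case: (e) => x y /=.
  by rewrite !xpair_eqE; lia.
have := galong (ltn_ord t); rewrite g1 g2 /step_along; case: (e) => x y /=.
by rewrite !xpair_eqE; lia.
Qed.

Let uflow_split e :
  `|uflow winding e| = \sum_(t < L) (((g t == e) && (g t.+1 == (e.1, e.2 + 1)))%:Z
     + ((g t.+1 == e) && (g t == (e.1, e.2 + 1)))%:Z) /\
  `|uflow w e| = `|uflow winding e| + `|uflow w e - uflow winding e|.
Proof.
rewrite uflow_winding /ustep sumrB big_split /= !sum_at_most_one; last 2 first.
- move=> s t /andP[_ /eqP gs] /andP[_ /eqP gt].
  by apply/val_inj/ginj; rewrite ?ltn_ord // gs gt.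
- move=> s t /andP[/eqP gs _] /andP[/eqP gt _].
  by apply/val_inj/ginj; rewrite ?ltn_ord // gs gt.
apply: norm_flow => /existsP[t /andP[/eqP g1 /eqP g2]].
  have := galong (ltn_ord t); rewrite g1 g2 /step_along; case: (e) => x y /=.
  by rewrite !xpair_eqE; lia.
have := galong (ltn_ord t); rewrite g1 g2 /step_along; case: (e) => x y /=.
by rewrite !xpair_eqE; lia.
Qed.

Lemma tv_winding_split : tv w = tv winding + tv (fun v => w v - winding v).
Proof.
apply: tv_add => p.
  have [_ ->] := rflow_split p; congr (_ + `|_|).
  by rewrite /rflow; lia.
have [_ ->] := uflow_split p; congr (_ + `|_|).
by rewrite /uflow; lia.
Qed.

(** No cancellation occurs between steps, so each step contributes at least 1 at the edge it
    traverses. *)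
Lemma length_le_tv_winding : L%:Z <= tv winding.
Proof.
pose F t e : int := ((g t == e) && (g t.+1 == (e.1 + 1, e.2)))%:Z
     + ((g t.+1 == e) && (g t == (e.1 + 1, e.2)))%:Z
     + (((g t == e) && (g t.+1 == (e.1, e.2 + 1)))%:Z
     + ((g t.+1 == e) && (g t == (e.1, e.2 + 1)))%:Z).
have -> : tv winding = \sum_(t < L) \sum_(x <- corners) \sum_(y <- corners) F t (x, y).
  rewrite exchange_big; apply: eq_bigr => x _ /=; rewrite exchange_big.
  apply: eq_bigr => y _ /=; rewrite big_split /=.
  by have [-> _] := rflow_split (x, y); have [-> _] := uflow_split (x, y).
have -> : L%:Z = \sum_(t < L) 1.
  by rewrite big_const_ord iter_addr_0 -[RHS]/(1 *+ L) -natz.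
apply: ler_sum => t _.
have F0 p : 0 <= F t p by rewrite /F; lia.
have := gstep (ltn_ord t) => /or4P[] /eqP gt.
- apply: le_trans (double_sum_ge F0 (gV t)); rewrite /F -gt !eqxx /=; lia.
- apply: le_trans (double_sum_ge F0 (gV t)); rewrite /F -gt !eqxx /=; lia.
- apply: le_trans (double_sum_ge F0 (gV t.+1)); rewrite /F -gt !eqxx /=; lia.
- apply: le_trans (double_sum_ge F0 (gV t.+1)); rewrite /F -gt !eqxx /=; lia.
Qed.

End winding.
End total_variation.

Definition clip (x : int) : int := Num.max (-1) (Num.min x 1).

Section tv_reduction.
Variables (R : realType) (N : nat) (h : Z2 -> R).
Implicit Types (w : Z2 -> int).

Definition pairing w : R :=
  \sum_(x <- cells N) \sum_(y <- cells N) (w (x, y))%:~R * h (x, y).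

Lemma pairingD w1 w2 : pairing (fun v => w1 v + w2 v) = pairing w1 + pairing w2.
Proof.
rewrite /pairing -big_split; apply: eq_bigr => x _; rewrite -big_split.
by apply: eq_bigr => y _; rewrite /= intrD mulrDl.
Qed.

Lemma eq_pairing w1 w2 : w1 =1 w2 -> pairing w1 = pairing w2.
Proof. by move=> e; apply: eq_bigr => x _; apply: eq_bigr => y _; rewrite e. Qed.

(* Integer weights reduce to windings of simple closed walks with values in
   {-1, 0, 1}: otherwise either the part of the weight exceeding 1 in absolute
   value, or a cycle of its boundary, can be split off without changing the
   total variation. *)
Lemma tv_reduction (M : R) (T0 : nat) : 0 <= M ->
  (forall (g : nat -> Z2) (L : nat), (L <= T0)%N ->
    (forall t, in_corners N (g t)) -> (forall t, (L <= t)%N -> g t = g 0%N) ->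
    (forall t, (t < L)%N -> unit_step (g t) (g t.+1)) ->
    (forall v, `|winding g L v| <= 1) ->
    pairing (winding g L) <= M * L%:R) ->
  forall w, supported N w -> tv N w <= T0%:Z -> pairing w <= M * (tv N w)%:~R.
Proof.
move=> M0 good w ws wT.
have [n wn] : exists n : nat, tv N w <= n%:Z.
  by exists `|tv N w|%N; have := tv_ge0 N w; lia.
elim: n w ws wT wn => [|n IHn] w ws wT wn.
  have w0 v : w v = 0.
    by apply/eqP; apply: contraT => /(tv_gt0 ws); lia.
  rewrite (eq_pairing w0) /pairing big1 ?mulr_ge0 ?ler0z ?tv_ge0 // => x _.
  by rewrite big1 // => y _; rewrite mul0r.
have split2 w1 w2 : supported N w1 -> supported N w2 -> (forall v, w v = w1 v + w2 v) ->
    tv N w = tv N w1 + tv N w2 -> 0 < tv N w1 -> 0 < tv N w2 ->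
    pairing w <= M * (tv N w)%:~R.
  move=> s1 s2 wE tvE t1 t2; rewrite (eq_pairing wE) pairingD tvE intrD mulrDr.
  by apply: lerD; apply: IHn => //; lia.
have [[v w2]|wle] := pselect (exists v, 1 < `|w v|).
  pose w1 v := clip (w v).
  have c1 v' : supported N w -> ~~ ((- N%:Z <= v'.1 <= N%:Z) && (- N%:Z <= v'.2 <= N%:Z)) -> clip (w v') = 0.
    by move=> _ v'N; rewrite ws.
  have s1 : supported N w1 by move=> v'; exact: c1.
  have s2 : supported N (fun v => w v - w1 v).
    by move=> v' v'N; rewrite s1 // ws.
  (* Both [clip] and its complement to the identity are nondecreasing, so the two differences have
     the same sign. *)
  have flow_split a b : `|a - b| = `|clip a - clip b| + `|(a - clip a) - (b - clip b)|.
    by rewrite /clip; lia.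
  apply: (split2 w1 (fun v => w v - w1 v)) => //.
  - by move=> v'; lia.
  - by apply: tv_add => p; exact: flow_split.
  - by apply: (tv_gt0 (v := v)) => //; rewrite /w1 /clip; lia.
  - by apply: (tv_gt0 (v := v)) => //; rewrite /w1 /clip; lia.
have {}wle v : `|w v| <= 1.
  by rewrite leNgt; apply/negP => h1; apply: wle; exists v.
have [[v wv]|w0] := pselect (exists v, w v != 0); last first.
  rewrite (@eq_pairing _ (fun=> 0)); last first.
    by move=> v; apply/eqP; apply: contraT => wv; exfalso; apply: w0; exists v.
  rewrite /pairing big1 ?mulr_ge0 ?ler0z ?tv_ge0 // => x _.
  by rewrite big1 // => y _; rewrite mul0r.
have [g [L L0 [gV gL galong ginj]]] := ex_cycle ws wv.
have gstep t : (t < L)%N -> unit_step (g t) (g t.+1).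
  by move=> tL; apply: step_along_unit (galong t tL).
have tvE := tv_winding_split N gL gstep ginj galong.
have Lle := length_le_tv_winding gV gL gstep ginj galong.
have s1 := winding_supported gV gL gstep.
have s2 : supported N (fun v => w v - winding g L v).
  by move=> v' v'N; rewrite s1 // ws.
have t2 := tv_ge0 N (fun v => w v - winding g L v).
(* If nothing remains, [w] is itself a winding, and its values are in {-1, 0, 1} by [wle]. *)
have [t20|t20] := ltP 0 (tv N (fun v => w v - winding g L v)).
  apply: (split2 (winding g L) (fun v => w v - winding g L v)) => //.
    by move=> v'; lia.
  lia.
have wE v' : w v' = winding g L v'.
  apply/eqP; rewrite -subr_eq0; apply: contraT => wv'.
  have := tv_gt0 (v := v') s2 wv'; lia.
rewrite (eq_pairing wE); apply: (@le_trans _ _ (M * L%:R)).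
  apply: good => //; first by lia.
  by move=> v'; rewrite -wE.
rewrite ler_wpM2l //; have -> : L%:R = L%:Z%:~R :> R by [].
by rewrite ler_int; lia.
Qed.

(** An edge between corners is dual to the edge between the two cells it separates; duality is
    injective, and it maps the edges counted by [tv] into the boundary of [A]. *)
Lemma tv_indicator (A : {fset Z2}) :
  tv N (fun v => (v \in A)%:Z) <= #|` edge_boundary A|%:Z.
Proof.
pose V : seq (Z2 * bool) := [seq (p, b) | p <- [seq (x, y) | x <- corners N, y <- corners N], b <- [:: true; false]].
pose crosses (pb : Z2 * bool) : bool :=
  let: (p, b) := pb in
  if b then ((p.1, p.2 - 1) \in A) != (p \in A) else (p \in A) != ((p.1 - 1, p.2) \in A).
pose edge (pb : Z2 * bool) : {fset Z2} :=
  let: (p, b) := pb in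
  if b then [fset (p.1, p.2 - 1)%R; p]%fset else [fset (p.1 - 1, p.2)%R; p]%fset.
have -> : tv N (fun v => (v \in A)%:Z) = (size [seq pb <- V | crosses pb])%:Z.
  rewrite size_filter -sum1_count big_mkcond (big_morph Posz PoszD (erefl _)).
  rewrite /V big_allpairs big_allpairs /tv.
  apply: eq_bigr => x _; apply: eq_bigr => y _.
  rewrite !big_cons big_nil /= addr0 /rflow /uflow /=.
  by case: (_ \in A); case: (_ \in A); case: (_ \in A).
rewrite lez_nat.
have cu : uniq (corners N) by exact: irange_uniq.
have Vu : uniq V.
  apply: allpairs_uniq => //; last by move=> [? ?] [? ?] _ _ [-> ->].
  by apply: allpairs_uniq => // -[? ?] [? ?] _ _ [-> ->].
have einj : {in [seq pb <- V | crosses pb] &, injective edge}.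
  have eP (p q p' q' : Z2) : [fset p; q]%fset = [fset p'; q']%fset ->
      (p = p' /\ q = q') \/ (p = q' /\ q = p').
    move=> e; have m (u a b : Z2) : u \in [fset a; b]%fset -> u = a \/ u = b.
      by rewrite !inE => /orP[] /eqP; [left|right].
    have hp : p = p' \/ p = q' by apply: m; rewrite -e !inE eqxx.
    have hq : q = p' \/ q = q' by apply: m; rewrite -e !inE eqxx orbT.
    have hp' : p' = p \/ p' = q by apply: m; rewrite e !inE eqxx.
    have hq' : q' = p \/ q' = q by apply: m; rewrite e !inE eqxx orbT.
    by case: hp => ?; case: hq => ?; case: hp' => ?; case: hq' => ?;
      solve [left; split; congruence|right; split; congruence].
  move=> [[x y] b] [[x' y'] b'] _ _; rewrite /edge /=.
  by case: b; case: b' => /eP[][] [e1 e2] [e3 e4]; rewrite ?e1 ?e2 ?e3 ?e4 //; lia.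
rewrite -(size_map edge); apply: uniq_leq_size.
  by rewrite map_inj_in_uniq // filter_uniq.
move=> _ /mapP[[[x y] b] + ->]; rewrite mem_filter => /andP[+ _].
have bnd p q : p \in A -> q \notin A -> q \in neighbors p ->
    [fset p; q]%fset \in edge_boundary A.
  move=> pA qA pq; apply/imfset2P; exists p => //; exists q => //.
  by rewrite inE /= qA andbT.
rewrite /crosses /edge /=; case: b.
  case p1: ((x, y) \in A); case p2: ((x, y - 1) \in A) => // _.
    by rewrite fsetUC; apply: bnd; rewrite ?p1 ?p2 // !inE /= eqxx ?orbT.
  by apply: bnd; rewrite ?p1 ?p2 // !inE /= subrK eqxx ?orbT.
case p1: ((x, y) \in A); case p2: ((x - 1, y) \in A) => // _.
  by rewrite fsetUC; apply: bnd; rewrite ?p1 ?p2 // !inE /= eqxx ?orbT.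
by apply: bnd; rewrite ?p1 ?p2 // !inE /= subrK eqxx ?orbT.
Qed.

End tv_reduction.

(** * Multiscale approximation of a closed walk *)

Definition polygon_weight (P : nat -> Z2) (n : nat) (v : Z2) : int :=
  \sum_(i < n) seg (P i) (P i.+1) v.

(** Over each coarse side lie the triangle of the new corner and the quadrilateral between the old
    and the new chord, cut into two triangles. The segments joining [P m] to [P' (2 * m)] cancel
    once both polygons close. *)
Lemma polygon_weight_refine (P P' : nat -> Z2) n v :
  P n = P 0%N -> P' (2 * n)%N = P' 0%N ->
  polygon_weight P' (2 * n) v - polygon_weight P n v =
  \sum_(i < n) (tri (P' (2 * i)%N) (P' (2 * i).+1) (P' (2 * i.+1)%N) v
    + (tri (P i) (P' (2 * i)%N) (P' (2 * i.+1)%N) v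
       + tri (P i) (P' (2 * i.+1)%N) (P i.+1) v)).
Proof.
move=> Pn P'n.
have key m : polygon_weight P' (2 * m) v - polygon_weight P m v =
    \sum_(i < m) (tri (P' (2 * i)%N) (P' (2 * i).+1) (P' (2 * i.+1)%N) v
    + (tri (P i) (P' (2 * i)%N) (P' (2 * i.+1)%N) v
       + tri (P i) (P' (2 * i.+1)%N) (P i.+1) v))
    + (seg (P m) (P' (2 * m)%N) v - seg (P 0%N) (P' 0%N) v).
  elim: m => [|m IHm].
    by rewrite /polygon_weight muln0 !big_ord0; lia.
  have e2 : (2 * m.+1 = (2 * m).+2)%N by lia.
  move: IHm; rewrite /polygon_weight e2 !big_ord_recr /= e2 /tri.
  rewrite (segN (P' (2 * m)%N) (P' (2 * m).+2)) (segN (P m) (P' (2 * m).+2)).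
  rewrite (segN (P m) (P m.+1)) (segN (P m.+1) (P' (2 * m).+2)); lra.
by rewrite key Pn P'n subrr addr0.
Qed.

Section snapped_polygons.
Variables (c : nat) (g : nat -> Z2).
Hypothesis glip : forall t,
  `|(g t.+1).1 - (g t).1| + `|(g t.+1).2 - (g t).2| <= 1.

Lemma walk_lip s t : (s <= t)%N ->
  `|(g t).1 - (g s).1| + `|(g t).2 - (g s).2| <= (t - s)%N%:Z.
Proof.
move=> /subnK <-; rewrite addnK; elim: (t - s)%N => [|m IHm].
  by rewrite add0n !subrr.
by have := glip (m + s)%N; rewrite addSn; lia.
Qed.

(** The mesh [2^k / 4^c]; truncated subtraction makes it 1 for [k <= 2 * c], where snapping is
    exact. *)
Definition scale k : nat := (2 ^ (k - 2 * c))%N.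

Lemma scale_gt0 k : (0 < scale k)%N.
Proof. by rewrite expn_gt0. Qed.

Lemma scale_le k : (scale k <= 2 ^ k)%N.
Proof. by rewrite leq_exp2l // leq_subr. Qed.

Lemma scaleS k : (scale k <= scale k.+1 <= 2 * scale k)%N.
Proof.
by rewrite -expnS !leq_exp2l //; lia.
Qed.

Lemma scaleS_dvd k : exists m : nat, scale k.+1 = (m * scale k)%N.
Proof.
have [k2|k2] := leqP (2 * c) k.
  by exists 2%N; rewrite /scale subSn // expnS.
by exists 1%N; rewrite /scale mul1n; congr expn; lia.
Qed.

Definition snap1 (r : nat) (x : int) : int := r%:Z * (x %/ r%:Z)%Z.

Definition snap r (p : Z2) : Z2 := (snap1 r p.1, snap1 r p.2).

Lemma snap1_le r x : (0 < r)%N -> snap1 r x <= x <= snap1 r x + (r%:Z - 1).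
Proof.
move=> r0; have r0' : 0 < r%:Z by lia.
have := divz_eq x r%:Z; have := modz_ge0 x (lt0r_neq0 r0').
by have := ltz_pmod x r0'; rewrite /snap1; lia.
Qed.

Definition vertex k i : Z2 := snap (scale k) (g (i * 2 ^ k)).

(* Twice the deviation of the midpoint of the [i]-th piece of length [2 ^ k.+1]
   from the midpoint of its chord. *)
Definition bend k i : Z2 :=
  (2 * (g ((2 * i).+1 * 2 ^ k)).1 - (g (i * 2 ^ k.+1)).1 - (g (i.+1 * 2 ^ k.+1)).1,
   2 * (g ((2 * i).+1 * 2 ^ k)).2 - (g (i * 2 ^ k.+1)).2 - (g (i.+1 * 2 ^ k.+1)).2).

Definition norm1 (p : Z2) : int := `|p.1| + `|p.2|.

Let cross_le (p q r : Z2) (s : int) : `|r.1 - p.1| <= s -> `|r.2 - p.2| <= s ->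
  `|cross p q r| <= (`|q.1 - p.1| + `|q.2 - p.2|) * s.
Proof.
move=> h1 h2; rewrite /cross [X in _ <= X]mulrDl; apply: le_trans (ler_normB _ _) _.
by apply: lerD; rewrite normrM ler_wpM2l.
Qed.

Variables xs ys : seq int.
Hypotheses (xs_uniq : uniq xs) (ys_uniq : uniq ys).

Let w k : int := (2 ^ k)%N%:Z.

(** Rounding enters through [scale - 1], which vanishes on the unit grid, so scales below [2 * c]
    pay only for bends. The first triangle has area governed by the bend; each of the other two,
    thin because only snapping separates the chords, costs 12. *)
Lemma l1_refine k n : g (n * 2 ^ k.+1)%N = g 0%N ->
  l1 xs ys (fun v => polygon_weight (vertex k) (2 * n) v
                     - polygon_weight (vertex k.+1) n v) <=
  \sum_(i < n) (5 * (w k * (norm1 (bend k i) + 4 * ((scale k)%:Z - 1)))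
                + 24 * (w k * ((scale k.+1)%:Z - 1))).
Proof.
move=> gn.
have v0 : vertex k.+1 n = vertex k.+1 0 by rewrite /vertex gn mul0n.
have v0' : vertex k (2 * n) = vertex k 0.
  by rewrite /vertex mul0n -gn expnS; congr (snap _ (g _)); lia.
rewrite (eq_l1 _ _ (fun v => polygon_weight_refine v v0 v0')).
apply: le_trans (l1_sum _ _ _ _) _; apply: ler_sum => i _.
have sk := scale_gt0 k; have sk1 := scale_gt0 k.+1.
have skw : (scale k)%:Z <= w k by have := scale_le k; rewrite /w; lia.
have ss : (scale k)%:Z <= (scale k.+1)%:Z <= 2 * (scale k)%:Z.
  by have := scaleS k; lia.
have sk' : 0 < (scale k)%:Z by lia.
have iE : ((2 * i)%N * 2 ^ k = i * 2 ^ k.+1)%N by rewrite expnS; lia.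
have iE' : ((2 * i.+1)%N * 2 ^ k = i.+1 * 2 ^ k.+1)%N by rewrite expnS; lia.
have l1' := @walk_lip (i * 2 ^ k.+1) ((2 * i).+1 * 2 ^ k)%N ltac:(rewrite expnS; lia).
have l2' := @walk_lip ((2 * i).+1 * 2 ^ k)%N (i.+1 * 2 ^ k.+1) ltac:(rewrite expnS; lia).
have d1 : ((2 * i).+1 * 2 ^ k - i * 2 ^ k.+1)%N%:Z = w k by rewrite /w expnS; lia.
have d2 : (i.+1 * 2 ^ k.+1 - (2 * i).+1 * 2 ^ k)%N%:Z = w k by rewrite /w expnS; lia.
rewrite d1 in l1'; rewrite d2 in l2'.
rewrite /vertex iE iE' /bend /norm1 /= /snap /=.
set a := g (i * 2 ^ k.+1)%N in l1' *; set m := g ((2 * i).+1 * 2 ^ k)%N in l1' l2' *.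
set b := g (i.+1 * 2 ^ k.+1)%N in l2' *.
have [[a1 a2] [m1 m2] [b1 b2]] : [/\
  snap1 (scale k) a.1 <= a.1 <= snap1 (scale k) a.1 + ((scale k)%:Z - 1) /\
  snap1 (scale k) a.2 <= a.2 <= snap1 (scale k) a.2 + ((scale k)%:Z - 1),
  snap1 (scale k) m.1 <= m.1 <= snap1 (scale k) m.1 + ((scale k)%:Z - 1) /\
  snap1 (scale k) m.2 <= m.2 <= snap1 (scale k) m.2 + ((scale k)%:Z - 1) &
  snap1 (scale k) b.1 <= b.1 <= snap1 (scale k) b.1 + ((scale k)%:Z - 1) /\
  snap1 (scale k) b.2 <= b.2 <= snap1 (scale k) b.2 + ((scale k)%:Z - 1)].
  by split; split; exact: snap1_le.
have [[A1 A2] [B1 B2]] : 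
  (snap1 (scale k.+1) a.1 <= a.1 <= snap1 (scale k.+1) a.1 + ((scale k.+1)%:Z - 1) /\
  snap1 (scale k.+1) a.2 <= a.2 <= snap1 (scale k.+1) a.2 + ((scale k.+1)%:Z - 1)) /\
  (snap1 (scale k.+1) b.1 <= b.1 <= snap1 (scale k.+1) b.1 + ((scale k.+1)%:Z - 1) /\
  snap1 (scale k.+1) b.2 <= b.2 <= snap1 (scale k.+1) b.2 + ((scale k.+1)%:Z - 1)).
  by split; split; exact: snap1_le.
move: (snap1 (scale k) a.1) (snap1 (scale k) a.2) (snap1 (scale k) m.1)
  (snap1 (scale k) m.2) (snap1 (scale k) b.1) (snap1 (scale k) b.2)
  (snap1 (scale k.+1) a.1) (snap1 (scale k.+1) a.2) (snap1 (scale k.+1) b.1)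
  (snap1 (scale k.+1) b.2) a1 a2 m1 m2 b1 b2 A1 A2 B1 B2.
move=> xa ya xm ym xb yb xA yA xB yB a1 a2 m1 m2 b1 b2 A1 A2 B1 B2.
have {iE iE' d1 d2 gn v0 v0'} w0 : 0 < w k by lia.
have t1 : l1 xs ys (tri (xa, ya) (xm, ym) (xb, yb)) <=
    5 * (w k * (`|2 * m.1 - a.1 - b.1| + `|2 * m.2 - a.2 - b.2| + 4 * ((scale k)%:Z - 1))).
  apply: le_trans (l1_tri xs_uniq ys_uniq (l := 3 * w k) _ _ _) _ => /=; try lia.
  rewrite /tri_bound; case: eqP => [_|/eqP X0].
    by rewrite mulr_ge0 // mulr_ge0 ?(ltW w0) //; lia.
  have cE : 2 * cross (xa, ya) (xm, ym) (xb, yb) =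
      (2 * xm - xa - xb) * (yb - ya) - (2 * ym - ya - yb) * (xb - xa).
    by rewrite /cross /=; lia.
  set u1 := 2 * xm - xa - xb in cE; set u2 := 2 * ym - ya - yb in cE.
  have c2 : 2 * `|cross (xa, ya) (xm, ym) (xb, yb)| <= (`|u1| + `|u2|) * (3 * w k).
    have -> : 2 * `|cross (xa, ya) (xm, ym) (xb, yb)| =
        `|u1 * (yb - ya) - u2 * (xb - xa)| by rewrite -cE normrM.
    rewrite [X in _ <= X]mulrDl; apply: le_trans (ler_normB _ _) _.
    by apply: lerD; rewrite normrM ler_wpM2l //; lia.
  (* A nondegenerate triangle deviates from its chord by at least one unit, and this absorbs the
     width term of [tri_bound]. *)
  have u0 : 1 <= `|u1| + `|u2|.
    have : (u1 != 0) || (u2 != 0).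
      apply: contraT; rewrite negb_or !negbK => /andP[/eqP e1 /eqP e2].
      by move: cE X0; rewrite e1 e2; lia.
    lia.
  have u3 : `|u1| + `|u2| <= `|2 * m.1 - a.1 - b.1| + `|2 * m.2 - a.2 - b.2|
      + 4 * ((scale k)%:Z - 1) by rewrite /u1 /u2; lia.
  move: c2 u0 u3; set U := `|u1| + `|u2|; set V := _ + 4 * _ => c2 u0 u3.
  have : w k * U <= w k * V by rewrite ler_pM2l.
  have : w k * 1 <= w k * U by rewrite ler_pM2l.
  lia.
have t2 : l1 xs ys (tri (xA, yA) (xa, ya) (xb, yb)) <= 12 * (w k * ((scale k.+1)%:Z - 1)).
  apply: le_trans (l1_tri xs_uniq ys_uniq (l := 4 * w k) _ _ _) _ => /=; try lia.
  rewrite /tri_bound; case: eqP => [_|/eqP X0].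
    by rewrite mulr_ge0 // mulr_ge0 ?(ltW w0) //; lia.
  have c2 := @cross_le (xA, yA) (xa, ya) (xb, yb) (4 * w k) ltac:(rewrite /=; lia) ltac:(rewrite /=; lia).
  rewrite /= in c2; set U := `|xa - xA| + `|ya - yA| in c2.
  have u0 : 1 <= U.
    apply: contraT => U0; have U00 : U = 0 by rewrite /U in U0 *; lia.
    by move: X0 c2; rewrite U00 mul0r; lia.
  have u3 : U <= 2 * ((scale k.+1)%:Z - 1) by rewrite /U; lia.
  have : U * w k <= 2 * ((scale k.+1)%:Z - 1) * w k by rewrite ler_pM2r.
  have s1 : 1 <= (scale k.+1)%:Z - 1 by lia.
  have : 1 * w k <= ((scale k.+1)%:Z - 1) * w k by rewrite ler_pM2r.
  lia.
have t3 : l1 xs ys (tri (xA, yA) (xb, yb) (xB, yB)) <= 12 * (w k * ((scale k.+1)%:Z - 1)).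
  apply: le_trans (l1_tri xs_uniq ys_uniq (l := 4 * w k) _ _ _) _ => /=; try lia.
  have -> : cross (xA, yA) (xb, yb) (xB, yB) = - cross (xB, yB) (xb, yb) (xA, yA).
    by rewrite /cross /=; lra.
  rewrite /tri_bound oppr_eq0 normrN; case: eqP => [_|/eqP X0].
    by rewrite mulr_ge0 // mulr_ge0 ?(ltW w0) //; lia.
  have c2 := @cross_le (xB, yB) (xb, yb) (xA, yA) (4 * w k) ltac:(rewrite /=; lia) ltac:(rewrite /=; lia).
  rewrite /= in c2; set U := `|xb - xB| + `|yb - yB| in c2.
  have u0 : 1 <= U.
    apply: contraT => U0; have U00 : U = 0 by rewrite /U in U0 *; lia.
    by move: X0 c2; rewrite U00 mul0r; lia.
  have u3 : U <= 2 * ((scale k.+1)%:Z - 1) by rewrite /U; lia.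
  have : U * w k <= 2 * ((scale k.+1)%:Z - 1) * w k by rewrite ler_pM2r.
  have s1 : 1 <= (scale k.+1)%:Z - 1 by lia.
  have : 1 * w k <= ((scale k.+1)%:Z - 1) * w k by rewrite ler_pM2r.
  lia.
apply: le_trans (l1D _ _ _ _) _; apply: le_trans (lerD t1 (l1D _ _ _ _)) _.
lia.
Qed.

End snapped_polygons.

(** * Codes for successive refinements and their costs *)

Section polygon_codes.
Implicit Types (P : nat -> Z2).

Definition letter := (Z2 * Z2)%type.

(** The offset 8 is 2 per coordinate: it makes the sum of [e^-cost] over all letters at most 1, as
    in Kraft's inequality. *)
Definition letter_cost (d : letter) : nat :=
  8 + (`|d.1.1| + `|d.1.2| + `|d.2.1| + `|d.2.2|)%N.

Definition word_cost (s : seq letter) : nat := \sum_(d <- s) letter_cost d.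

Fixpoint words (S : seq letter) n : seq (seq letter) :=
  if n is m.+1 then [seq d :: s | d <- S, s <- words S m] else [:: [::]].

Lemma mem_words S n s : size s = n -> {subset s <= S} -> s \in words S n.
Proof.
elim: n s => [|n IHn] [|d s] //= [sn] sS; apply: (allpairs_f cons).
  by apply: sS; rewrite mem_head.
by apply: IHn => // x xs; apply: sS; rewrite inE xs orbT.
Qed.

(* Each corner of the refined polygon is coded by its displacement, in units of
   [r], from the coarse corner or from the midpoint of a coarse side. *)
Definition refine (r : nat) P (s : seq letter) (i : nat) : Z2 :=
  let d := nth ((0, 0), (0, 0)) s i./2 in
  if odd i then
    (((P i./2).1 + (P i./2.+1).1 + r%:Z * d.2.1) %/ 2,
     ((P i./2).2 + (P i./2.+1).2 + r%:Z * d.2.2) %/ 2)%Z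
  else ((P i./2).1 + r%:Z * d.1.1, (P i./2).2 + r%:Z * d.1.2).

(* Triples (cost, polygon, parent polygon) after [m] refinements; the polygon has
   [2 ^ m] sides and only its first [2 ^ m + 1] values matter. *)
Fixpoint codes (c : nat) S (roots : seq Z2) K m : seq (nat * (nat -> Z2) * (nat -> Z2)) :=
  if m is l.+1 then
    [seq ((e.1.1 + word_cost s)%N, refine (scale c (K - m)) e.1.2 s, e.1.2)
      | e <- codes c S roots K l, s <- words S (2 ^ l).+1]
  else [seq (0%N, fun=> p, fun=> p) | p <- roots].

Definition code_weight (e : nat * (nat -> Z2) * (nat -> Z2)) n (v : Z2) : int :=
  clip (polygon_weight e.1.2 (2 * n) v) - clip (polygon_weight e.2 n v).

Section code_of_walk.
Variables (c : nat) (g : nat -> Z2).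
Hypothesis glip : forall t,
  `|(g t.+1).1 - (g t).1| + `|(g t.+1).2 - (g t).2| <= 1.
Local Notation vertex := (vertex c g).
Local Notation scale := (scale c).

Definition walk_letter k i : letter :=
  ((((vertex k (2 * i)).1 - (vertex k.+1 i).1) %/ (scale k)%:Z,
    ((vertex k (2 * i)).2 - (vertex k.+1 i).2) %/ (scale k)%:Z)%Z,
   ((2 * (vertex k (2 * i).+1).1 - (vertex k.+1 i).1 - (vertex k.+1 i.+1).1)
      %/ (scale k)%:Z,
    (2 * (vertex k (2 * i).+1).2 - (vertex k.+1 i).2 - (vertex k.+1 i.+1).2)
      %/ (scale k)%:Z)%Z).

Definition walk_word k n : seq letter := [seq walk_letter k i | i <- iota 0 n.+1].

Let snap1_dvd r x : (r%:Z %| snap1 r x)%Z.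
Proof. by rewrite /snap1 dvdz_mulr. Qed.

Let snap1S_dvd k x : ((scale k)%:Z %| snap1 (scale k.+1) x)%Z.
Proof.
have [m ->] := scaleS_dvd c k.
by rewrite /snap1 PoszM -mulrA dvdz_mull // dvdz_mulr.
Qed.

Let divK (r x : int) : (r %| x)%Z -> r * (x %/ r)%Z = x.
Proof. by move=> rx; rewrite mulrC divzK. Qed.

(** The grids are nested, so all displacements are multiples of [scale k], and decoding is exact. *)
Lemma refine_walk_word k n P : (forall i, (i <= n)%N -> P i = vertex k.+1 i) ->
  forall i, (i <= 2 * n)%N -> refine (scale k) P (walk_word k n) i = vertex k i.
Proof.
move=> Pv i ni; rewrite /refine /walk_word.
have i2 : (i./2 <= n)%N by lia.
rewrite (nth_map 0%N) ?size_iota // nth_iota // add0n /walk_letter.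
set j := i./2 in i2 *; have iE : i = (odd i + 2 * j)%N by rewrite /j; lia.
have v1 l : ((scale k)%:Z %| (vertex k l).1)%Z by exact: snap1_dvd.
have v2 l : ((scale k)%:Z %| (vertex k l).2)%Z by exact: snap1_dvd.
have u1 l : ((scale k)%:Z %| (vertex k.+1 l).1)%Z by exact: snap1S_dvd.
have u2 l : ((scale k)%:Z %| (vertex k.+1 l).2)%Z by exact: snap1S_dvd.
have v1' l : ((scale k)%:Z %| 2 * (vertex k l).1)%Z by rewrite dvdz_mull.
have v2' l : ((scale k)%:Z %| 2 * (vertex k l).2)%Z by rewrite dvdz_mull.
have half (a b x : int) : ((a + b + (2 * x - a - b)) %/ 2)%Z = x.
  by rewrite (_ : a + b + _ = x * 2) ?mulzK //; lra.
have [oi|oi] := boolP (odd i); rewrite ?oi ?(negbTE oi) in iE.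
  rewrite iE add1n !Pv; [|lia|lia].
  rewrite !divK ?(rpredB, v1, v2, v1', v2', u1, u2) //.
  rewrite [LHS]/= !half.
  by [].
rewrite iE add0n Pv //.
rewrite !divK ?(rpredB, v1, v2, u1, u2) //= !subrKC.
  by [].
Qed.

(** Snapping one point to two grids of ratio at most 2 moves it by at most one unit per coordinate.
    A new corner is displaced by its bend up to 4 units of rounding per coordinate, so the constant
    is [8 + 2 + 8 = 18]. *)
Lemma walk_letter_cost k i :
  ((scale k * letter_cost (walk_letter k i))%N%:Z <=
   18 * (scale k)%:Z + norm1 (bend g k i)) /\
  [/\ `|(walk_letter k i).1.1| <= 1, `|(walk_letter k i).1.2| <= 1,
      `|(walk_letter k i).2.1| <= (2 ^ k.+2)%N%:Z + 4 &
      `|(walk_letter k i).2.2| <= (2 ^ k.+2)%N%:Z + 4].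
Proof.
have sk := scale_gt0 c k; have sk1 := scale_gt0 c k.+1.
have sk' : 0 < (scale k)%:Z by lia.
have ss : (scale k)%:Z <= (scale k.+1)%:Z <= 2 * (scale k)%:Z.
  by have := scaleS c k; lia.
have iE : ((2 * i)%N * 2 ^ k = i * 2 ^ k.+1)%N by rewrite expnS; lia.
have l1' := @walk_lip g glip (i * 2 ^ k.+1) ((2 * i).+1 * 2 ^ k)%N ltac:(rewrite expnS; lia).
have l2' := @walk_lip g glip ((2 * i).+1 * 2 ^ k)%N (i.+1 * 2 ^ k.+1) ltac:(rewrite expnS; lia).
have d1 : ((2 * i).+1 * 2 ^ k - i * 2 ^ k.+1)%N%:Z = (2 ^ k)%N%:Z by rewrite expnS; lia.
have d2 : (i.+1 * 2 ^ k.+1 - (2 * i).+1 * 2 ^ k)%N%:Z = (2 ^ k)%N%:Z by rewrite expnS; lia.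
rewrite d1 in l1'; rewrite d2 in l2'.
rewrite /walk_letter /letter_cost /bend /norm1 /= iE.
set a := g (i * 2 ^ k.+1)%N in l1' *; set m := g ((2 * i).+1 * 2 ^ k)%N in l1' l2' *.
set b := g (i.+1 * 2 ^ k.+1)%N in l2' *.
have eps (x : int) : (scale k)%:Z *
    ((snap1 (scale k) x - snap1 (scale k.+1) x) %/ (scale k)%:Z)%Z =
    snap1 (scale k) x - snap1 (scale k.+1) x.
  by apply: divK; rewrite rpredB ?snap1_dvd ?snap1S_dvd.
have mid (x y z : int) : (scale k)%:Z *
    ((2 * snap1 (scale k) y - snap1 (scale k.+1) x - snap1 (scale k.+1) z)
      %/ (scale k)%:Z)%Z =
    2 * snap1 (scale k) y - snap1 (scale k.+1) x - snap1 (scale k.+1) z.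
  by apply: divK; rewrite !rpredB ?snap1S_dvd //; apply: dvdz_mull; exact: snap1_dvd.
have epsb (x : int) : `|((snap1 (scale k) x - snap1 (scale k.+1) x) %/ (scale k)%:Z)%Z| <= 1.
  have := eps x; set q := (_ %/ _)%Z => qE.
  have := @snap1_le (scale k) x sk; have := @snap1_le (scale k.+1) x sk1 => h1 h2.
  by rewrite -ltzD1 ltr_norml -(ltr_pM2l sk') -[X in _ && X](ltr_pM2l sk') qE; lia.
have midb (x y z : int) : (scale k)%:Z * `|((2 * snap1 (scale k) y - snap1 (scale k.+1) x
      - snap1 (scale k.+1) z) %/ (scale k)%:Z)%Z| <= `|2 * y - x - z| + 4 * (scale k)%:Z.
  have -> : (scale k)%:Z * `|((2 * snap1 (scale k) y - snap1 (scale k.+1) x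
      - snap1 (scale k.+1) z) %/ (scale k)%:Z)%Z| =
      `|2 * snap1 (scale k) y - snap1 (scale k.+1) x - snap1 (scale k.+1) z|.
    by rewrite -[in RHS]mid normrM ger0_norm.
  have := @snap1_le (scale k) y sk; have := @snap1_le (scale k.+1) x sk1.
  by have := @snap1_le (scale k.+1) z sk1; lia.
have e1 := epsb a.1; have e2 := epsb a.2.
have m1 := midb a.1 m.1 b.1; have m2 := midb a.2 m.2 b.2.
set q1 := ((_ - _) %/ _)%Z in e1 *; set q2 := ((_ - snap1 _ a.2) %/ _)%Z in e2 *.
move: m1 m2; set x1 := (_ %/ _)%Z; set x2 := (_ %/ _)%Z => m1 m2.
have b4 : (2 ^ k.+2)%N%:Z = 4 * (2 ^ k)%N%:Z by rewrite !expnS; lia.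
have xle (x B : int) : (scale k)%:Z * `|x| <= B + 4 * (scale k)%:Z -> B <= 4 * (2 ^ k)%N%:Z ->
    `|x| <= 4 * (2 ^ k)%N%:Z + 4.
  clear -sk'; move: (scale k)%:Z sk' `|x| (2 ^ k)%N => s s0 z n sx BW.
  have [x4|x4] := lerP z 4; first by lia.
  have : z - 4 <= s * (z - 4) by rewrite ler_peMl; lia.
  by rewrite mulrBr; lia.
rewrite b4; split; last first.
  split; [exact: e1|exact: e2|apply: (xle _ _ m1)|apply: (xle _ _ m2)]; clear -l1' l2'; lia.
have q1s : (scale k)%:Z * `|q1| <= (scale k)%:Z by rewrite ler_piMr //; exact: ltW.
have q2s : (scale k)%:Z * `|q2| <= (scale k)%:Z by rewrite ler_piMr //; exact: ltW.
clearbody q1 q2 x1 x2 a b m; clear -m1 m2 q1s q2s.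
rewrite PoszM !PoszD !abszE !mulrDr; move: (scale k)%:Z m1 m2 q1s q2s => s.
move: (s * `|q1|) (s * `|q2|) (s * `|x1|) (s * `|x2|) => y1 y2 y3 y4; lia.
Qed.

End code_of_walk.
End polygon_codes.

Definition sqnorm (p : Z2) : int := p.1 ^+ 2 + p.2 ^+ 2.

Section chord_energy.
Variable g : nat -> Z2.
Hypothesis glip : forall t,
  `|(g t.+1).1 - (g t).1| + `|(g t.+1).2 - (g t).2| <= 1.

Definition chord_energy k n : int := \sum_(i < n)
  sqnorm ((g (i.+1 * 2 ^ k)%N).1 - (g (i * 2 ^ k)%N).1,
          (g (i.+1 * 2 ^ k)%N).2 - (g (i * 2 ^ k)%N).2).

Lemma chord_energy_ge0 k n : 0 <= chord_energy k n.
Proof. by apply: sumr_ge0 => i _; rewrite addr_ge0 ?sqr_ge0. Qed.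

(** The parallelogram identity. Divided by [2^(k+1)], it telescopes over [k]: the energy of all
    bends, each scale weighted by the inverse of its length, is at most the energy of the unit
    steps. *)
Lemma chord_energy_bend k n :
  2 * chord_energy k (2 * n) = chord_energy k.+1 n + \sum_(i < n) sqnorm (bend g k i).
Proof.
elim: n => [|n IHn]; first by rewrite /chord_energy muln0 !big_ord0.
have e2 : (2 * n.+1 = (2 * n).+2)%N by lia.
move: IHn; rewrite /chord_energy e2 !big_ord_recr /= mulrDr mulrDr => ->.
have e3 : ((2 * n)%N * 2 ^ k = n * 2 ^ k.+1)%N by rewrite expnS; lia.
have e4 : ((2 * n).+2 * 2 ^ k = n.+1 * 2 ^ k.+1)%N by rewrite expnS; lia.
rewrite /sqnorm /bend /= e3 e4; lra.
Qed.

Lemma chord_energy0_le n : chord_energy 0 n <= n%:Z.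
Proof.
elim: n => [|n IHn]; first by rewrite /chord_energy big_ord0.
rewrite /chord_energy big_ord_recr /= -/(chord_energy 0 n) intS addrC lerD //.
rewrite !muln1 /sqnorm /=; have := glip n.
move: (_ - _) (_ - _) => x y xy.
have hx : x ^+ 2 <= `|x| by rewrite -real_normK ?num_real // expr2 ler_piMl //; lia.
have hy : y ^+ 2 <= `|y| by rewrite -real_normK ?num_real // expr2 ler_piMl //; lia.
lia.
Qed.

End chord_energy.

Section chain_step.
Variable R : realFieldType.

Lemma amgm_scaled (a w x : R) : 0 < a -> 0 < w ->
  a * x <= a ^+ 3 * x ^+ 2 / (w * 2) + w / (a * 2).
Proof.
move=> a0 w0.
have -> : a ^+ 3 * x ^+ 2 / (w * 2) + w / (a * 2) =
    a * x + (a ^+ 2 * x - w) ^+ 2 / (w * a * 2).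
  have [an wn] : a != 0 /\ w != 0 by split; lra.
  apply: (@mulIf _ (w * a * 2)); first by rewrite !mulf_neq0.
  rewrite [RHS]mulrDl divfK ?mulf_neq0 // mulrDl.
  have -> : a ^+ 3 * x ^+ 2 / (w * 2) * (w * a * 2) = a ^+ 4 * x ^+ 2.
    rewrite -[w * a * 2]mulrAC mulrA divfK ?mulf_neq0 //.
    by rewrite !expr2 !exprS expr0; lra.
  have -> : w / (a * 2) * (w * a * 2) = w ^+ 2.
    rewrite -[w * a * 2]mulrA [w * (a * 2)]mulrC mulrA divfK ?mulf_neq0 //.
  by rewrite !exprS expr0; lra.
by rewrite lerDl divr_ge0 ?sqr_ge0 // !mulr_ge0 // ltW.
Qed.

End chain_step.

(** This bounds the variance of a clipped increment by an area. *)
Lemma clip_sqr_le (x y : int) : (clip x - clip y) ^+ 2 <= 2 * `|x - y|.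
Proof.
have d2 : `|clip x - clip y| <= 2 by rewrite /clip; lia.
have d1 : `|clip x - clip y| <= `|x - y| by rewrite /clip; lia.
rewrite -real_normK ?num_real // expr2; apply: le_trans (_ : 2 * `|clip x - clip y| <= _).
  by rewrite ler_wpM2r.
by rewrite ler_wpM2l.
Qed.

Definition sqsum (R : realType) N (w : Z2 -> int) : R :=
  \sum_(x <- cells N) \sum_(y <- cells N) (w (x, y))%:~R ^+ 2.

Lemma sqsum_clip (R : realType) N (f g : Z2 -> int) :
  sqsum R N (fun v => clip (f v) - clip (g v)) <=
  (2 * l1 (cells N) (cells N) (fun v => f v - g v))%:~R.
Proof.
rewrite /sqsum /l1 mulr_sumr rmorph_sum; apply: ler_sum => x _.
rewrite mulr_sumr rmorph_sum; apply: ler_sum => y _.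
by rewrite -rmorphXn /= ler_int clip_sqr_le.
Qed.

Section level_step.
Variables (R : realType) (N c k n : nat) (g : nat -> Z2).
Hypothesis glip : forall t,
  `|(g t.+1).1 - (g t).1| + `|(g t.+1).2 - (g t).2| <= 1.
Hypothesis gconst : forall t, (n * 2 ^ k.+1 <= t)%N -> g t = g 0%N.
Hypothesis n_gt0 : (0 < n)%N.

Let a : R := 2 ^+ c.
Let w : R := 2 ^+ k.
Let s : R := (scale c k)%:R.
Let s' : R := (scale c k.+1)%:R.
Let B : R := (\sum_(i < n) norm1 (bend g k i))%:~R.
Let Q : R := (\sum_(i < n) sqnorm (bend g k i))%:~R.

Let a0 : 0 < a. Proof. exact: exprn_gt0. Qed.
Let w0 : 0 < w. Proof. exact: exprn_gt0. Qed.
Let s0 : 0 < s. Proof. by rewrite ltr0n scale_gt0. Qed.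

Let scale_near l : (scale c l)%:R * a ^+ 2 >= 2 ^+ l :> R /\
  ((scale c l)%:R - 1) * a ^+ 2 <= 2 ^+ l :> R.
Proof.
have aE : a ^+ 2 = (2 ^ (2 * c))%N%:R :> R by rewrite natrX mulnC exprM.
have wE : 2 ^+ l = (2 ^ l)%N%:R :> R by rewrite natrX.
rewrite mulrBl mul1r lerBlDr aE wE -natrM -natrD !ler_nat /scale -expnD.
have [lc|lc] := leqP (2 * c) l; first by rewrite subnK // leq_addr leqnn.
have -> : (l - 2 * c = 0)%N by lia.
by rewrite add0n leq_addl leq_exp2l // ltnW.
Qed.

Let norm1_bend : a * B <= a ^+ 3 * Q / (w * 2) + n%:R * (w / a).
Proof.
rewrite /B /Q !rmorph_sum !mulr_sumr mulr_suml.
rewrite (_ : n%:R * (w / a) = \sum_(i < n) (w / a)); last first.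
  by rewrite sumr_const card_ord mulr_natl.
rewrite -big_split; apply: ler_sum => i _.
move: (bend g k i) => b; rewrite /norm1 /sqnorm /=.
rewrite 2!rmorphD /= !rmorphXn /= !intr_norm mulrDr [a ^+ 3 * _]mulrDr mulrDl.
have h x : a * `|x%:~R| <= a ^+ 3 * x%:~R ^+ 2 / (w * 2) + w / a / 2.
  rewrite -[w / a / 2]mulrA -invfM -[x%:~R ^+ 2]real_normK ?num_real //.
  exact: amgm_scaled.
have := h b.1; have := h b.2; lra.
Qed.

(** Here [a / w] is the exponential parameter of the level. The area gives [5 a B + 68 n w / a], the
    code [2 a B + 72 n w / a], and [norm1_bend] replaces the [7 a B], whence 147. The cost has a
    factor 2 because every finer level charges it again at half the price. *)
Lemma level_step :
  a / w / 2 * sqsum R N (fun v => clip (polygon_weight (vertex c g k) (2 * n) v)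
                         - clip (polygon_weight (vertex c g k.+1) n v))
    + (word_cost (walk_word c g k n))%:R * (2 * (w / a)) <=
  147 * (n%:R * (w / a)) + 7 * (a ^+ 3 * Q / (w * 2)).
Proof.
have u0 : 0 < w / a by rewrite divr_gt0.
have gn : g (n * 2 ^ k.+1)%N = g 0%N by exact: gconst.
have uE : w / a * a = w by rewrite divfK // gt_eqF.
have G1 : a / w / 2 * sqsum R N (fun v =>
    clip (polygon_weight (vertex c g k) (2 * n) v)
    - clip (polygon_weight (vertex c g k.+1) n v)) <=
    5 * (a * B) + n%:R * (68 * (w / a)).
  have := sqsum_clip R N (polygon_weight (vertex c g k) (2 * n))
    (polygon_weight (vertex c g k.+1) n).
  have := l1_refine c glip (irange_uniq _ _) (irange_uniq _ _) gn
    (xs := cells N) (ys := cells N).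
  rewrite -(ler_int R) => l1le; rewrite rmorphM /=.
  have sE : (\sum_(i < n) (5 * ((2 ^ k)%N%:Z *
     (norm1 (bend g k i) + 4 * ((scale c k)%:Z - 1))) +
     24 * ((2 ^ k)%N%:Z * ((scale c k.+1)%:Z - 1))))%:~R =
     w * (5 * B + n%:R * (20 * (s - 1) + 24 * (s' - 1))) :> R.
    rewrite /B !rmorph_sum mulr_sumr (_ : n%:R * _ =
      \sum_(i < n) (20 * (s - 1) + 24 * (s' - 1))); last first.
      by rewrite sumr_const card_ord mulr_natl.
    rewrite -big_split mulr_sumr; apply: eq_bigr => i _ /=.
    have -> : w = (2 ^ k)%N%:Z%:~R by rewrite -pmulrn natrX.
    rewrite !(rmorphD, rmorphM, rmorphB) /= -!pmulrn.
    rewrite -/s -/s'; lra.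
  rewrite sE in l1le; move: l1le; set X : R := _%:~R; set Y := sqsum _ _ _ => l1le YX.
  have {}YX : Y <= 2 * (w * (5 * B + n%:R * (20 * (s - 1) + 24 * (s' - 1)))).
    by apply: le_trans YX _; rewrite ler_pM2l.
  apply: le_trans (ler_wpM2l _ YX) _; first by rewrite !divr_ge0 // ltW.
  rewrite (_ : a / w / 2 * _ = 5 * (a * B) + n%:R * (20 * ((s - 1) * a) + 24 * ((s' - 1) * a))); last first.
    rewrite [a / w / 2]mulrAC mulrCA !mulrA divfK ?gt_eqF //; lra.
  rewrite lerD2l ler_wpM2l //.
  have t1 : (s - 1) * a <= w / a.
    by rewrite ler_pdivlMr // -mulrA -expr2; have [] := scale_near k.
  have t2 : (s' - 1) * a <= 2 * (w / a).
    by rewrite mulrA ler_pdivlMr // -mulrA -expr2 -exprS; have [] := scale_near k.+1.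
  lra.
have G2 : (word_cost (walk_word c g k n))%:R * (2 * (w / a)) <=
    36 * ((n%:R + 1) * (w / a)) + 2 * (a * B).
  (* A word has [n + 1] letters, the last one coding the closing corner; the walk is constant from
     there on. *)
  have bn : norm1 (bend g k n) = 0.
    rewrite /bend /norm1 /= !gconst ?expnS; try lia.
  have : ((scale c k * word_cost (walk_word c g k n))%N%:Z)%:~R <=
      s * (18 * (n%:R + 1)) + B.
    rewrite /word_cost /walk_word big_map -[iota 0 n.+1]/(index_iota 0 n.+1).
    rewrite big_mkord big_distrr (big_morph Posz PoszD (erefl _)).
    apply: (@le_trans _ _ (\sum_(i < n.+1) (18 * (scale c k)%:Z + norm1 (bend g k i)))%:~R).
      by rewrite ler_int; apply: ler_sum => i _; have [] := walk_letter_cost c glip k i.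
    rewrite big_split /= sumr_const card_ord big_ord_recr /= bn addr0 rmorphD /=.
    rewrite -/B lerD2r rmorphMn /= rmorphM /= -!pmulrn -/s.
    by rewrite -[18 * s *+ _]mulr_natr -natr1; lra.
  rewrite -pmulrn natrM -/s; set C : R := (word_cost _)%:R => sC.
  have us : w / a / s <= a.
    by rewrite ler_pdivrMr // ler_pdivrMr // mulrC mulrA -expr2 mulrC; have [] := scale_near k.
  have -> : C * (2 * (w / a)) = (s * C) * (2 * (w / a / s)).
    by rewrite -[in LHS](divfK (lt0r_neq0 s0) (w / a)); lra.
  apply: le_trans (ler_wpM2r _ sC) _.
    by rewrite mulr_ge0 // ltW // divr_gt0.
  have : B * (w / a / s) <= B * a by rewrite ler_wpM2l // ler0z sumr_ge0.
  have : s * (w / a / s) = w / a by rewrite mulrC divfK ?lt0r_neq0.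
  move: (w / a / s) => v <-; lra.
have := norm1_bend; have n1 : 1 <= n%:R :> R by rewrite ler1n.
have : (n%:R + 1) * (w / a) <= (2 * n%:R) * (w / a) by rewrite ler_pM2r //; lra.
lra.
Qed.
End level_step.

Section chaining.
Variables (R : realType) (N c K : nat) (S : seq letter) (roots : seq Z2).
Variable h : Z2 -> R.

(** The logarithm of a Gaussian exponential weight of mean 1, discounted by the cost. *)
Definition code_exponent m (e : nat * (nat -> Z2) * (nat -> Z2)) : R :=
  let l := 2 ^+ c / 2 ^+ (K - m.+1) in
  l * pairing N h (code_weight e (2 ^ m)) - l ^+ 2 / 2 * sqsum R N (code_weight e (2 ^ m))
  - e.1.1%:R.

Variables (g : nat -> Z2) (ell : R).
Hypothesis glip : forall t,
  `|(g t.+1).1 - (g t).1| + `|(g t.+1).2 - (g t).2| <= 1.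
Hypothesis gconst : forall t, (2 ^ K <= t)%N -> g t = g 0%N.
Hypothesis root_in : snap (scale c K) (g 0%N) \in roots.
Hypothesis letter_in : forall k i, (k < K)%N -> walk_letter c g k i \in S.
Hypothesis exponent_le : forall m e, (m < K)%N -> e \in codes c S roots K m.+1 ->
  code_exponent m e <= ell.

Let a : R := 2 ^+ c.
Let W k v := clip (polygon_weight (vertex c g k) (2 ^ (K - k)) v).

Let pairing0 (w : Z2 -> int) : (forall v, w v = 0) -> pairing N h w = 0.
Proof.
by move=> w0; rewrite /pairing big1 // => x _; rewrite big1 // => y _; rewrite w0 mul0r.
Qed.

(** The accumulated cost stays on the left at the current price, which halves at each refinement.
    Half of it thereby pays the cost charged by the next exponent. *)
Let chain_upto m : (m <= K)%N -> exists2 e, e \in codes c S roots K m &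
  (forall i, (i <= 2 ^ m)%N -> e.1.2 i = vertex c g (K - m) i) /\
  pairing N h (W (K - m)) + e.1.1%:R * (2 ^+ (K - m) / a) <=
  ell * ((2 ^+ K - 2 ^+ (K - m)) / a) + m%:R * (147 * (2 ^+ K / 2 / a))
  + 7 * a ^+ 3 * ((chord_energy g (K - m) (2 ^ m))%:~R / 2 ^+ (K - m)).
Proof.
have a0 : 0 < a by exact: exprn_gt0.
elim: m => [_|m IHm mK].
  (* The coarsest polygon is a single point joined to itself, of weight zero. *)
  rewrite subn0; have vK i : (i <= 1)%N -> snap (scale c K) (g 0%N) = vertex c g K i.
    by rewrite /vertex; case: i => [|[|]] // _; rewrite mul1n (gconst (leqnn _)).
  exists (0%N, fun=> snap (scale c K) (g 0%N), fun=> snap (scale c K) (g 0%N)).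
    exact: map_f.
  split=> [//|]; rewrite mul0r addr0 subrr mul0r mulr0 mul0r !add0r pairing0.
    by rewrite !mulr_ge0 ?invr_ge0 ?exprn_ge0 ?(ltW a0) // ler0z chord_energy_ge0.
  move=> v; rewrite /W /polygon_weight subnn expn0 big_ord1 -(vK 0%N) // -(vK 1%N) //.
  by rewrite seg_id.
have [e ein [eP eb]] := IHm (ltnW mK).
pose k := (K - m.+1)%N; have kE : (K - m = k.+1)%N by rewrite /k; lia.
have KE : (2 ^ K = 2 ^ m * 2 ^ k.+1)%N by rewrite -expnD; congr expn; lia.
have m2 : (2 ^ m.+1 = 2 * 2 ^ m)%N by rewrite expnS.
rewrite kE in eP eb; rewrite -/k.
pose s := walk_word c g k (2 ^ m).
pose e' := ((e.1.1 + word_cost s)%N, refine (scale c k) e.1.2 s, e.1.2).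
have e'in : e' \in codes c S roots K m.+1.
  apply: (allpairs_f (fun (e : nat * (nat -> Z2) * (nat -> Z2)) s =>
    ((e.1.1 + word_cost s)%N, refine (scale c (K - m.+1)) e.1.2 s, e.1.2))) => //.
  apply: mem_words; first by rewrite size_map size_iota.
  by move=> _ /mapP[i _ ->]; apply: letter_in; rewrite /k; lia.
exists e' => //.
have e'P i : (i <= 2 ^ m.+1)%N -> e'.1.2 i = vertex c g k i.
  by rewrite m2; exact: refine_walk_word.
split=> //; have := exponent_le mK e'in; rewrite /code_exponent -/k -/a.
have DE v : code_weight e' (2 ^ m) v = W k v - W k.+1 v.
  rewrite /code_weight /W /polygon_weight -kE (_ : K - (K - m) = m)%N; last by lia.
  rewrite (_ : K - k = m.+1)%N; last by rewrite /k; lia.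
  rewrite m2; congr (clip _ - clip _); apply: eq_bigr => i _.
    by have im : (i < 2 ^ m.+1)%N; [rewrite m2|rewrite !e'P // ltnW].
  by have im := ltn_ord i; rewrite -[e'.2]/(e.1.2) ?kE !eP // ltnW.
have step := @level_step R N c k (2 ^ m) g glip _ (expn_gt0 _ _).
have {step} := step ltac:(rewrite -KE; exact: gconst).
have sE : sqsum R N (code_weight e' (2 ^ m)) =
    sqsum R N (fun v => clip (polygon_weight (vertex c g k) (2 * 2 ^ m) v)
                         - clip (polygon_weight (vertex c g k.+1) (2 ^ m) v)).
  apply: eq_bigr => x _; apply: eq_bigr => y _; rewrite DE /W -kE -m2.
  rewrite (_ : K - (K - m) = m)%N; last by lia.
  by rewrite (_ : K - k = m.+1)%N //; rewrite /k; lia.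
have -> : pairing N h (code_weight e' (2 ^ m)) = pairing N h (W k) - pairing N h (W k.+1).
  rewrite (eq_pairing _ _ DE) /pairing -sumrB; apply: eq_bigr => x _; rewrite -sumrB.
  by apply: eq_bigr => y _; rewrite rmorphB mulrBl.
rewrite -sE -/a -/s natrD -[m.+1%:R]natr1; set D := sqsum _ _ _; set wc := (word_cost s)%:R.
have := chord_energy_bend g k (2 ^ m); rewrite -m2.
set E := chord_energy g k _; set E' := chord_energy g k.+1 _ => EE.
move=> step lo; have := eb.
set w : R := 2 ^+ k; rewrite exprS -/w.
set p := pairing N h (W k); set p' := pairing N h (W k.+1).
have w0 : 0 < w by exact: exprn_gt0.
have KR : 2 ^+ K = (2 ^ m)%N%:R * (2 * w) :> R.
  by rewrite /w -exprS natrX -exprD; congr (_ ^+ _); lia.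
set u := w / a; have u0 : 0 < u by rewrite divr_gt0.
have lo' : p - p' - (a / w) / 2 * D - (e.1.1%:R + wc) * u <= ell * u.
  have : u * (a / w * (p - p') - (a / w) ^+ 2 / 2 * D - (e.1.1%:R + wc)) <= u * ell.
    by rewrite ler_pM2l.
  have ua : u * (a / w) = 1 by rewrite /u mulrA divfK ?lt0r_neq0 // divff ?lt0r_neq0.
  move: (a / w) ua => b ub.
  have -> : u * (b * (p - p') - b ^+ 2 / 2 * D - (e.1.1%:R + wc)) =
      (u * b) * (p - p') - (u * b) * (b / 2 * D) - u * (e.1.1%:R + wc).
    by rewrite expr2; lra.
  by rewrite ub; lra.
have EER : E%:~R / w = E'%:~R / (2 * w) +
    (\sum_(i < 2 ^ m) sqnorm (bend g k i))%:~R / (w * 2) :> R.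
  apply: (@mulIf _ (2 * w)); first by rewrite lt0r_neq0 ?mulr_gt0.
  rewrite [RHS]mulrDl [w * 2]mulrC !divfK ?lt0r_neq0 ?mulr_gt0 // -rmorphD -EE.
  by rewrite rmorphM /= [2 * w]mulrC mulrA divfK ?lt0r_neq0 // mulrC.
rewrite EER [(2 * w) / a](_ : _ = 2 * u); last by rewrite /u mulrA.
move: step; rewrite -/w -/u.
set Q : R := (\sum_(i < _) _)%:~R.
rewrite (_ : 2 ^+ K / 2 / a = (2 ^ m)%N%:R * u); last first.
  by rewrite KR /u; lra.
rewrite [(2 ^+ K - 2 * w) / a]mulrBl [(2 ^+ K - w) / a]mulrBl -/u.
rewrite [(2 * w) / a](_ : _ = 2 * u); last by rewrite /u mulrA.
move: lo'; set X := a / w / 2 * D; rewrite -/E'; lra.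
Qed.

(** At level 0 the mesh is 1 and the polygon is the walk. The prices [2^k / a] sum to less than
    [2^K / a], each of the [K] levels adds [147 / 2] times that, and the bend energy gives [7 a^3]
    per unit length. *)
Lemma pairing_clip_le : 0 <= ell ->
  pairing N h (fun v => clip (polygon_weight g (2 ^ K) v)) <=
  2 ^+ K * ((ell + 74 * K%:R) / 2 ^+ c + 7 * 8 ^+ c).
Proof.
move=> ell0; have [e _ [_]] := chain_upto (leqnn K).
rewrite subnn expr0 divr1.
have W0 v : W 0 v = clip (polygon_weight g (2 ^ K) v).
  rewrite /W subn0; congr clip; apply: eq_bigr => i _.
  have v0 j : vertex c g 0 j = g j.
    rewrite /vertex /snap /snap1 /scale sub0n expn0 muln1 !divz1 !mul1r.
    by rewrite -surjective_pairing.
  by rewrite !v0.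
rewrite (eq_pairing _ _ W0); set p := pairing _ _ _.
have a0 : 0 < a by exact: exprn_gt0.
have E0 : (chord_energy g 0 (2 ^ K))%:~R <= 2 ^+ K :> R.
  by rewrite -natrX pmulrn ler_int chord_energy0_le.
have a3 : 8 ^+ c = a ^+ 3 by rewrite /a -exprM mulnC exprM; congr (_ ^+ _); rewrite -natrX.
have c0 : 0 <= e.1.1%:R * (1 / a) by rewrite mulr_ge0 // divr_ge0 // ltW.
have l0 : 0 <= ell * (1 / a) by rewrite mulr_ge0 // divr_ge0 // ltW.
have k0 : 0 <= K%:R * (2 ^+ K / a) by rewrite mulr_ge0 // divr_ge0 ?exprn_ge0 // ltW.
have E1 : 7 * a ^+ 3 * (chord_energy g 0 (2 ^ K))%:~R <= 7 * a ^+ 3 * 2 ^+ K.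
  by rewrite ler_wpM2l // mulr_ge0 // exprn_ge0 // ltW.
move=> pb; rewrite -/a a3; move: pb c0 l0 k0 E1.
move: (2 ^+ K) => w; lra.
Qed.

End chaining.

(** * The partition function of the codes *)

Definition sym_range n : seq int :=
  [seq i%:Z | i <- iota 0 n.+1] ++ [seq - i%:Z | i <- iota 0 n.+1].

Lemma mem_sym_range n x : `|x| <= n%:Z -> x \in sym_range n.
Proof.
move=> xn; rewrite mem_cat; have [x0|x0] := leP 0 x; apply/orP; [left|right].
  by apply/mapP; exists `|x|%N; rewrite ?mem_iota; lia.
by apply/mapP; exists `|x|%N; rewrite ?mem_iota; lia.
Qed.

Definition alphabet n : seq letter :=
  [seq ((x.1, x.2), (y.1, y.2)) |
    x <- [seq (a, b) | a <- sym_range n, b <- sym_range n],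
    y <- [seq (a, b) | a <- sym_range n, b <- sym_range n]].

Lemma mem_alphabet n (d : letter) : `|d.1.1| <= n%:Z -> `|d.1.2| <= n%:Z ->
  `|d.2.1| <= n%:Z -> `|d.2.2| <= n%:Z -> d \in alphabet n.
Proof.
case: d => [[a b] [a' b']] /= h1 h2 h3 h4.
apply: (allpairs_f (fun x y : Z2 => ((x.1, x.2), (y.1, y.2))) (x := (a, b)) (y := (a', b'))).
  by apply: (allpairs_f pair); exact: mem_sym_range.
by apply: (allpairs_f pair); exact: mem_sym_range.
Qed.

Section counting_codes.
Variable R : realType.
Let q : R := expR (-1).

Let q_ge0 : 0 <= q. Proof. exact: expR_ge0. Qed.

Let q_le : q <= 1 / 2.
Proof.
have e := expR_ge1Dx (1 : R); have e0 := expR_gt0 (1 : R).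
have qe : q * expR 1 = 1 by rewrite /q -expRD addNr expR0.
have : q * 2 <= q * expR 1 by rewrite ler_wpM2l //; lra.
lra.
Qed.

Lemma expR_natN n : expR (- n%:R) = q ^+ n :> R.
Proof. by rewrite /q -expRM_natr; congr expR; lra. Qed.

(** Two geometric series of ratio at most 1/2 sum to at most 4, and [q^2 <= 1/4]. *)
Let sum_sym_range n : q ^+ 2 * \sum_(x <- sym_range n) q ^+ `|x|%N <= 1.
Proof.
have geo m : \sum_(i <- iota 0 m.+1) q ^+ i <= 2.
  rewrite -[iota 0 m.+1]/(index_iota 0 m.+1) big_mkord.
  have := subrX1 q m.+1; set s := \sum_(i < _) _ => sE.
  have s0 : 0 <= s by apply: sumr_ge0 => i _; exact: exprn_ge0.
  have : (1 / 2) * s <= (1 - q) * s by rewrite ler_wpM2r //; have := q_le; lra.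
  have : 0 <= q ^+ m.+1 by exact: exprn_ge0.
  lra.
rewrite /sym_range big_cat !big_map /=.
have -> : \sum_(i <- iota 0 n.+1) q ^+ `|- i%:Z|%N = \sum_(i <- iota 0 n.+1) q ^+ i.
  by apply: eq_bigr => i _; rewrite abszN absz_nat.
have := geo n; set s := \sum_(i <- _) _ => s2.
have s0 : 0 <= s by apply: sumr_ge0 => i _; exact: exprn_ge0.
have : q ^+ 2 * (s + s) <= q ^+ 2 * 4 by rewrite ler_wpM2l ?exprn_ge0 //; lra.
have : q ^+ 2 <= (1 / 2) ^+ 2 by rewrite ler_pXn2r ?nnegrE.
rewrite expr2 expr2; lra.
Qed.

Lemma sum_alphabet n : \sum_(d <- alphabet n) q ^+ letter_cost d <= 1.
Proof.
have := sum_sym_range n; set s := \sum_(x <- _) _ => s1.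
have -> : \sum_(d <- alphabet n) q ^+ letter_cost d = (q ^+ 2 * s) ^+ 4.
  have pairs : \sum_(x <- [seq (a, b) | a <- sym_range n, b <- sym_range n])
      q ^+ (`|x.1| + `|x.2|)%N = s * s.
    rewrite big_allpairs mulr_suml; apply: eq_bigr => x _; rewrite mulr_sumr.
    by apply: eq_bigr => y _; rewrite exprD.
  rewrite /alphabet big_allpairs_dep /=.
  under eq_bigr => x _.
    under eq_bigr => y _.
      rewrite /letter_cost /= -addnA exprD [q ^+ (_ + (_ + _))%N]exprD mulrA.
      over.
    rewrite -mulr_sumr pairs; over.
  rewrite -mulr_suml -mulr_sumr pairs.
  by rewrite exprMn -exprM !exprS expr0; lra.
rewrite exprn_ile1 // mulr_ge0 ?exprn_ge0 // sumr_ge0 // => x _.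
exact: exprn_ge0.
Qed.

Lemma sum_words n l : \sum_(s <- words (alphabet n) l) q ^+ word_cost s <= 1.
Proof.
elim: l => [|l IHl]; first by rewrite big_seq1 /word_cost big_nil.
rewrite -[words _ l.+1]/[seq d :: s | d <- alphabet n, s <- words (alphabet n) l].
rewrite big_allpairs_dep.
under eq_bigr => d _.
  under eq_bigr => s _ do rewrite /word_cost big_cons exprD.
  rewrite -mulr_sumr; over.
rewrite -mulr_suml mulr_ile1 ?sum_alphabet // sumr_ge0 // => ? _; exact: exprn_ge0.
Qed.

(** The words appended at a refinement have total weight at most 1, so refining never increases the
    sum. *)
Lemma sum_codes c n roots K m :
  \sum_(e <- codes c (alphabet n) roots K m) q ^+ e.1.1 <= (size roots)%:R.
Proof.
elim: m => [|m IHm].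
  by rewrite big_map big_const_seq iter_addr_0 count_predT.
rewrite -[codes _ _ _ _ m.+1]/[seq ((e.1.1 + word_cost s)%N,
    refine (scale c (K - m.+1)) e.1.2 s, e.1.2)
  | e <- codes c (alphabet n) roots K m, s <- words (alphabet n) (2 ^ m).+1].
rewrite big_allpairs_dep; apply: le_trans IHm; apply: ler_sum => e _.
under eq_bigr => s _ do rewrite [q ^+ _]exprD.
by rewrite -mulr_sumr ler_piMr ?exprn_ge0 // sum_words.
Qed.

End counting_codes.

Section exponential_weights.
Context d (T : measurableType d) (R : realType) (P : probability T R).
Variable h : Z2 -> {RV P >-> R}.
Hypothesis iid : iid_standard_gaussian h.
Variables N c : nat.

Let cell_seq : seq Z2 := [seq (x, y) | x <- cells N, y <- cells N].

Let cell_seq_uniq : uniq cell_seq.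
Proof. by apply: allpairs_uniq; rewrite ?irange_uniq // => -[? ?] [? ?] _ _ [-> ->]. Qed.

Let exp_weightE (l : R) (w : Z2 -> int) t :
  expR (l * pairing N (h ^~ t) w - l ^+ 2 / 2 * sqsum R N w) =
  expR (- ((\sum_(v <- cell_seq) (l * (w v)%:~R) ^+ 2) / 2)) *
  expR (\sum_(v <- cell_seq) (l * (w v)%:~R) * h v t).
Proof.
rewrite -expRD [in RHS]addrC; congr expR; congr (_ + _).
  rewrite /cell_seq big_allpairs /pairing mulr_sumr; apply: eq_bigr => x _.
  by rewrite mulr_sumr; apply: eq_bigr => y _; rewrite mulrA.
rewrite /cell_seq big_allpairs /sqsum; congr (- _).
rewrite mulrAC mulr_sumr; congr (_ / _); apply: eq_bigr => x _.
by rewrite mulr_sumr; apply: eq_bigr => y _; rewrite exprMn.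
Qed.

Lemma summable_exp_weight (l : R) (w : Z2 -> int) :
  summable P (fun t => expR (l * pairing N (h ^~ t) w - l ^+ 2 / 2 * sqsum R N w)).
Proof.
rewrite (funext (exp_weightE l w)); apply: summableZ.
exact: (summable_expR_lin iid).
Qed.

Lemma mean_exp_weight (l : R) (w : Z2 -> int) :
  mean P (fun t => expR (l * pairing N (h ^~ t) w - l ^+ 2 / 2 * sqsum R N w)) = 1.
Proof.
rewrite (funext (exp_weightE l w)) meanZ; last exact: (summable_expR_lin iid).
by rewrite (mean_expR_lin iid) // -expRD addNr expR0.
Qed.

Let exp_codeE K m e t : expR (code_exponent N c K (h ^~ t) m e) =
  expR (- e.1.1%:R) *
  expR (2 ^+ c / 2 ^+ (K - m.+1) * pairing N (h ^~ t) (code_weight e (2 ^ m)) -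
    (2 ^+ c / 2 ^+ (K - m.+1)) ^+ 2 / 2 * sqsum R N (code_weight e (2 ^ m))).
Proof. by rewrite -expRD addrC. Qed.

Lemma summable_exp_code K m e :
  summable P (fun t => expR (code_exponent N c K (h ^~ t) m e)).
Proof.
rewrite (funext (exp_codeE K m e)); apply: summableZ; exact: summable_exp_weight.
Qed.

Lemma mean_exp_code K m e :
  mean P (fun t => expR (code_exponent N c K (h ^~ t) m e)) = expR (- e.1.1%:R).
Proof.
rewrite (funext (exp_codeE K m e)) meanZ; last exact: summable_exp_weight.
by rewrite mean_exp_weight mulr1.
Qed.

Definition start_vertices K : seq Z2 :=
  [seq snap (scale c K) (x, y) | x <- corners N, y <- corners N].

Variables (n k : nat).

(** Each exponential weight is a summand, so one random number bounds all exponents, for every walk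
    and every scale at once. The leading 1 makes the resulting bound on the exponents
    nonnegative. *)
Definition partition_function (t : T) : R := 1 +
  \sum_(K <- iota 0 k.+1) \sum_(m <- iota 0 k)
    \sum_(e <- codes c (alphabet n) (start_vertices K) K m.+1)
      expR (code_exponent N c K (h ^~ t) m e).

Lemma summable_partition_function : summable P partition_function.
Proof.
apply: summableD; first exact: summable_cst.
apply: summable_sum => K; apply: summable_sum => m; apply: summable_sum => e.
exact: summable_exp_code.
Qed.

Lemma mean_partition_function :
  mean P partition_function <= 1 + (k.+1 ^ 2 * (2 * N.+1) ^ 2)%N%:R.
Proof.
have sm K m : summable P (fun t =>
    \sum_(e <- codes c (alphabet n) (start_vertices K) K m.+1)
      expR (code_exponent N c K (h ^~ t) m e)).
  by apply: summable_sum => e; exact: summable_exp_code.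
rewrite meanD; [|exact: summable_cst|]; last first.
  by apply: summable_sum => K; exact: summable_sum.
rewrite mean_cst lerD2l mean_sum; last by move=> K; exact: summable_sum.
apply: (@le_trans _ _ (\sum_(K <- iota 0 k.+1) \sum_(m <- iota 0 k) ((2 * N.+1) ^ 2)%N%:R)).
  apply: ler_sum => K _; rewrite mean_sum //; apply: ler_sum => m _.
  rewrite mean_sum; last by move=> e; exact: summable_exp_code.
  under eq_bigr => e _ do rewrite mean_exp_code expR_natN.
  apply: le_trans (sum_codes _ _ _ _ _ _) _; rewrite ler_nat.
  by rewrite size_allpairs !size_map !size_iota -mulnn; lia.
rewrite !big_const_seq !count_predT !size_iota !iter_addr_0 -!mulrnA ler_nat.
by rewrite -[X in (X <= _)%N]mulnC; nia.
Qed.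

Lemma code_exponent_le t K m e : (K <= k)%N -> (m < K)%N ->
  e \in codes c (alphabet n) (start_vertices K) K m.+1 ->
  expR (code_exponent N c K (h ^~ t) m e) <= partition_function t.
Proof.
move=> Kk mK ein; have E0 K' m' e' : 0 <= expR (code_exponent N c K' (h ^~ t) m' e').
  exact: expR_ge0.
have S0 K' m' : 0 <= \sum_(e <- codes c (alphabet n) (start_vertices K') K' m'.+1)
      expR (code_exponent N c K' (h ^~ t) m' e) by exact: sumr_ge0.
rewrite /partition_function.
rewrite (perm_big _ (perm_to_rem (_ : K \in iota 0 k.+1))) ?mem_iota //= big_cons.
rewrite (perm_big _ (perm_to_rem (_ : m \in iota 0 k))) ?mem_iota /=; last by lia.
rewrite big_cons (perm_big _ (perm_to_rem ein)) /= big_cons.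
set a := expR _; set s1 := \sum_(_ <- _) _; set s2 := \sum_(_ <- _) _; set s3 := \sum_(_ <- _) _.
have h1 : 0 <= s1 by apply: sumr_ge0 => e' _; exact: E0.
have h2 : 0 <= s2 by apply: sumr_ge0 => m' _; exact: S0.
have h3 : 0 <= s3 by apply: sumr_ge0 => K' _; apply: sumr_ge0 => m' _; exact: S0.
clearbody a s1 s2 s3; lra.
Qed.

Lemma partition_function_ge1 t : 1 <= partition_function t.
Proof.
rewrite lerDl sumr_ge0 // => K _; rewrite sumr_ge0 // => m _; exact: sumr_ge0.
Qed.

End exponential_weights.

(** The logarithm lies below its tangent at [a]. The bound is affine in [z], so with [a] above the
    mean of [Z] it replaces Jensen's inequality. *)
Lemma le_tangent_ln (R : realType) (a x z : R) : 0 < a -> expR x <= z ->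
  x <= z / a + ln a - 1.
Proof.
move=> a0 xz; have := expR_ge1Dx (x - ln a); rewrite expRD expRN lnK ?posrE // => h1.
have : expR x / a <= z / a by rewrite ler_pM2r ?invr_gt0.
lra.
Qed.

Lemma winding_polygon (g : nat -> Z2) L n v : (L <= n)%N ->
  (forall t, (L <= t)%N -> g t = g 0%N) -> winding g L v = polygon_weight g n v.
Proof.
move=> Ln gL; rewrite /winding /polygon_weight.
rewrite -(big_mkord xpredT (fun i => seg (g i) (g i.+1) v)).
rewrite -(big_mkord xpredT (fun i => seg (g i) (g i.+1) v)).
rewrite (big_cat_nat _ Ln) //= [X in _ = _ + X]big_nat_cond [X in _ = _ + X]big1 ?addr0 // => i.
by rewrite andbT => /andP[Li _]; rewrite !gL ?seg_id // leqW.
Qed.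

Lemma pairing_indicator (R : realType) N (h : Z2 -> R) (A : {fset Z2}) :
  {in A, forall v, supnorm v <= N%:Z} ->
  pairing N h (fun v => (v \in A)%:Z) = \sum_(v <- A) h v.
Proof.
move=> AN; rewrite /pairing.
rewrite -(@big_allpairs _ _ _ _ _ (cells N) (cells N) (fun v => (v \in A)%:Z%:~R * h v)).
have -> : \sum_(v <- A) h v = \sum_(v <- [seq (x, y) | x <- cells N, y <- cells N] | v \in A) h v.
  rewrite -[RHS]big_filter; apply: perm_big; apply: uniq_perm.
  - exact: fset_uniq.
  - apply: filter_uniq; apply: allpairs_uniq; rewrite ?irange_uniq //.
    by move=> [? ?] [? ?] _ _ [-> ->].
  move=> v; rewrite mem_filter; case vA: (v \in A); last by rewrite andFb.
  have := AN v vA; rewrite /supnorm ge_max andTb => /andP[xN yN]; apply/esym.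
  case: v xN yN {vA} => x y xN yN; rewrite /= in xN yN.
  by apply: (allpairs_f pair); rewrite /cells mem_irange; lia.
rewrite [RHS]big_mkcond; apply: eq_bigr => v _.
by case: (v \in A); rewrite ?mul1r ?mul0r.
Qed.

Lemma tv_indicator_le N (A : {fset Z2}) :
  tv N (fun v => (v \in A)%:Z) <= (8 * N.+1 ^ 2)%N%:Z.
Proof.
apply: (@le_trans _ _ (\sum_(x <- corners N) \sum_(y <- corners N) 2)).
  apply: ler_sum => x _; apply: ler_sum => y _; rewrite /rflow /uflow /=.
  by case: (_ \in A); case: (_ \in A); case: (_ \in A).
rewrite !big_const_seq !count_predT !size_map !size_iota !iter_addr_0 -mulnn.
rewrite -mulrnA -[_ *+ (_ * _)]mulr_natr natz (_ : (N + N).+2 = 2 * N.+1)%N; last by lia.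
by move: N.+1 => m; lia.
Qed.

(** * The upper bound in expectation *)

Section upper_bound.
Context d (T : measurableType d) (R : realType) (P : probability T R).
Variable h : Z2 -> {RV P >-> R}.
Hypothesis iid : iid_standard_gaussian h.
Variables N c k : nat.
Hypotheses (N_gt0 : (0 < N)%N) (Nk : (8 * N.+1 ^ 2 <= 2 ^ k)%N).
Variable a : R.
Hypothesis a_gt0 : 0 < a.

Let Z := partition_function h N c (2 ^ k.+2 + 4) k.

Let ell t := Z t / a + ln a - 1.

(** The factor 2 is lost when the length of a walk is rounded up to a power of 2. *)
Let M t := 2 * ((ell t + 74 * k%:R) / 2 ^+ c + 7 * 8 ^+ c).

Let ell_ge0 t : 0 <= ell t.
Proof. by apply: le_tangent_ln; rewrite // expR0 partition_function_ge1. Qed.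

Let M_ge0 t : 0 <= M t.
Proof.
rewrite mulr_ge0 // addr_ge0 ?mulr_ge0 ?exprn_ge0 // ?invr_ge0 ?exprn_ge0 //.
by rewrite addr_ge0 ?mulr_ge0.
Qed.

Let walk_le t (g : nat -> Z2) L : (L <= 8 * N.+1 ^ 2)%N ->
  (forall t, in_corners N (g t)) -> (forall t, (L <= t)%N -> g t = g 0%N) ->
  (forall t, (t < L)%N -> unit_step (g t) (g t.+1)) ->
  (forall v, `|winding g L v| <= 1) ->
  pairing N (h ^~ t) (winding g L) <= M t * L%:R.
Proof.
move=> LN gN gL gstep gw.
have glip s : `|(g s.+1).1 - (g s).1| + `|(g s.+1).2 - (g s).2| <= 1.
  have [sL|Ls] := ltnP s L; last by rewrite !gL ?leqW // !subrr.
  have := gstep s sL; move: (g s) (g s.+1) => [x y] [x' y'].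
  by rewrite /unit_step !xpair_eqE /=; lia.
have [L0|L0] := posnP L.
  rewrite L0 mulr0 /pairing big1 // => x _; rewrite big1 // => y _.
  by rewrite /winding big_ord0 mul0r.
pose K := up_log 2 L.
have LK : (L <= 2 ^ K)%N by exact: up_logP.
have KL : (2 ^ K <= 2 * L)%N.
  have [L1|L1] := leqP L 1; first by rewrite /K (_ : L = 1%N) ?up_log1 //; lia.
  have := up_log_bounds (isT : 1 < 2)%N L1; rewrite -/K => /andP[+ _].
  by have : (0 < K)%N; [rewrite up_log_gt0|case: (K) => // j _; rewrite expnS /=; lia].
have Kk : (K <= k)%N by apply: up_log_min => //; lia.
have wE v : winding g L v = clip (polygon_weight g (2 ^ K) v).
  by rewrite -(winding_polygon v LK gL) /clip; have := gw v; lia.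
rewrite (eq_pairing _ _ wE).
apply: (@le_trans _ _ (2 ^+ K * ((ell t + 74 * K%:R) / 2 ^+ c + 7 * 8 ^+ c))).
  apply: (@pairing_clip_le R N c K (alphabet (2 ^ k.+2 + 4)) (start_vertices N c K)) => //.
  - by move=> s Ks; apply: gL; lia.
  - have := gN 0%N; case: (g 0%N) => x y /andP[xN yN].
    apply: (allpairs_f (fun x y => snap (scale c K) (x, y)));
      rewrite mem_irange; move: xN yN => /=; lia.
  - move=> j i jK; have [_ [h1 h2 h3 h4]] := walk_letter_cost c glip j i.
    have jk : (2 ^ j.+2 <= 2 ^ k.+2)%N by rewrite leq_exp2l //; lia.
    by apply: mem_alphabet; lia.
  - move=> m e mK ein; apply: le_tangent_ln => //.
    exact: code_exponent_le ein.
have c0 : 0 <= (2 ^+ c)^-1 :> R by rewrite invr_ge0 exprn_ge0.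
have KkR : K%:R <= k%:R :> R by rewrite ler_nat.
apply: (@le_trans _ _ (2 ^+ K * ((ell t + 74 * k%:R) / 2 ^+ c + 7 * 8 ^+ c))).
  by rewrite ler_wpM2l ?exprn_ge0 // lerD2r ler_wpM2r //; lra.
rewrite /M [2 * _]mulrC -mulrA [X in X <= _]mulrC ler_wpM2l //.
  by have := M_ge0 t; rewrite /M pmulr_rge0.
by rewrite -natrX -natrM ler_nat.
Qed.

Let ratio_le t A : animals N A -> ratio (h ^~ t) A <= M t.
Proof.
move=> [AN _ _]; rewrite /ratio -(pairing_indicator _ AN).
have [b0|b0] := posnP #|` edge_boundary A|; first by rewrite b0 invr0 mulr0.
rewrite ler_pdivrMr ?ltr0n //.
have sA : supported N (fun v => (v \in A)%:Z).
  move=> v; case vA: (v \in A) => // /negP[].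
  by have := AN v vA; rewrite /supnorm ge_max; lia.
apply: le_trans (tv_reduction (M_ge0 t) (@walk_le t) sA (tv_indicator_le N A)) _.
by rewrite ler_wpM2l // pmulrn ler_int tv_indicator.
Qed.

Lemma mean_greedy_le : 1 + (k.+1 ^ 2 * (2 * N.+1) ^ 2)%N%:R <= a ->
  mean P (greedy_animal h N) <= 2 * ((ln a + 74 * k%:R) / 2 ^+ c + 7 * 8 ^+ c).
Proof.
move=> Za; pose b : R := 2 / 2 ^+ c.
pose r : R := b * (ln a - 1 + 74 * k%:R) + 14 * 8 ^+ c.
have ME t : M t = b / a * Z t + r.
  rewrite /M /ell /r /b.
  move: (2 ^+ c)^-1 a^-1 (8 ^+ c) (Z t) => x y z w; lra.
have sZ : summable P Z by exact: summable_partition_function.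
have sM : summable P (fun t => b / a * Z t + r).
  by apply: summableD; [exact: summableZ|exact: summable_cst].
have mono t : greedy_animal h N t <= b / a * Z t + r.
  rewrite -ME /greedy_animal; have aN : animals N `<=` animals N by [].
  have a0 : animals N !=set0.
    exists [fset origin]%fset; split=> [v||u v]; rewrite ?inE //.
      by move=> /eqP ->.
    by move=> /eqP -> /eqP ->; exists [::].
  have [[A AA ->] _] := max_ratioP (h ^~ t) aN a0; exact: ratio_le.
apply: le_trans (le_mean (summable_greedy iid N_gt0) sM mono) _.
rewrite meanD; [|exact: summableZ|exact: summable_cst]; rewrite meanZ // mean_cst.
have Zle : mean P Z <= a by apply: le_trans Za; exact: mean_partition_function.
have : mean P Z / a <= 1 by rewrite ler_pdivrMr // mul1r.
have b0 : 0 <= b by rewrite divr_ge0 // exprn_ge0.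
move=> Z1; have : b * (mean P Z / a) <= b * 1 by rewrite ler_wpM2l.
rewrite /r; move: Z1; have -> : 2 * ((ln a + 74 * k%:R) / 2 ^+ c + 7 * 8 ^+ c) =
    b * (ln a + 74 * k%:R) + 14 * 8 ^+ c.
  by rewrite /b; move: (2 ^+ c)^-1 (8 ^+ c) => x y; lra.
have -> : b / a * mean P Z = b * (mean P Z / a) by rewrite mulrAC mulrA.
lra.
Qed.

End upper_bound.

Section upper_bound_log.
Context d (T : measurableType d) (R : realType) (P : probability T R).
Variable h : Z2 -> {RV P >-> R}.
Hypothesis iid : iid_standard_gaussian h.

Lemma upper_bound N : (3 <= N)%N ->
  mean P (greedy_animal h N) <= 2 ^+ 17 * (ln N%:R) `^ (3 / 4).
Proof.
move=> N3; have [c [K [/andP[_ NK] K0 /andP[Kc _] _ xge]]] := log_scales R N3.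
(* An indicator on the box has total variation at most [8 (N + 1)^2 <= 32 * 4^K], which bounds the
   lengths of the walks. *)
pose k := (2 * K + 5)%N.
have N1 : (N.+1 <= 2 * 2 ^ K)%N by rewrite -expnS.
have K2 : (K < 2 ^ K)%N by exact: ltn_expl.
have kE : (2 ^ k = 32 * 2 ^ K * 2 ^ K)%N.
  by rewrite /k expnD mulnC mul2n -addnn expnD mulnA.
have Nk : (8 * N.+1 ^ 2 <= 2 ^ k)%N.
  by rewrite kE -mulnn; move: (2 ^ K)%N N1 => X N1; nia.
(* With [X = 2^K] the mean of [Z] is at most [1 + 256 X^4], and [256 < 2^9 <= X^9]; only [ln a] of
   order [K] matters. *)
pose a : R := (2 ^ (15 * K))%N%:R.
have a_gt0 : 0 < a by rewrite ltr0n expn_gt0.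
have Za : 1 + (k.+1 ^ 2 * (2 * N.+1) ^ 2)%N%:R <= a.
  rewrite addrC natr1 ler_nat [(15 * K)%N]mulnC expnM.
  have X2 : (2 <= 2 ^ K)%N by rewrite -{1}(expn1 2) leq_exp2l.
  rewrite (_ : k.+1 = 2 * K + 6)%N; last by rewrite /k; lia.
  move: (2 ^ K)%N N1 K2 X2 => X N1 K2 X2.
  have h1 : ((2 * N.+1) ^ 2 <= (4 * X) ^ 2)%N by rewrite leq_exp2r //; lia.
  have h2 : ((2 * K + 6) ^ 2 <= (4 * X) ^ 2)%N by rewrite leq_exp2r //; lia.
  have h3 : (2 ^ 9 * X ^ 4 <= X ^ 9 * X ^ 4)%N by rewrite leq_mul2r leq_exp2r // X2 orbT.
  have h4 : (X ^ 13 <= X ^ 15)%N by rewrite leq_pexp2l //; lia.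
  have h5 := leq_mul h2 h1; apply: leq_ltn_trans h5 _.
  apply: leq_trans h4; rewrite -[13%N]/(9 + 4)%N expnD; apply: leq_trans h3.
  have Y0 : (0 < X ^ 4)%N by rewrite expn_gt0; lia.
  have YE : ((4 * X) ^ 2 * (4 * X) ^ 2 = 256 * X ^ 4)%N by rewrite -expnD expnMn.
  by rewrite YE; move: (X ^ 4)%N Y0 => Y; lia.
have lna : ln a <= 15 * K%:R.
  have /andP[_ ln2] := ln2_bounds R.
  rewrite /a natrX lnXn // -[ln _ *+ _]mulr_natr natrM -[15%:R]/(15 : R).
  have : 0 <= K%:R :> R by [].
  nra.
have := @mean_greedy_le _ _ _ _ h iid N c k ltac:(lia) Nk a a_gt0 Za.
have Kc' : K%:R / 2 ^+ c <= 8 ^+ c :> R.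
  rewrite ler_pdivrMr ?exprn_gt0 // -exprMn (_ : 8 * 2 = 16%:R); last by lra.
  by rewrite -natrX ler_nat.
have K1 : 1 <= K%:R :> R by rewrite ler1n.
(* [15 + 74 * 7 = 533], as [k <= 7 * K]. Then [2 * (533 + 7) * 64] is below [2^17]. *)
have : (ln a + 74 * k%:R) / 2 ^+ c <= 533 * K%:R / 2 ^+ c.
  rewrite ler_pM2r ?invr_gt0 ?exprn_gt0 // /k natrD natrM -[2%:R]/(2 : R) -[5%:R]/(5 : R).
  lra.
rewrite -[533 * _ / _]mulrA; move: Kc' xge (powR_ge0 (ln N%:R : R) (3 / 4)).
move: ((ln a + 74 * k%:R) / 2 ^+ c) (K%:R / 2 ^+ c) (8 ^+ c) (_ `^ _) => u v w x.
have -> : (2 ^+ 17 : R) = 512 * 256 by rewrite !exprS expr0; lra.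
lra.
Qed.

End upper_bound_log.

Theorem theorem1p6 (R : realType) :
  exists2 C : R, 0 < C &
    forall (d : measure_display) (T : measurableType d) (P : probability T R)
           (h : Z2 -> {RV P >-> R}),
      iid_standard_gaussian h ->
      forall N : nat, (3 <= N)%N ->
        [/\ ((C^-1 * (ln N%:R) `^ (3 / 4))%:E
               <= 'E_P[greedy_simply_connected_animal h N])%E,
            ('E_P[greedy_simply_connected_animal h N]
               <= 'E_P[greedy_animal h N])%E &
            ('E_P[greedy_animal h N]
               <= (C * (ln N%:R) `^ (3 / 4))%:E)%E].
Proof.
exists (2 ^+ 42); first exact: exprn_gt0.
move=> d T P h iid N N3; have N0 : (0 < N)%N by exact: ltn_trans N3.
have s1 := summable_greedy_sc iid N0; have s2 := summable_greedy iid N0.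
rewrite !expectation_mean //; split; rewrite lee_fin.
- exact: lower_bound.
- by apply: le_mean => // t; exact: greedy_sc_le.
- apply: le_trans (upper_bound iid N3) _; rewrite ler_wpM2r ?powR_ge0 //.
  by rewrite ler_eXn2l // ltr1n.
Qed.
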